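(* Let $X=\{X_u:u\in\mathbb Z^d\}$ and $Y=\{Y_u:u\in\mathbb Z^d\}$ be stationary ergodic random fields, independent of each other, with values in $A$ and $\hat A$ respectively, and let $$W_n=\inf\{i\ge1:\rho_n(X_{C(n)},Y_{u+C(n)})\le D\text{ for some }u\in[0,i-1]^d\}.$$ (a) If $Y$ is i.i.d. and the average distortion $D_{\rm av}$ is finite, then for any $D\in(D_{\rm min},D_{\rm av})$, $$\frac1{n^d}\log W_n^d\to R_1(P_1,Q_1,D)\quad\text{with probability one.}$$ (b) Suppose that $\rho$ is bounded and that, for $\mathbb P$-almost every realization $x_{[0,\infty)}$ of $X_{[0,\infty)}$, conditional on $X_{[0,\infty)}=x_{[0,\infty)}$, the random variables $\{\rho_n(x_{C(n)},Y_{C(n)})\}$ satisfy a large deviations principle with some deterministic (not depending on $x_{[0,\infty)}$), convex rate-function. Suppose also that the non-uniform $\phi$-mixing coefficients of $Y$ satisfy $$\limsup_{n\to\infty}\sum_{j=1}^\infty(j+1)^{d-1}\phi_n(jn)<\infty.$$ Then, for any $D\in(D_{\rm min}^{(\infty)},D_{\rm av})$, $$\frac1{n^d}\log W_n^d\to R(\mathbb P,\mathbb Q,D)\quad\text{with probability one.}$$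
   Context: $d\ge2$. $A,\hat A$ are complete separable metric spaces with their Borel $\sigma$-fields. Stationary and ergodic means that the translations of $\mathbb Z^d$ act on the laws $\mathbb P$ of $X$ and $\mathbb Q$ of $Y$ in a measure-preserving, ergodic manner. $C(n)=\{u\in\mathbb Z^d:1\le u_j\le n\ \forall j\}$, $[0,\infty)=\{u\in\mathbb Z^d:u_j\ge0\ \forall j\}$, $[0,i-1]^d=\{u\in\mathbb Z^d:0\le u_j\le i-1\ \forall j\}$, $X_U=\{X_u:u\in U\}$, $u+V=\{u+v:v\in V\}$, $\inf\emptyset=+\infty$. $P_n,Q_n$ are the distributions of $X_{C(n)},Y_{C(n)}$. $\rho:A\times\hat A\to[0,\infty)$ is measurable, $\rho_n(x_{C(n)},y_{C(n)})=\frac1{n^d}\sum_{u\in C(n)}\rho(x_u,y_u)$ ($Y_{u+C(n)}$ is identified with a pattern on $C(n)$ by translation). $\log$ is natural. $H(W\|V)=E_W[\log\frac{dW}{dV}]$ if the density exists, $\infty$ otherwise. $D_{\rm av}=E_{P_1\times Q_1}[\rho(X,Y)]$. In (a), $D_{\rm min}=E_{P_1}[\operatorname{ess\,inf}_{Y\sim Q_1}\rho(X,Y)]$; in (b), $D_{\rm min}=\sup_nD_{\rm min}^{(n)}=\lim_nD_{\rm min}^{(n)}$ with $D_{\rm min}^{(n)}=E_{P_n}[\operatorname{ess\,inf}_{Y_{C(n)}\sim Q_n}\rho_n(X_{C(n)},Y_{C(n)})]$. It is assumed that $D_{\rm min}<D_{\rm av}$. $R_n(P_n,Q_n,D)=\inf_{V_n}n^{-d}H(V_n\|P_n\times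 Q_n)$, the infimum over all joint distributions $V_n$ on $A^{n^d}\times\hat A^{n^d}$ with $A^{n^d}$-marginal $P_n$ and $E_{V_n}[\rho_n(X_{C(n)},Y_{C(n)})]\le D$; $R_1(P_1,Q_1,D)$ is the case $n=1$; $R(\mathbb P,\mathbb Q,D)=\lim_nR_n(P_n,Q_n,D)$; $D_{\rm min}^{(\infty)}=\inf\{D\ge0:\sup_{n\ge1}R_n(P_n,Q_n,D)<\infty\}$. LDP: real random variables $Z_n$ satisfy the LDP (here with speed $n^d$) with rate-function $I:\mathbb R\to[0,\infty]$, $I$ lower semicontinuous, if for every Borel $\Gamma$, $-\inf_{\Gamma^\circ}I\le\liminf_nn^{-d}\log\Pr\{Z_n\in\Gamma\}\le\limsup_nn^{-d}\log\Pr\{Z_n\in\Gamma\}\le-\inf_{\overline\Gamma}I$. With $d(v,w)=\max_i|v_i-w_i|$, $d(U,V)=\inf_{v\in U,w\in V}d(v,w)$, $|U|$ the number of points of $U$, and $\sigma(Y_U)$ the $\sigma$-field generated by $Y_U$, the non-uniform $\phi$-mixing coefficients of $Y$ are $$\phi_\ell(k)=\sup\{|\mathbb Q(F|E)-\mathbb Q(F)|:F\in\sigma(Y_U),\,E\in\sigma(Y_V),\,\mathbb Q(E)>0,\,|U|\le\ell,\,|V|<\infty,\,d(U,V)\ge k\}.$$ *)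

(* Defs.v *)
From HB Require Import structures.
From mathcomp Require Import all_boot all_order all_algebra finmap.
From mathcomp Require Import all_classical all_reals all_analysis ess_sup_inf.

Set Implicit Arguments.
Unset Strict Implicit.
Unset Printing Implicit Defensive.

Import Order.TTheory GRing.Theory Num.Theory.
Import numFieldNormedType.Exports.

Local Open Scope classical_set_scope.
Local Open Scope ring_scope.
Local Open Scope charge_scope.

#[short(type="completeMetricType")]
HB.structure Definition CompleteMetric (K : numDomainType) :=
  { T of Metric K T & Complete T }.

Definition separable (T : topologicalType) :=
  exists2 D : set T, countable D & dense D.

Definition borel (T : ptopologicalType) := g_sigma_algebraType (@open T).

(* T^I; the sigma-field below is the product one, not a Borel one *)
Definition config (I T : Type) := I -> T.

Definition config_display : measure_display -> measure_display.
Proof. exact. Qed.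

Section config_measurable.
Context {disp : measure_display} {I : Type} {T : measurableType disp}.

Definition cylinders : set (set (config I T)) :=
  [set E | exists i : I, exists2 B : set T,
     measurable B & E = [set x | B (x i)]].

HB.instance Definition _ := Pointed.copy (config I T) (I -> T).

Let config_set0 : <<s cylinders >> set0.
Proof. exact: sigma_algebra0. Qed.

Let config_setC E : <<s cylinders >> E -> <<s cylinders >> (~` E).
Proof. exact: sigma_algebraC. Qed.

Let config_bigcup (F : (set (config I T))^nat) :
  (forall i, <<s cylinders >> (F i)) -> <<s cylinders >> (\bigcup_i F i).
Proof. exact: sigma_algebra_bigcup. Qed.

HB.instance Definition _ := @isMeasurable.Build (config_display disp)
  (config I T) <<s cylinders >> config_set0 config_setC config_bigcup.

End config_measurable.

Lemma measurable_reindex (disp : measure_display) (I J : Type)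
    (T : measurableType disp) (h : J -> I) :
  measurable_fun [set: config I T] (fun x : config I T => x \o h : config J T).
Proof.
apply: (measurability (@cylinders _ J T)) => // _ [_ [j [B mB ->]] <-].
by rewrite setTI; apply: sub_sigma_algebra; exists (h j), B.
Qed.

Definition lattice (d : nat) := 'rV[int]_d.

Definition cube (d n : nat) : set (lattice d) :=
  [set u | forall j, 1 <= u ord0 j <= n%:Z].

Definition orthant (d : nat) : set (lattice d) :=
  [set u | forall j, 0 <= u ord0 j].

Definition search_box (d i : nat) : set (lattice d) :=
  [set u | forall j, 0 <= u ord0 j <= i%:Z - 1].

Arguments cube : clear implicits.
Arguments orthant : clear implicits.
Arguments search_box : clear implicits.

Lemma cube_orthant (d n : nat) : cube d n `<=` orthant d.
Proof.
by move=> u un j; have /andP[u1 _] := un j; exact: (le_trans ler01 u1).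
Qed.

Section restrictions.
Context {disp : measure_display} {d : nat} {T : measurableType disp}.

(* Two versions of x_U: read off x on the whole lattice, and off x_V *)
Definition restr (U : set (lattice d)) (x : config (lattice d) T) :
  config U T := x \o set_val.

Definition subrestr (U V : set (lattice d)) (UV : U `<=` V) (x : config V T) :
  config U T := x \o subfun UV.

Definition shift (u : lattice d) (x : config (lattice d) T) :
  config (lattice d) T := x \o +%R u.

HB.instance Definition _ (U : set (lattice d)) :=
  isMeasurableFun.Build _ _ _ _ (@restr U) (measurable_reindex set_val).

End restrictions.

Arguments restr {disp d T} U x.

Section random_fields.
Context {R : realType} {d : nat} {disp : measure_display}
  {T : measurableType disp}.
Variable P : probability (config (lattice d) T) R.
Local Open Scope ereal_scope.

Definition stationary := forall (u : lattice d) E,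
  measurable E -> P (shift u @^-1` E) = P E.

Definition ergodic := forall E, measurable E ->
  (forall u : lattice d, shift u @^-1` E = E) -> P E = 0 \/ P E = 1.

Definition iid :=
  (forall (u v : lattice d) (E : set T), measurable E ->
     P [set x | E (x u)] = P [set x | E (x v)]) /\
  (forall (U : {fset lattice d}) (E : lattice d -> set T),
     (forall u, measurable (E u)) ->
     P [set x | forall u, u \in U -> E u (x u)] =
     \prod_(u <- U) P [set x | E u (x u)]).

Definition law_on (U : set (lattice d)) := distribution P (restr U).

(* sigma(x_u : u in U), transported from T^U to the whole path space *)
Definition events_on (U : set (lattice d)) : set (set (config (lattice d) T)) :=
  g_sigma_algebra_preimage (restr U).

Definition ldist (v w : lattice d) : nat :=
  \max_(i < d) `|v ord0 i - w ord0 i|%N.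

Definition set_ldist (U V : set (lattice d)) : \bar R :=
  ereal_inf [set r | exists v w, [/\ U v, V w & r = (ldist v w)%:R%:E]].

Definition phi_mixing (l k : nat) : \bar R :=
  ereal_sup [set r | exists (U V : {fset lattice d}) F E,
    [/\ events_on [set` U] F, events_on [set` V] E, 0 < P E,
        (#|` U| <= l)%N /\ k%:R%:E <= set_ldist [set` U] [set` V] &
        r = (`|fine (P (F `&` E)) / fine (P E) - fine (P F)|%R)%:E]].

End random_fields.

Arguments law_on {R d disp T} P U.

Definition independent_fields {R : realType} {dispO dispA dispB}
    {Omega : measurableType dispO} {A : measurableType dispA}
    {B : measurableType dispB} (Pr : probability Omega R)
    (X : {RV Pr >-> A}) (Y : {RV Pr >-> B}) :=
  forall E F, measurable E -> measurable F ->
    Pr (X @^-1` E `&` Y @^-1` F) = (Pr (X @^-1` E) * Pr (Y @^-1` F))%E.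

Section large_deviations.
Context {R : realType} {disp : measure_display} {T : measurableType disp}.
Local Open Scope ereal_scope.

Definition rate_function (I : R -> \bar R) :=
  (forall z, 0 <= I z) /\ lower_semicontinuous I.

Definition convex_rate (I : R -> \bar R) :=
  forall (t x y : R), (0 <= t <= 1)%R ->
    I (t * x + (1 - t) * y)%R <= t%:E * I x + (1 - t)%:E * I y.

(* The speed is n^d; lne 0 = -oo, and the meaningless term n = 0 plays no role *)
Definition LDP (d : nat) (Pr : probability T R) (Z : nat -> T -> R)
    (I : R -> \bar R) :=
  forall G : set R, measurable G ->
    let rate n := ((n%:R ^+ d)^-1)%:E * lne (Pr (Z n @^-1` G)) in
    [/\ - ereal_inf [set I z | z in G°] <= limn_einf rate,
        limn_einf rate <= limn_esup rate &
        limn_esup rate <= - ereal_inf [set I z | z in closure G]].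

(* The derivative is only determined V-a.e.; it is positive W-a.e., so lne takes
   its value -oo on a W-null set only *)
Definition relative_entropy (W V : probability T R) : \bar R :=
  if `[< W `<< V >]
  then \int[W]_z lne ('d (charge_of_finite_measure W) '/d V z)
  else +oo.

End large_deviations.

Section rate_distortion.
Context {R : realType} {d : nat} {dispA dispB : measure_display}
  {A : measurableType dispA} {B : measurableType dispB}.
Variable rho : A -> B -> R.
Local Open Scope ereal_scope.

Definition rho_n (n : nat) (x : config (cube d n) A) (y : config (cube d n) B) : R :=
  ((n%:R ^+ d)^-1 * \sum_(u \in [set: cube d n]) rho (x u) (y u))%R.

Section pairs_of_laws.
Variables (P : probability (config (lattice d) A) R)
          (Q : probability (config (lattice d) B) R).

Local Notation Pn n := (law_on P (cube d n)).
Local Notation Qn n := (law_on Q (cube d n)).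

(* C(1) is a single site and rho_1 is rho under A^{C(1)} = A, so this is the
   integral of rho against the product of the one-site marginals *)
Definition D_av : \bar R :=
  \int[Pn 1 \x Qn 1]_z (rho_n z.1 z.2)%:E.

Definition D_min (n : nat) : \bar R :=
  \int[Pn n]_x ess_inf (Qn n) (fun y => (rho_n x y)%:E).

Definition D_min_sup : \bar R :=
  ereal_sup [set D_min n | n in [set n | (0 < n)%N]].

Definition couplings (n : nat) (D : R) :
    set (probability (config (cube d n) A * config (cube d n) B)%type R) :=
  [set V | (forall E, measurable E -> V (fst @^-1` E) = Pn n E) /\
           \int[V]_z (rho_n z.1 z.2)%:E <= D%:E].

Definition rate_n (n : nat) (D : R) : \bar R :=
  ereal_inf [set ((n%:R ^+ d)^-1)%:E * relative_entropy V (Pn n \x Qn n)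
            | V in @couplings n D].

Definition D_min_oo : \bar R :=
  ereal_inf [set D%:E | D in [set D : R | (0 <= D)%R /\
    ereal_sup [set rate_n n D | n in [set n | (0 < n)%N]] < +oo]].

(* For a field Y with law Q that is independent of X, the conditional law of Y
   given X = x on the orthant is Q itself, whatever x *)
Definition conditional_LDP (I : R -> \bar R) :=
  {ae law_on P (orthant d), forall x : config (orthant d) A,
    LDP d Q (fun n y => rho_n (subrestr (@cube_orthant d n) x)
                              (restr (cube d n) y)) I}.

End pairs_of_laws.

Definition waiting_time (D : R) (x : config (lattice d) A)
    (y : config (lattice d) B) (n : nat) : \bar R :=
  ereal_inf [set i%:R%:E | i in [set i : nat | (0 < i)%N /\
    exists2 u, search_box d i u &
      (rho_n (restr (cube d n) x) (restr (cube d n) (shift u y)) <= D)%R]].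

Definition log_waiting (D : R) (x : config (lattice d) A)
    (y : config (lattice d) B) (n : nat) : \bar R :=
  ((n%:R ^+ d)^-1)%:E * lne (waiting_time D x y n ^+ d).

End rate_distortion.

(* Main.v *)
Require Import Defs.
From HB Require Import structures.
From mathcomp Require Import all_boot all_order all_algebra finmap.
From mathcomp Require Import all_classical all_reals all_analysis.
From mathcomp Require Import measurable_realfun ess_sup_inf.
From mathcomp Require Import ring lra zify.

(** The waiting time is governed by a matching probability.  Fix a realization
    [x] of the first field and let [p n] be the probability, under the law [Q] of
    the second field, that the mean cost over [C(n)] between [x] and [y] is at most
    [D].  Two facts are needed: for almost every [x], [p n] is
    [exp(- n^d (r + o(1)))] with [r] the announced limit; and matches at distant
    places are nearly independent.

    Given these, the search box of side [i] contains [i^d] places.  If [i^d] is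
    [exp(n^d (r - 2 e))], the expected number of matches decreases exponentially,
    so that by Borel and Cantelli there is none for large [n]
    ([eventually_not_early]).  If [i^d] is a little above [exp(n^d (r + 2 e))], look
    only at a grid of mesh [2 n^d] in the box: the number of matches on the grid has
    a large mean [m], and a variance of order [m] since the correlations at distance
    [j], of which each grid point has [O(j^(d - 1))], are bounded by [psi j] with
    [sum (j + 1)^(d - 1) psi j] bounded ([miss_le]).  By Chebyshev the probability
    of no match is [O(1 / m)], which is summable again ([eventually_late]).  The
    fields being independent, Fubini turns these statements for almost every [x]
    into one for almost every pair ([independent_ae]).  Independent letters give
    [psi = 0].  Under phi-mixing, a block has [n^d] sites and the mesh [2 n^d] leaves
    a distance [j n^d] between two blocks, so that [psi j] is the coefficient
    [phi_(n^d)(j n^d)]: the summability hypothesis is used at the integer [n^d]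
    ([phi_mixing_decoupled]).

    For the rate, let [Z_l(x)] be the [Q]-mean of [exp(l c(x, y))], for a cost [c]
    and [l <= 0], and let [L l] be the [P]-mean of [ln Z_l].  The least relative
    entropy of a coupling with first marginal [P] and mean cost at most [D] is
    [l D - L l] at the slope [l] at which the coupling of density
    [exp(l c) / Z_l] has mean cost [D], and at least [l D - L l] for every [l <= 0]
    ([min_entropy_dual]).  So the rate is the supremum of [l D - L l] over [l <= 0],
    and it remains to find the same supremum in the decay of [p n].

    In part (a), [ln] of the [Q]-mean of [exp(l n^d rho_n)] is, by independence, the
    sum over [C(n)] of the translates of [ln Z_l] for a single letter.  Divided by
    [n^d] it tends to [L l] for almost every [x] by the pointwise ergodic theorem for
    the cubes of [Z^d] ([pointwise_ergodic]), which is proved by covering a large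
    region with disjoint cubes over which the average is large.  An upper bound on
    [p n] is Chernoff's ([decay_upper]); the lower bound is a change of measure to a
    slope where the mean cost is slightly below [D] ([decay_lower]).

    In part (b), the large deviations principle and the boundedness of the cost give
    the same convergence with [L] the Legendre transform of the rate function [I]
    ([dual_rate_limit]).  The limit does not depend on [x], so the means over [P],
    which enter [R_n] by duality, have the same limit.  Since [D] exceeds
    [D_min_oo], the optimal slopes stay in a bounded interval, and [R_n] tends to the
    supremum of [l D - L l] ([dual_exponent_cvg]).  The probability [p n] decays at
    the infimum of [I] over the half line below [D], which is the same number because
    [I] is convex ([rate_below]). *)

Set Implicit Arguments.
Unset Strict Implicit.
Unset Printing Implicit Defensive.

Import Order.TTheory GRing.Theory Num.Theory.
Import numFieldNormedType.Exports.

Local Open Scope classical_set_scope.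
Local Open Scope ring_scope.
Local Open Scope charge_scope.

Local Notation shift := Defs.shift.

(** * Free energies and tilted means *)

Section prob_integral.
Context {R : realType} {d : measure_display} {T : measurableType d}.
Variable P : probability T R.

Lemma bounded_integrable (f : T -> R) (M : R) :
  measurable_fun setT f -> (forall x, `|f x| <= M) ->
  P.-integrable setT (EFin \o f).
Proof.
move=> mf fM; apply: (@le_integrable _ _ _ _ _ measurableT _ (cst M%:E)) => //.
- exact/measurable_EFinP.
- by move=> x _ /=; rewrite lee_fin (le_trans (fM x))// ler_norm.
- exact: finite_measure_integrable_cst.
Qed.

Lemma integrableZ_EFin (k : R) (f : T -> R) :
  P.-integrable setT (EFin \o f) ->
  P.-integrable setT (EFin \o (fun x => k * f x)).
Proof.
move=> fi; rewrite (_ : _ \o _ = (fun x => k%:E * (f x)%:E)%E).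
  exact: (integrableZl measurableT).
by apply/funext => x /=; rewrite EFinM.
Qed.

Lemma integrableD_EFin (f g : T -> R) :
  P.-integrable setT (EFin \o f) -> P.-integrable setT (EFin \o g) ->
  P.-integrable setT (EFin \o (fun x => f x + g x)).
Proof. by move=> fi gi; exact: (integrableD measurableT fi gi). Qed.

Lemma integrableN_EFin (f : T -> R) :
  P.-integrable setT (EFin \o f) -> P.-integrable setT (EFin \o (fun x => - f x)).
Proof.
move=> /(integrableZ_EFin (-1)); congr (integrable _ _ _).
by apply/funext => x /=; rewrite mulN1r.
Qed.

Lemma fine_probability_setT : fine ((P : {measure set T -> \bar R}) setT) = 1.
Proof. by rewrite [X in fine X](probability_setT P). Qed.

Lemma Rintegral_prob_cst (r : R) : \int[P]_x r = r.
Proof. by rewrite Rintegral_cst// fine_probability_setT mulr1. Qed.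

Lemma integral_prob_cst (r : R) : (\int[P]_x r%:E = r%:E)%E.
Proof. by rewrite integral_cst// [X in (_ * X)%E](probability_setT P) mule1. Qed.

Lemma EFin_Rintegral (f : T -> R) : P.-integrable setT (EFin \o f) ->
  (\int[P]_x f x)%:E = (\int[P]_x (f x)%:E)%E.
Proof. by move=> fi; rewrite fineK// integrable_fin_num. Qed.

Lemma Rintegral_gt0 (f : T -> R) : P.-integrable setT (EFin \o f) ->
  (forall x, 0 < f x) -> 0 < \int[P]_x f x.
Proof.
move=> fi f0; rewrite lt_neqAle Rintegral_ge0 ?andbT//; last by move=> x _; exact/ltW.
apply/eqP => If0.
have mf := measurable_int _ fi.
have : (\int[P]_(x in setT) `|(EFin \o f) x| = 0)%E.
  rewrite -[RHS](_ : (\int[P]_x f x)%:E = 0%E); last by rewrite -If0.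
  rewrite EFin_Rintegral//; apply: eq_integral => x _ /=.
  by rewrite ger0_norm// ltW.
move/(ae_eq_integral_abs _ measurableT mf).1 => [N [mN N0 sN]].
have : setT `<=` N.
  by move=> x _; apply: sN => /= /(_ I) [] /eqP; rewrite gt_eqF.
rewrite subTset => NT; move: N0; rewrite NT => /(congr1 fine).
by rewrite fine_probability_setT => /eqP; rewrite oner_eq0.
Qed.

End prob_integral.

Lemma measurable_Rintegral_section (R : realType) (dS dT : measure_display)
    (S : measurableType dS) (T : measurableType dT) (nu : probability T R)
    (F : S * T -> R) :
  measurable_fun setT F -> (forall z, 0 <= F z) ->
  measurable_fun setT (fun x => \int[nu]_y F (x, y)).
Proof.
move=> mF F0; apply: measurableT_comp => //.
apply: (@measurable_fun_fubini_tonelli_F _ _ _ _ _ nu (EFin \o F)).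
- exact/measurable_EFinP.
- by move=> z; rewrite lee_fin.
Qed.

(** Slopes of a convex function increase: add the two subgradient
    inequalities. *)
Lemma subgradients_homo (R : realFieldType) (a b La Lb fa fb : R) : a < b ->
  La + (b - a) * fa <= Lb -> Lb + (a - b) * fb <= La -> fa <= fb.
Proof. by move=> ab h1 h2; rewrite -(ler_pM2l (_ : 0 < b - a)) ?subr_gt0//; lra. Qed.

(** The constant [b^-1 * Fa] bounds all slopes [m] at points [l] between [a] and
    [b] at once, which is what domination near [l] requires. *)
Lemma dominating_slope (R : realFieldType) (b l m Fl Fa : R) : b < 0 -> l < b ->
  0 <= m -> - l * m <= - Fl -> Fa <= Fl -> m <= b^-1 * Fa.
Proof.
move=> b0 lb m0 h1 h2; rewrite -mulrNN -invrN ler_pdivlMl ?oppr_gt0//.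
have : 0 <= (b - l) * m by rewrite mulr_ge0// subr_ge0 ltW.
lra.
Qed.

Lemma minr_le_maxr (R : realDomainType) (a b D : R) : a <= D -> D <= b ->
  Num.min a b <= D <= Num.max a b.
Proof. by move=> aD Db; rewrite ge_min le_max aD Db orbT. Qed.

(** Here [Lb] and [La] are values of a convex function at [- t] and [- t / 2].
    If [- Lb / t] exceeds the midpoint of [D] and the mean [m], then the slope
    [f] at [- t / 2], being at least the slope of the chord from [- t] to
    [- t / 2], exceeds [D]. *)
Lemma tilt_above (R : realFieldType) (t D m La Lb f : R) : 0 < t ->
  La + (- t - - (t / 2)) * f <= Lb -> - La <= - - (t / 2) * m ->
  (D + m) / 2 * t < - Lb -> D < f.
Proof.
move=> t0 h1 h2 h3; have t2 : 0 < t / 2 by rewrite divr_gt0.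
rewrite -(ltr_pM2l t2).
have -> : t / 2 * D = (D + m) / 2 * t - - - (t / 2) * m by field.
have : - t - - (t / 2) = - (t / 2) by field.
by move=> e; rewrite e in h1; lra.
Qed.

Lemma tilt_below (R : realFieldType) (l D L f : R) : l < 0 ->
  - l * f <= - L -> l * D - L < 0 -> f < D.
Proof. by move=> l0 h1 h2; rewrite -(ltr_nM2l l0); lra. Qed.

Section partition_function.
Context {R : realType} {dS dT : measure_display}.
Context {S : measurableType dS} {T : measurableType dT}.
Variables (mu : probability S R) (nu : probability T R).
Variable c : S -> T -> R.
Hypothesis c0 : forall x y, 0 <= c x y.
Hypothesis mc : measurable_fun setT (fun z : S * T => c z.1 z.2).

(** In the terms of statistical mechanics, [l] is minus the inverse temperature;
    only [l <= 0] is used, where everything is bounded by [1] since the cost is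
    nonnegative. *)
Definition partition_fun (l : R) (x : S) : R := \int[nu]_y expR (l * c x y).

Definition free_energy (l : R) (x : S) : R := ln (partition_fun l x).

Definition tilted_mean (l : R) (x : S) : R :=
  (\int[nu]_y (c x y * expR (l * c x y))) / partition_fun l x.

Lemma measurable_section x : measurable_fun setT (c x).
Proof. exact: (measurableT_comp mc (@measurable_pair1 _ _ _ _ x)). Qed.

Lemma measurable_expc (l : R) :
  measurable_fun setT (fun z : S * T => expR (l * c z.1 z.2)).
Proof. by apply: measurableT_comp => //; exact: measurable_funM. Qed.

Lemma expc_le1 (l : R) x y : l <= 0 -> expR (l * c x y) <= 1.
Proof. by move=> l0; rewrite -expR0 ler_expR mulr_le0_ge0. Qed.

Lemma integrable_expc (l : R) x : l <= 0 ->
  nu.-integrable setT (EFin \o (fun y => expR (l * c x y))).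
Proof.
move=> l0; apply: (@bounded_integrable _ _ _ _ _ 1).
  exact: (measurableT_comp (measurable_expc l) (@measurable_pair1 _ _ _ _ x)).
by move=> y; rewrite ger0_norm ?expR_ge0// expc_le1.
Qed.

Lemma partition_fun_gt0 (l : R) x : l <= 0 -> 0 < partition_fun l x.
Proof.
by move=> l0; apply: Rintegral_gt0 => [|y]; [exact: integrable_expc|exact: expR_gt0].
Qed.

Lemma partition_fun_le1 (l : R) x : l <= 0 -> partition_fun l x <= 1.
Proof.
move=> l0; rewrite -[leRHS](Rintegral_prob_cst nu 1).
apply: le_Rintegral => //; first exact: integrable_expc.
- exact: finite_measure_integrable_cst.
- by move=> y _; exact: expc_le1.
Qed.

Lemma free_energy_le0 (l : R) x : l <= 0 -> free_energy l x <= 0.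
Proof. by move=> l0; rewrite ln_le0// partition_fun_le1. Qed.

Lemma expR_free_energy (l : R) x : l <= 0 -> expR (free_energy l x) = partition_fun l x.
Proof. by move=> l0; rewrite lnK// posrE partition_fun_gt0. Qed.

Lemma measurable_partition (l : R) : measurable_fun setT (partition_fun l).
Proof.
apply: (measurable_Rintegral_section nu (measurable_expc l)) => z.
exact: expR_ge0.
Qed.

Lemma measurable_free_energy (l : R) : measurable_fun setT (free_energy l).
Proof. by apply: measurableT_comp => //; exact: measurable_partition. Qed.

(** The maximum of [c e^(l c)] over [c >= 0] is at most [1 / (- l)], so that
    tilted means are finite whether or not [c] is integrable. *)
Lemma cexpc_le (l : R) x y : l < 0 -> c x y * expR (l * c x y) <= (- l)^-1.
Proof.
move=> l0; rewrite -[leRHS]mul1r ler_pdivlMr ?oppr_gt0//.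
rewrite mulrAC -[l * _]opprK expRN ler_pdivrMr ?expR_gt0// mul1r.
by apply: le_trans (expR_ge1Dx _); rewrite mulrN mulrC lerDr.
Qed.

Lemma measurable_cexpc (l : R) :
  measurable_fun setT (fun z : S * T => c z.1 z.2 * expR (l * c z.1 z.2)).
Proof. by apply: measurable_funM => //; exact: measurable_expc. Qed.

Lemma integrable_cexpc (l : R) x : l < 0 ->
  nu.-integrable setT (EFin \o (fun y => c x y * expR (l * c x y))).
Proof.
move=> l0; apply: (@bounded_integrable _ _ _ _ _ (- l)^-1).
  exact: (measurableT_comp (measurable_cexpc l) (@measurable_pair1 _ _ _ _ x)).
by move=> y; rewrite ger0_norm ?cexpc_le// mulr_ge0 ?expR_ge0.
Qed.

Lemma measurable_tilted_mean (l : R) : l < 0 ->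
  measurable_fun setT (tilted_mean l).
Proof.
move=> l0; apply: measurable_funM.
  apply: (measurable_Rintegral_section nu (measurable_cexpc l)) => z.
  by rewrite mulr_ge0// expR_ge0.
rewrite (_ : (fun x => _) = (fun x => expR (- free_energy l x))).
  by apply: measurableT_comp => //; apply: measurableT_comp => //;
     exact: measurable_free_energy.
by apply/funext => x; rewrite expRN expR_free_energy ?ltW.
Qed.

Lemma tilted_mean_ge0 (l : R) x : l <= 0 -> 0 <= tilted_mean l x.
Proof.
move=> l0; rewrite divr_ge0//; last by rewrite ltW// partition_fun_gt0.
by apply: Rintegral_ge0 => y _; rewrite mulr_ge0// expR_ge0.
Qed.

(** Convexity of the free energy, with the tilted mean as slope, without
    differentiating: write [b = l + (b - l)] and apply [e^t >= 1 + t] to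
    [t = (b - l) (c - m)] under the law tilted by [l], where [c - m] has mean
    zero. *)
Lemma free_energy_subgradient (l b : R) x : l < 0 -> b <= 0 ->
  free_energy l x + (b - l) * tilted_mean l x <= free_energy b x.
Proof.
move=> l0 b0; have l0' := ltW l0; set m := tilted_mean l x.
have i1 := integrable_expc x l0'.
have i2 := integrable_cexpc x l0.
have i1' := integrableZ_EFin (1 - (b - l) * m) i1.
have i2' := integrableZ_EFin (b - l) i2.
have i12 := integrableD_EFin i1' i2'.
rewrite -ler_expR expRD !expR_free_energy//.
have -> : partition_fun l x * expR ((b - l) * m) =
    \int[nu]_y (expR ((b - l) * m) *
      ((1 - (b - l) * m) * expR (l * c x y) +
       (b - l) * (c x y * expR (l * c x y)))).
  rewrite RintegralZl// RintegralD// !RintegralZl//.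
  rewrite mulrC; congr (_ * _).
  have -> : \int[nu]_y (c x y * expR (l * c x y)) = m * partition_fun l x.
    by rewrite /m /tilted_mean divfK// gt_eqF// partition_fun_gt0.
  by rewrite -/(partition_fun l x); ring.
apply: le_Rintegral => //; [exact: integrableZ_EFin|exact: integrable_expc|].
move=> y _.
have -> : expR (b * c x y) =
  expR ((b - l) * m) * (expR ((b - l) * (c x y - m)) * expR (l * c x y)).
  by rewrite -!expRD; congr expR; ring.
rewrite ler_pM2l ?expR_gt0//.
apply: le_trans (_ : (1 + (b - l) * (c x y - m)) * expR (l * c x y) <= _).
  by rewrite le_eqVlt; apply/orP; left; apply/eqP; ring.
by rewrite ler_wpM2r ?expR_ge0// expR_ge1Dx.
Qed.

Lemma free_energy0 x : free_energy 0 x = 0.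
Proof.
rewrite /free_energy /partition_fun; under eq_Rintegral do rewrite mul0r expR0.
by rewrite Rintegral_prob_cst ln1.
Qed.

Lemma free_energy_le_partition (l : R) x : l <= 0 ->
  free_energy l x <= partition_fun l x - 1.
Proof.
move=> l0; have := expR_ge1Dx (free_energy l x).
by rewrite expR_free_energy//; lra.
Qed.

(** Jensen's inequality for the exponential, when the mean is finite. *)
Lemma free_energy_ge (l : R) x : l <= 0 ->
  ((- free_energy l x)%:E <= (- l)%:E * \int[nu]_y (c x y)%:E)%E.
Proof.
move=> l0; have G0 : (0 <= \int[nu]_y (c x y)%:E)%E.
  by apply: integral_ge0 => y _; rewrite lee_fin.
have [->|l0'] := eqVneq l 0; first by rewrite free_energy0 !oppr0 mul0e.
have {l0'} : l < 0 by rewrite lt_neqAle l0'.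
case: ltgtP => // lt0 _.
have [Gfin|] := ltP (\int[nu]_y (c x y)%:E)%E +oo%E; last first.
  by rewrite leye_eq => /eqP ->; rewrite gt0_muley ?leey// lte_fin oppr_gt0.
have ci : nu.-integrable setT (EFin \o c x).
  apply/integrableP; split; first by apply/measurable_EFinP; exact: measurable_section.
  by under eq_integral do rewrite /= ger0_norm//.
have Gnum : (\int[nu]_y (c x y)%:E)%E \is a fin_num by rewrite ge0_fin_numE.
rewrite -(fineK Gnum) -EFinM lee_fin mulNr lerN2 -ler_expR expR_free_energy//.
rewrite -/(Rintegral nu setT (c x)); set G := Rintegral _ _ _.
have i1 := integrableZ_EFin l ci.
have i2 : nu.-integrable setT (EFin \o (fun _ : T => 1 - l * G)).
  exact: finite_measure_integrable_cst.
have i12 := integrableD_EFin i1 i2.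
(* The tangent line of the exponential at [l G], whose mean is [exp(l G)]. *)
have -> : expR (l * G) = \int[nu]_y (expR (l * G) * (l * c x y + (1 - l * G))).
  rewrite RintegralZl// RintegralD// RintegralZl// Rintegral_prob_cst.
  by rewrite -/G addrC subrK mulr1.
apply: le_Rintegral => //; [exact: integrableZ_EFin|exact: integrable_expc|].
move=> y _; rewrite -[l * c x y in leRHS](addrNK (l * G)) expRD mulrC.
rewrite ler_pM2r ?expR_gt0//; apply: le_trans (expR_ge1Dx _).
by rewrite le_eqVlt; apply/orP; left; apply/eqP; ring.
Qed.

(** Comparing with the value [0] at the origin bounds the slope. *)
Lemma tilted_mean_le (l : R) x : l < 0 ->
  - l * tilted_mean l x <= - free_energy l x.
Proof.
move=> l0; have := free_energy_subgradient x l0 (lexx 0).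
rewrite free_energy0; rewrite sub0r; lra.
Qed.

Lemma free_energy_homo (l b : R) x : l <= b -> b <= 0 ->
  free_energy l x <= free_energy b x.
Proof.
move=> lb b0; have l0 := le_trans lb b0.
rewrite ler_ln ?posrE ?partition_fun_gt0//; apply: le_Rintegral => //.
- exact: integrable_expc.
- exact: integrable_expc.
- by move=> y _; rewrite ler_expR ler_wpM2r.
Qed.

Definition mean_cost : \bar R := (\int[mu]_x \int[nu]_y (c x y)%:E)%E.

Definition log_mgf (l : R) : R := \int[mu]_x free_energy l x.

Definition tilted_cost (l : R) : R := \int[mu]_x tilted_mean l x.

Hypothesis cfin : (mean_cost < +oo)%E.

Lemma measurable_mean_section :
  measurable_fun setT (fun x => \int[nu]_y (c x y)%:E)%E.
Proof.
apply: (@measurable_fun_fubini_tonelli_F _ _ _ _ _ nu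
  (fun z => (c z.1 z.2)%:E)).
- exact/measurable_EFinP.
- by move=> z; rewrite lee_fin.
Qed.

Lemma integrable_free_energy (l : R) : l <= 0 ->
  mu.-integrable setT (EFin \o free_energy l).
Proof.
move=> l0; apply/integrableP; split.
  by apply/measurable_EFinP; exact: measurable_free_energy.
apply: (@le_lt_trans _ _ (\int[mu]_x ((- l)%:E * \int[nu]_y (c x y)%:E))%E).
  apply: ge0_le_integral => //.
  - apply: measurableT_comp => //; apply/measurable_EFinP.
    exact: measurable_free_energy.
  - by apply: measurable_funeM; exact: measurable_mean_section.
  - move=> x _ /=; rewrite ler0_norm ?free_energy_le0//.
    exact: free_energy_ge.
rewrite ge0_integralZl//; last 2 first.
- by move=> x _; apply: integral_ge0 => y _; rewrite lee_fin.
- by rewrite lee_fin oppr_ge0.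
- by rewrite lte_mul_pinfty// ?lee_fin ?oppr_ge0.
- exact: measurable_mean_section.
Qed.

Lemma log_mgf_ge (l : R) : l <= 0 ->
  ((- log_mgf l)%:E <= (- l)%:E * mean_cost)%E.
Proof.
move=> l0; have iN := integrableN_EFin (integrable_free_energy l0).
have -> : - log_mgf l = \int[mu]_x (- free_energy l x).
  rewrite -mulN1r /log_mgf -(RintegralZl _ measurableT (integrable_free_energy l0)).
  by apply: eq_Rintegral => x _; rewrite mulN1r.
rewrite (EFin_Rintegral iN) -ge0_integralZl//; last 3 first.
- exact: measurable_mean_section.
- by move=> x _; apply: integral_ge0 => y _; rewrite lee_fin.
- by rewrite lee_fin oppr_ge0.
apply: ge0_le_integral => //.
- by move=> x _; rewrite lee_fin oppr_ge0 free_energy_le0.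
- exact: measurable_int iN.
- by apply: measurable_funeM; exact: measurable_mean_section.
- by move=> x _; exact: free_energy_ge.
Qed.

Lemma integrable_tilted_mean (l : R) : l < 0 ->
  mu.-integrable setT (EFin \o tilted_mean l).
Proof.
move=> l0; have := integrableZ_EFin (l^-1) (integrable_free_energy (ltW l0)).
apply: le_integrable => //.
  by apply/measurable_EFinP; exact: measurable_tilted_mean.
move=> x _ /=; rewrite lee_fin (ger0_norm (tilted_mean_ge0 x (ltW l0))).
rewrite normrM ltr0_norm ?invr_lt0// -invrN (ler0_norm (free_energy_le0 x (ltW l0))).
by rewrite ler_pdivlMl ?oppr_gt0//; exact: tilted_mean_le.
Qed.

Lemma log_mgf_subgradient (l b : R) : l < 0 -> b <= 0 ->
  log_mgf l + (b - l) * tilted_cost l <= log_mgf b.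
Proof.
move=> l0 b0; have i1 := integrable_free_energy (ltW l0).
have i2 := integrable_tilted_mean l0.
have i2' := integrableZ_EFin (b - l) i2.
rewrite -(RintegralZl (b - l) measurableT i2) -(RintegralD measurableT i1 i2').
apply: (le_Rintegral measurableT (integrableD_EFin i1 i2') (integrable_free_energy b0)).
by move=> x _; exact: free_energy_subgradient.
Qed.

Lemma log_mgf0 : log_mgf 0 = 0.
Proof.
rewrite /log_mgf; under eq_Rintegral do rewrite free_energy0.
by rewrite Rintegral_prob_cst.
Qed.

Lemma tilted_cost_homo (a b : R) : a < b -> b < 0 ->
  tilted_cost a <= tilted_cost b.
Proof.
move=> ab b0; have a0 := lt_trans ab b0.
have h1 := log_mgf_subgradient a0 (ltW b0).
have h2 := log_mgf_subgradient b0 (ltW a0).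
exact: subgradients_homo ab h1 h2.
Qed.

Lemma tilted_cost_le (l : R) : l < 0 -> - l * tilted_cost l <= - log_mgf l.
Proof. by move=> l0; have := log_mgf_subgradient l0 (lexx 0); rewrite log_mgf0; lra. Qed.

Lemma mean_cost_prod : mean_cost = (\int[mu \x nu]_z (c z.1 z.2)%:E)%E.
Proof.
rewrite (@fubini_tonelli1 _ _ _ _ _ mu nu (fun z => (c z.1 z.2)%:E))//.
- exact/measurable_EFinP.
- by move=> z; rewrite lee_fin.
Qed.

Lemma continuous_expc (k l : R) : {for l, continuous (fun a : R => expR (a * k))}.
Proof.
apply: continuous_comp; [exact: mulrr_continuous|exact: continuous_expR].
Qed.

(** As [s] decreases to [0], the averages of [(1 - e^(- s c)) / s] tend to the
    mean of [c]; they bound [- log_mgf (- s) / s] from below since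
    [- ln z >= 1 - z]. *)
Lemma log_mgf_slope_near0 (D : R) : (D%:E < mean_cost)%E ->
  \forall n \near \oo, D * n.+1%:R^-1 < - log_mgf (- n.+1%:R^-1).
Proof.
move=> Dc; pose h n (z : S * T) := n.+1%:R * (1 + - expR (- n.+1%:R^-1 * c z.1 z.2)).
have h0 n z : 0 <= h n z.
  by rewrite mulr_ge0// subr_ge0 expc_le1// oppr_le0.
have mh n : measurable_fun setT (h n).
  by apply: measurable_funM => //; apply: measurable_funB => //; exact: measurable_expc.
have hc n z : h n z <= c z.1 z.2.
  rewrite /h mulrC -ler_pdivlMr// mulNr mulrC.
  by move: (c z.1 z.2 / n.+1%:R) => t; have := expR_ge1Dx (- t); lra.
have ch n z : c z.1 z.2 * expR (- n.+1%:R^-1 * c z.1 z.2) <= h n z.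
  rewrite /h -ler_pdivrMl// mulrA [n.+1%:R^-1 * _]mulrC mulNr [n.+1%:R^-1 * _]mulrC.
  rewrite -(ler_pM2r (expR_gt0 (c z.1 z.2 / n.+1%:R))).
  rewrite -mulrA mulrBl -expRD addNr expR0 mulr1 mul1r.
  by move: (c z.1 z.2 / n.+1%:R) => t; have := expR_ge1Dx t; lra.
have hcvg : (fun n => \int[mu \x nu]_z (h n z)%:E)%E @ \oo --> mean_cost.
  rewrite mean_cost_prod.
  apply: (@dominated_cvg _ _ _ (mu \x nu)%E setT measurableT
    (fun n z => (h n z)%:E) (fun z => (c z.1 z.2)%:E) (fun z => (c z.1 z.2)%:E)) => //.
  - by move=> n; exact/measurable_EFinP.
  - move=> z _; apply: cvg_EFin; first exact: nearW.
    apply: (@squeeze_cvgr _ _ _ _ (fun n => c z.1 z.2 * expR (- n.+1%:R^-1 * c z.1 z.2))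
      (cst (c z.1 z.2))); last exact: cvg_cst.
      by apply: nearW => n; rewrite ch hc.
    have : (fun n => c z.1 z.2 * expR (- n.+1%:R^-1 * c z.1 z.2)) @ \oo -->
        c z.1 z.2 * expR (- 0 * c z.1 z.2).
      apply: cvgMl_tmp.
      apply: (@cvg_comp _ _ _ (fun n => - n.+1%:R^-1)
        (fun a : R => expR (a * c z.1 z.2)) _ (nbhs (- 0 : R))).
        by apply: cvgN; exact: cvg_harmonic.
      exact: (@continuous_expc (c z.1 z.2)).
    by rewrite oppr0 mul0r expR0 mulr1.
  - apply/integrableP; split; first exact/measurable_EFinP.
    by under eq_integral do rewrite /= ger0_norm//; rewrite -mean_cost_prod.
  - by move=> n z _; rewrite /= lee_fin ger0_norm.
have : \forall n \near \oo, (D%:E < \int[mu \x nu]_z (h n z)%:E)%E.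
  exact: (hcvg _ (open_ereal_gt' Dc)).
apply: filterS => n hD; set s := n.+1%:R^-1.
have s0 : 0 < s by rewrite invr_gt0.
have s0' : - s <= 0 by rewrite oppr_le0 ltW.
have iN := integrableN_EFin (integrable_free_energy s0').
have iE := integrableZ_EFin n.+1%:R iN.
have hs : (\int[mu \x nu]_z (h n z)%:E <= (n.+1%:R * - log_mgf (- s))%:E)%E.
  have -> : ((n.+1%:R * - log_mgf (- s))%:E =
      \int[mu]_x (n.+1%:R * - free_energy (- s) x)%:E)%E.
    rewrite -(EFin_Rintegral iE) (RintegralZl _ measurableT iN).
    congr (_ * _)%:E; rewrite -mulN1r /log_mgf.
    rewrite -(RintegralZl _ measurableT (integrable_free_energy s0')).
    by apply: eq_Rintegral => x _; rewrite mulN1r.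
  rewrite (@fubini_tonelli1 _ _ _ _ _ mu nu (fun z => (h n z)%:E)); last 2 first.
  - exact/measurable_EFinP.
  - by move=> z; rewrite lee_fin.
  apply: ge0_le_integral => //.
  - by move=> x _; apply: integral_ge0 => y _; rewrite lee_fin.
  - apply: (@measurable_fun_fubini_tonelli_F _ _ _ _ _ nu (fun z => (h n z)%:E)).
      exact/measurable_EFinP.
    by move=> z; rewrite lee_fin.
  - exact: measurable_int iE.
  move=> x _; rewrite /fubini_F/=.
  have i1 : nu.-integrable setT (EFin \o (fun _ : T => 1 : R)).
    exact: finite_measure_integrable_cst.
  have ie := integrableN_EFin (integrable_expc x s0').
  have i1e := integrableD_EFin i1 ie.
  have ih := integrableZ_EFin n.+1%:R i1e.
  rewrite -(EFin_Rintegral ih) lee_fin (RintegralZl _ measurableT i1e).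
  rewrite ler_pM2l// (RintegralB measurableT i1 (integrable_expc x s0')).
  rewrite Rintegral_prob_cst -/(partition_fun (- s) x).
  by have := free_energy_le_partition x s0'; lra.
have := lt_le_trans hD hs; rewrite lte_fin => {}hD.
by rewrite ltr_pdivrMr// mulrC.
Qed.

Lemma continuous_tilted_mean (l : R) x : l < 0 ->
  {for l, continuous (tilted_mean ^~ x)}.
Proof.
move=> l0; pose a := l - 1; pose b := l / 2.
have lab : l \in `]a, b[%classic by rewrite inE/= in_itv/= /a /b; lra.
have b0 : b < 0 by rewrite /b; lra.
apply: continuousM; last apply: continuousV.
- have H := @continuity_under_integral R dT T nu
    (fun l y => c x y * expR (l * c x y)) setT measurableT a b.
  apply: (H _ _ (cst (- b)^-1) _ _ _ lab).
  + move=> l' /=; rewrite in_itv/= => /andP[_ lb].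
    by apply: integrable_cexpc; exact: lt_trans lb b0.
  + apply: aeW => y _ l' _; apply: cvgMl_tmp; exact: continuous_expc.
  + exact: finite_measure_integrable_cst.
  + move=> l' /=; rewrite in_itv/= => /andP[_ lb]; apply: aeW => y _.
    have l0' := lt_trans lb b0.
    rewrite ger0_norm ?mulr_ge0 ?expR_ge0//; apply: le_trans (cexpc_le _ _ l0') _.
    by rewrite lef_pV2 ?posrE ?oppr_gt0// lerN2 ltW.
- by rewrite gt_eqF// partition_fun_gt0// ltW.
- have H := @continuity_under_integral R dT T nu
    (fun l y => expR (l * c x y)) setT measurableT a b.
  apply: (H _ _ (cst 1) _ _ _ lab).
  + move=> l' /=; rewrite in_itv/= => /andP[_ lb].
    by apply: integrable_expc; exact: ltW (lt_trans lb b0).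
  + by apply: aeW => y _ l' _; exact: continuous_expc.
  + exact: finite_measure_integrable_cst.
  + move=> l' /=; rewrite in_itv/= => /andP[_ lb]; apply: aeW => y _.
    by rewrite ger0_norm ?expR_ge0// expc_le1// ltW// (lt_trans lb b0).
Qed.

(** Dominated convergence: on a neighbourhood of [l] that stays away from [0],
    the tilted means are bounded by a multiple of the free energy at its left
    end. *)
Lemma continuous_tilted_cost (l : R) : l < 0 -> {for l, continuous tilted_cost}.
Proof.
move=> l0; pose a := l - 1; pose b := l / 2.
have lab : l \in `]a, b[%classic by rewrite inE/= in_itv/= /a /b; lra.
have a0 : a < 0 by rewrite /a; lra.
have b0 : b < 0 by rewrite /b; lra.
have H := @continuity_under_integral R dS S mu tilted_mean setT measurableT a b.
apply: (H _ _ (fun x => b^-1 * free_energy a x) _ _ _ lab).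
- move=> l' /=; rewrite in_itv/= => /andP[_ lb].
  by apply: integrable_tilted_mean; exact: lt_trans b0.
- apply: aeW => x _ l'; rewrite inE/= in_itv/= => /andP[_ lb].
  by apply: continuous_tilted_mean; exact: lt_trans b0.
- exact: integrableZ_EFin (integrable_free_energy (ltW a0)).
- move=> l' /=; rewrite in_itv/= => /andP[al lb]; apply: aeW => x _.
  have l0' := lt_trans lb b0.
  rewrite (ger0_norm (tilted_mean_ge0 x (ltW l0'))).
  have h1 := tilted_mean_le x l0'.
  have h2 := free_energy_homo x (ltW al) (ltW l0').
  have h3 := tilted_mean_ge0 x (ltW l0').
  exact: dominating_slope b0 lb h3 h1 h2.
Qed.

(** The mean under the tilted law runs continuously from below [D] to above [D],
    hence takes the value [D]. It is below [D] at [l1] because the chord of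
    [log_mgf] from [l1] to [0] has slope below [D]; it is above [D] near [0]
    because the slope tends there to the mean cost. *)
Lemma exists_tilt (D l1 : R) : (D%:E < mean_cost)%E -> l1 < 0 ->
  l1 * D - log_mgf l1 < 0 ->
  exists l, [/\ l1 <= l, l < 0 & tilted_cost l = D].
Proof.
move=> Dc l10 l1D.
have f1 : tilted_cost l1 < D.
  have h := tilted_cost_le l10; exact: tilt_below l10 h l1D.
have [s s0 fs] : exists2 s, 0 < s & D < tilted_cost (- s).
  have mfin : mean_cost \is a fin_num.
    rewrite ge0_fin_numE//; apply: integral_ge0 => x _.
    by apply: integral_ge0 => y _; rewrite lee_fin.
  move: Dc; rewrite -(fineK mfin) lte_fin; set m := fine mean_cost => Dm.
  have /log_mgf_slope_near0[n _ /(_ n (leqnn n)) hn] :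
      (((D + m) / 2)%:E < mean_cost)%E.
    by rewrite -(fineK mfin) lte_fin -/m; lra.
  exists (n.+1%:R^-1 / 2); first by rewrite divr_gt0// invr_gt0.
  have t0 : 0 < n.+1%:R^-1 :> R by rewrite invr_gt0.
  move: (n.+1%:R^-1) t0 hn => t t0 ht.
  have l0 : - (t / 2) < 0 by rewrite oppr_lt0 divr_gt0.
  have t0' : - t <= 0 by rewrite oppr_le0 ltW.
  have h1 := log_mgf_subgradient l0 t0'.
  have h2 := log_mgf_ge (ltW l0).
  rewrite -(fineK mfin) -/m -EFinM lee_fin in h2.
  exact: tilt_above t0 h1 h2 ht.
have l1s : l1 < - s.
  rewrite ltNge; apply/negP; rewrite le_eqVlt => /orP[/eqP sl|sl].
    by move: (lt_trans f1 fs); rewrite sl ltxx.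
  have := tilted_cost_homo sl l10.
  by rewrite leNgt (lt_trans f1 fs).
have cf : {within `[l1, - s], continuous tilted_cost}.
  apply: continuous_in_subspaceT => l; rewrite inE/= in_itv/= => /andP[_ ls].
  by apply: continuous_tilted_cost; rewrite (le_lt_trans ls)// oppr_lt0.
have [|l] := IVT (ltW l1s) cf (v := D).
  exact: minr_le_maxr (ltW f1) (ltW fs).
rewrite in_itv/= => /andP[l1l ls] <-; exists l; split=> //.
by rewrite (le_lt_trans ls)// oppr_lt0.
Qed.

End partition_function.

(** * Relative entropy and convex duality *)

Section relative_entropy.
Context {R : realType} {d : measure_display} {T : measurableType d}.
Implicit Types P W : probability T R.

(** A one-sided comparison that lets [g] have integral [+oo], as the logarithm
    of a density may. *)
Lemma le_integral_ae P (f g : T -> \bar R) :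
  P.-integrable setT f -> measurable_fun setT g ->
  {ae P, forall x, (f x <= g x)%E} ->
  (\int[P]_x f x <= \int[P]_x g x)%E.
Proof.
move=> fi mg fg; have mf := measurable_int _ fi.
rewrite [leLHS]integralE [leRHS]integralE; apply: leeB.
- apply: ae_ge0_le_integral => //.
  + exact: measurable_funepos.
  + exact: measurable_funepos.
  + by apply: filterS fg => x fgx _; rewrite !funeposE ge_max !le_max fgx lexx orbT.
- apply: ae_ge0_le_integral => //.
  + exact: measurable_funeneg.
  + exact: measurable_funeneg.
  + apply: filterS fg => x fgx _.
    by rewrite !funenegE ge_max !le_max leeN2 fgx lexx orbT.
Qed.

Lemma measurable_lne_EFin (r : T -> R) : measurable_fun setT r ->
  measurable_fun setT (fun x => lne (r x)%:E).
Proof.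
move=> mr; rewrite /lne; apply: measurable_fun_ifT => //.
- exact: measurable_fun_ler.
- by apply/measurable_EFinP; apply: measurableT_comp.
Qed.

Local Notation density W P := (Radon_Nikodym_SigmaFinite.f W P).

Lemma measurable_density W P : W `<< P ->
  measurable_fun setT (density W P).
Proof. by move=> WP; apply: measurable_int (Radon_Nikodym_SigmaFinite.f_integrable WP). Qed.

Lemma dominates_ae W P (A : set T) : W `<< P ->
  {ae P, forall x, A x} -> {ae W, forall x, A x}.
Proof.
move=> /null_content_dominatesP WP [N [mN PN sN]]; exists N; split=> //.
exact: WP.
Qed.

Lemma relative_entropy_density W P : W `<< P ->
  relative_entropy W P = (\int[W]_x lne (density W P x))%E.
Proof.
move=> WP; rewrite /relative_entropy; case: ifPn => [_|/asboolP//].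
have fin1 x : density W P x \is a fin_num by exact: Radon_Nikodym_SigmaFinite.f_fin_num.
have fin2 x : ('d (charge_of_finite_measure W) '/d P) x \is a fin_num.
  exact: Radon_Nikodym_fin_num.
apply: ae_eq_integral => //.
- rewrite (_ : (fun z => _) = (fun z => lne
    (fine (('d (charge_of_finite_measure W) '/d P) z))%:E)); last first.
    by apply/funext => z; rewrite fineK.
  apply: measurable_lne_EFin; exact: measurableT_comp.
- rewrite (_ : (fun z => _) = (fun z => lne (fine (density W P z))%:E)); last first.
    by apply/funext => z; rewrite fineK.
  by apply: measurable_lne_EFin; apply: measurableT_comp => //; exact: measurable_density.
- apply: (dominates_ae WP).
  have := ae_eq_Radon_Nikodym_SigmaFinite WP measurableT.
  by apply: filterS => x /(_ I) -> _.
Qed.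

(** Gibbs' variational inequality: [log h >= phi + 1 - e^phi / h] for the
    density [h], and the last term integrates to at most [1] under [W]. *)
Lemma relative_entropy_ge P W (phi : T -> R) :
  W.-integrable setT (EFin \o phi) ->
  (\int[P]_x (expR (phi x))%:E = 1)%E ->
  (\int[W]_x (phi x)%:E <= relative_entropy W P)%E.
Proof.
move=> phii phi1.
have [WP|nWP] := pselect (W `<< P); last first.
  by rewrite /relative_entropy; case: ifPn => [/asboolP//|_]; rewrite leey.
rewrite relative_entropy_density//; set h := density W P.
have mphi : measurable_fun setT phi by apply/measurable_EFinP; exact: measurable_int phii.
have hfin x : h x \is a fin_num by exact: Radon_Nikodym_SigmaFinite.f_fin_num.
have mh : measurable_fun setT h by exact: measurable_density.
pose r x := fine (h x).
have hr x : h x = (r x)%:E by rewrite fineK.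
have r0 x : 0 <= r x by rewrite fine_ge0//; exact: Radon_Nikodym_SigmaFinite.f_ge0.
have mr : measurable_fun setT r by apply: measurableT_comp.
(* The quotient [e^phi / h], set to [0] where the density vanishes; that set is
   null for [W] but not for [P]. *)
pose g x := if 0 < r x then expR (phi x - ln (r x)) else 0.
have g0 x : 0 <= g x by rewrite /g; case: ifP => // _; exact: expR_ge0.
have mg : measurable_fun setT g.
  apply: measurable_fun_ifT => //; first exact: measurable_fun_ltr.
  apply: measurableT_comp => //; apply: measurable_funB => //.
  exact: measurableT_comp.
have gh x : g x * r x <= expR (phi x).
  rewrite /g; case: ifPn => [rx|_]; last by rewrite mul0r expR_ge0.
  by rewrite expRB lnK// divfK// gt_eqF.
have ig1 : (\int[W]_x (g x)%:E <= 1)%E.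
  rewrite -phi1.
  rewrite -(@Radon_Nikodym_SigmaFinite.change_of_variables _ _ _ W P WP
    (EFin \o g) setT)//; last exact/measurable_EFinP.
  apply: ge0_le_integral => //.
  - by move=> x _; rewrite -/h hr mule_ge0// lee_fin.
  - by apply: emeasurable_funM => //; exact/measurable_EFinP.
  - by apply/measurable_EFinP; exact: measurableT_comp.
  - by move=> x _; rewrite -/h hr/= -EFinM lee_fin.
have gi : W.-integrable setT (EFin \o g).
  apply/integrableP; split; first exact/measurable_EFinP.
  under eq_integral do rewrite /= ger0_norm//.
  by rewrite (le_lt_trans ig1)// ltry.
have i1 : W.-integrable setT (EFin \o (fun _ : T => 1 : R)).
  exact: finite_measure_integrable_cst.
have iF := integrableD_EFin phii (integrableD_EFin i1 (integrableN_EFin gi)).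
have Fge : (\int[W]_x (phi x)%:E <= \int[W]_x (phi x + (1 + - g x))%:E)%E.
  rewrite -(EFin_Rintegral phii) -(EFin_Rintegral iF) lee_fin.
  rewrite (RintegralD measurableT phii (integrableD_EFin i1 (integrableN_EFin gi))).
  rewrite (RintegralB measurableT i1 gi) Rintegral_prob_cst lerDl subr_ge0.
  by rewrite -lee_fin (EFin_Rintegral gi).
apply: (le_trans Fge); apply: (le_integral_ae iF).
  by under eq_fun do rewrite hr; exact: measurable_lne_EFin.
have mN : measurable [set x | r x <= 0].
  by rewrite -[X in measurable X]setTI; apply: measurable_fun_ler => //.
exists [set x | r x <= 0]; split=> //.
- have := Radon_Nikodym_SigmaFinite.f_integral WP mN => /= ->.
  apply: integral0_eq => x /= rx0; rewrite -/h hr; congr EFin.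
  by apply/eqP; rewrite eq_le rx0 r0.
- move=> x /= /negP; rewrite -ltNge.
  apply: contraTT; rewrite -ltNge -leNgt => rx.
  rewrite hr /g rx /lne (lt_geF rx) lee_fin.
  by have := expR_ge1Dx (phi x - ln (r x)); lra.
Qed.

End relative_entropy.

Section tilting.
Context {R : realType} {d : measure_display} {T : measurableType d}.
Variables (P : probability T R) (phi : T -> R).
Hypothesis mphi : measurable_fun setT phi.
Hypothesis phi1 : (\int[P]_x (expR (phi x))%:E = 1)%E.

(** The two proofs are arguments of the function so that it can carry the
    structure of a probability measure, which depends on them. *)
Definition tilting of measurable_fun setT phi
    & (\int[P]_x (expR (phi x))%:E = 1)%E : set T -> \bar R :=
  fun A => (\int[P]_(x in A) (expR (phi x))%:E)%E.

Local Notation W := (tilting mphi phi1).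

Let W0 : W set0 = 0%E. Proof. by rewrite /tilting integral_set0. Qed.

Let W_ge0 A : (0 <= W A)%E.
Proof. by apply: integral_ge0 => x _; rewrite lee_fin expR_ge0. Qed.

Let W_sigma : semi_sigma_additive W.
Proof.
apply: (@semi_sigma_additive_nng_induced _ _ _ P (fun x => (expR (phi x))%:E)).
- by apply/measurable_EFinP; exact: measurableT_comp.
- by move=> x; rewrite lee_fin expR_ge0.
Qed.

HB.instance Definition _ := isMeasure.Build _ _ _ W W0 W_ge0 W_sigma.

Let W1 : W setT = 1%E. Proof. exact: phi1. Qed.

HB.instance Definition _ := Measure_isProbability.Build _ _ _ W W1.

Definition tilted_law : probability T R := W.

Lemma tilted_lawE A : tilted_law A = (\int[P]_(x in A) (expR (phi x))%:E)%E.
Proof. by []. Qed.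

Lemma tilted_law_dominates : tilted_law `<< P.
Proof.
apply/null_content_dominatesP => A mA PA; rewrite [LHS]tilted_lawE.
by apply: null_set_integral => //; apply: measurable_funTS; apply/measurable_EFinP; exact: measurableT_comp.
Qed.

Local Notation h := (Radon_Nikodym_SigmaFinite.f tilted_law P).

Lemma tilted_law_density : ae_eq P setT h (fun x => (expR (phi x))%:E).
Proof.
apply: integral_ae_eq => //.
- exact: Radon_Nikodym_SigmaFinite.f_integrable tilted_law_dominates.
- by apply/measurable_EFinP; exact: measurableT_comp.
- move=> A _ mA.
  by rewrite -(Radon_Nikodym_SigmaFinite.f_integral tilted_law_dominates mA).
Qed.

Lemma ge0_integral_tilted_law (f : T -> R) : measurable_fun setT f ->
  (forall x, 0 <= f x) ->
  (\int[tilted_law]_x (f x)%:E = \int[P]_x (f x * expR (phi x))%:E)%E.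
Proof.
move=> mf f0; have mf' : measurable_fun setT (EFin \o f) by exact/measurable_EFinP.
rewrite -(@Radon_Nikodym_SigmaFinite.change_of_variables _ _ _ tilted_law P
  tilted_law_dominates (EFin \o f) setT)//.
apply: ae_eq_integral => //.
- by apply: emeasurable_funM => //; exact: measurable_density tilted_law_dominates.
- by apply/measurable_EFinP; apply: measurable_funM => //; exact: measurableT_comp.
- by apply: filterS tilted_law_density => x hx _; rewrite /= hx// EFinM.
Qed.

(** Its density with respect to [P] is [e^phi]. *)
Lemma relative_entropy_tilted_law :
  relative_entropy tilted_law P = (\int[tilted_law]_x (phi x)%:E)%E.
Proof.
have dom := tilted_law_dominates.
rewrite (relative_entropy_density dom); apply: ae_eq_integral => //.
- rewrite (_ : (fun z => _) = (fun z => lne (fine (h z))%:E)); last first.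
    by apply/funext => z; rewrite fineK//; exact: Radon_Nikodym_SigmaFinite.f_fin_num.
  by apply: measurable_lne_EFin; apply: measurableT_comp => //; exact: measurable_density.
- exact/measurable_EFinP.
- apply: (dominates_ae dom).
  apply: filterS tilted_law_density => x hx _.
  by rewrite hx//= leNgt expR_gt0/= expRK.
Qed.

End tilting.

Section duality.
Context {R : realType} {dS dT : measure_display}.
Context {S : measurableType dS} {T : measurableType dT}.
Variables (mu : probability S R) (nu : probability T R).
Variable c : S -> T -> R.
Hypothesis c0 : forall x y, 0 <= c x y.
Hypothesis mc : measurable_fun setT (fun z : S * T => c z.1 z.2).
Hypothesis cfin : (mean_cost mu nu c < +oo)%E.

Local Notation L := (log_mgf mu nu c).

Definition first_marginal_is (V : probability (S * T)%type R) :=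
  forall E, measurable E -> V (fst @^-1` E) = mu E.

Lemma integral_first_marginal (V : probability (S * T)%type R) (f : S -> R) :
  first_marginal_is V -> mu.-integrable setT (EFin \o f) ->
  V.-integrable setT (EFin \o (fun z => f z.1)) /\
  (\int[V]_z (f z.1)%:E = \int[mu]_x (f x)%:E)%E.
Proof.
move=> V1 fi; have mf : measurable_fun setT f.
  by apply/measurable_EFinP; exact: measurable_int fi.
have E (g : S -> \bar R) : (\int[pushforward V fst]_x g x = \int[mu]_x g x)%E.
  by apply: eq_measure_integral => A mA _; exact: V1.
have fV : V.-integrable setT (EFin \o (fun z => f z.1)).
  apply/integrableP; split.
    by apply/measurable_EFinP; exact: (measurableT_comp mf measurable_fst).
  rewrite -[ltLHS](_ : (\int[pushforward V fst]_x `|(f x)%:E| = _)%E).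
    by rewrite E; case/integrableP : fi.
  rewrite (ge0_integral_pushforward measurable_fst)//.
  by apply: measurableT_comp => //; exact/measurable_EFinP.
split=> //; rewrite -E (integral_pushforward measurable_fst)//.
exact/measurable_EFinP.
Qed.

(** Logarithm of the density of the optimal coupling with respect to the product
    law; subtracting the free energy of [x] normalizes each section, which keeps
    the first marginal. *)
Definition tilt_potential (l : R) (z : S * T) : R :=
  l * c z.1 z.2 - free_energy nu c l z.1.

Lemma measurable_tilt_potential l : measurable_fun setT (tilt_potential l).
Proof.
apply: measurable_funB; first exact: measurable_funM.
by apply: measurableT_comp => //; exact: measurable_free_energy.
Qed.

Lemma expR_tilt_potential l x y : l <= 0 -> expR (tilt_potential l (x, y)) =
  (partition_fun nu c l x)^-1 * expR (l * c x y).
Proof. by move=> l0; rewrite expRD expRN expR_free_energy// mulrC. Qed.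

Lemma tilt_potential_section1 l x : l <= 0 ->
  (\int[nu]_y (expR (tilt_potential l (x, y)))%:E = 1)%E.
Proof.
move=> l0; under eq_integral do rewrite expR_tilt_potential//.
rewrite -(EFin_Rintegral (integrableZ_EFin _ (integrable_expc nu c0 mc x l0))).
rewrite (RintegralZl _ measurableT (integrable_expc nu c0 mc x l0)).
by rewrite -/(partition_fun nu c l x) mulVf// gt_eqF// partition_fun_gt0.
Qed.

Lemma tilt_potential1 l : l <= 0 ->
  (\int[mu \x nu]_z (expR (tilt_potential l z))%:E = 1)%E.
Proof.
move=> l0; rewrite (@fubini_tonelli1 _ _ _ _ _ mu nu
  (fun z => (expR (tilt_potential l z))%:E)); last 2 first.
- apply/measurable_EFinP; apply: measurableT_comp => //.
  exact: measurable_tilt_potential.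
- by move=> z; rewrite lee_fin expR_ge0.
rewrite -[RHS](integral_prob_cst mu 1).
apply: eq_integral => x _; rewrite /fubini_F.
exact: tilt_potential_section1.
Qed.

(** Gibbs' inequality for the tilt potential, whose mean is at least [l D - L l]
    for every admissible coupling: [l] is not positive, and the free energy
    depends only on the first coordinate. *)
Lemma relative_entropy_coupling_ge (l D : R) (V : probability (S * T)%type R) :
  l <= 0 -> first_marginal_is V -> (\int[V]_z (c z.1 z.2)%:E <= D%:E)%E ->
  ((l * D - L l)%:E <= relative_entropy V (mu \x nu)%E)%E.
Proof.
move=> l0 V1 VD.
have ci : V.-integrable setT (EFin \o (fun z => c z.1 z.2)).
  apply/integrableP; split; first exact/measurable_EFinP.
  under eq_integral do rewrite /= ger0_norm//.
  by rewrite (le_lt_trans VD)// ltry.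
have iF := integrable_free_energy c0 mc cfin l0.
have [iFV eFV] := integral_first_marginal V1 iF.
have ip : V.-integrable setT (EFin \o tilt_potential l).
  exact: integrableD_EFin (integrableZ_EFin l ci) (integrableN_EFin iFV).
apply: le_trans (relative_entropy_ge ip (tilt_potential1 l0)).
rewrite -(EFin_Rintegral ip) lee_fin /tilt_potential.
rewrite (RintegralB measurableT (integrableZ_EFin l ci) iFV).
rewrite (RintegralZl _ measurableT ci).
have -> : \int[V]_x free_energy nu c l x.1 = L l by rewrite /Rintegral eFV.
rewrite lerD2r ler_wnM2l//.
by rewrite -lee_fin (EFin_Rintegral ci).
Qed.

Definition optimal_coupling (l : R) (l0 : l <= 0) : probability (S * T)%type R :=
  tilted_law (measurable_tilt_potential l) (tilt_potential1 l0).

Lemma optimal_coupling_marginal l (l0 : l <= 0) :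
  first_marginal_is (optimal_coupling l0).
Proof.
move=> E mE; rewrite /optimal_coupling tilted_lawE integral_mkcond.
have mfE : measurable (fst @^-1` E : set (S * T)).
  by rewrite -[X in measurable X]setTI; exact: measurable_fst.
rewrite (@fubini_tonelli1 _ _ _ _ _ mu nu); last 2 first.
- apply/(measurable_restrictT _ mfE); apply: measurable_funTS.
  by apply/measurable_EFinP; apply: measurableT_comp => //; exact: measurable_tilt_potential.
- by move=> z; rewrite patchE; case: ifP; rewrite // lee_fin expR_ge0.
rewrite -[RHS](_ : (\int[mu]_x (\1_E x)%:E = _)%E); last first.
  by rewrite integral_indic// setIT.
apply: eq_integral => x _; rewrite /fubini_F.
have [xE|xE] := boolP (x \in E).
  rewrite indicE xE -(integral_prob_cst nu 1); under eq_integral => y _.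
    rewrite patchE (_ : (x, y) \in _ = true); last exact: xE.
    over.
  by rewrite tilt_potential_section1// integral_prob_cst.
rewrite indicE (negbTE xE); apply: integral0_eq => y _.
by rewrite patchE ifN.
Qed.

Lemma optimal_coupling_cost l (l0 : l < 0) :
  (\int[optimal_coupling (ltW l0)]_z (c z.1 z.2)%:E = (tilted_cost mu nu c l)%:E)%E.
Proof.
rewrite ge0_integral_tilted_law//.
have m1 : measurable_fun setT
    (fun z : S * T => c z.1 z.2 * expR (tilt_potential l z)).
  by apply: measurable_funM => //; apply: measurableT_comp => //; exact: measurable_tilt_potential.
rewrite (@fubini_tonelli1 _ _ _ _ _ mu nu
  (fun z => (c z.1 z.2 * expR (tilt_potential l z))%:E)); last 2 first.
- exact/measurable_EFinP.
- by move=> z; rewrite lee_fin mulr_ge0// expR_ge0.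
rewrite /tilted_cost (EFin_Rintegral (integrable_tilted_mean c0 mc cfin l0)).
apply: eq_integral => x _; rewrite /fubini_F.
have ic := integrable_cexpc nu c0 mc x l0.
under eq_integral => y _.
  rewrite expR_tilt_potential ?(ltW l0)//= mulrCA; over.
rewrite -(EFin_Rintegral (integrableZ_EFin _ ic)) (RintegralZl _ measurableT ic).
by rewrite /tilted_mean mulrC.
Qed.

Lemma relative_entropy_optimal_coupling l (l0 : l < 0) :
  relative_entropy (optimal_coupling (ltW l0)) (mu \x nu)%E =
  (l * tilted_cost mu nu c l - L l)%:E.
Proof.
rewrite relative_entropy_tilted_law.
have e1 := optimal_coupling_cost l0.
have V1 := optimal_coupling_marginal (ltW l0).
rewrite /optimal_coupling in e1 V1.
set V := tilted_law _ _ in e1 V1 *.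
have ci : V.-integrable setT (EFin \o (fun z => c z.1 z.2)).
  apply/integrableP; split; first exact/measurable_EFinP.
  under eq_integral do rewrite /= ger0_norm//.
  by rewrite e1 ltry.
have [iFV eFV] := integral_first_marginal V1 (integrable_free_energy c0 mc cfin (ltW l0)).
have ip := integrableD_EFin (integrableZ_EFin l ci) (integrableN_EFin iFV).
rewrite -(EFin_Rintegral ip) (RintegralB measurableT (integrableZ_EFin l ci) iFV).
rewrite (RintegralZl _ measurableT ci); congr (_ * _ - _)%:E.
  by rewrite /Rintegral e1.
by rewrite /Rintegral eFV.
Qed.

Definition min_entropy (D : R) : \bar R :=
  ereal_inf [set relative_entropy V (mu \x nu)%E | V in
    [set V | first_marginal_is V /\ (\int[V]_z (c z.1 z.2)%:E <= D%:E)%E]].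

Lemma min_entropy_ge (l D : R) : l <= 0 -> ((l * D - L l)%:E <= min_entropy D)%E.
Proof.
move=> l0; apply: le_ereal_inf_tmp => _ [V [V1 VD] <-].
exact: relative_entropy_coupling_ge.
Qed.

(** There is no duality gap at the slope [l] where the tilted mean cost is [D]:
    the optimal coupling attains the bound. *)
Lemma min_entropy_tilted (l : R) : l < 0 ->
  min_entropy (tilted_cost mu nu c l) = (l * tilted_cost mu nu c l - L l)%:E.
Proof.
move=> l0; apply/eqP; rewrite eq_le (min_entropy_ge _ (ltW l0)) andbT.
apply: ereal_inf_lbound; exists (optimal_coupling (ltW l0)).
  by split; [exact: optimal_coupling_marginal|rewrite optimal_coupling_cost].
exact: relative_entropy_optimal_coupling.
Qed.

(** Convex duality for the constrained entropy, with the optimal slope found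
    between [0] and a slope where [l D - L l] is negative. *)
Theorem min_entropy_dual (D l1 : R) : (D%:E < mean_cost mu nu c)%E -> l1 < 0 ->
  l1 * D - L l1 < 0 ->
  exists l, [/\ l1 <= l, l < 0, tilted_cost mu nu c l = D &
    min_entropy D = (l * D - L l)%:E].
Proof.
move=> Dc l10 l1D; have [l [l1l l0 lD]] := exists_tilt c0 mc cfin Dc l10 l1D.
by exists l; split=> //; rewrite -{1}lD min_entropy_tilted// lD.
Qed.

End duality.

(** * The pointwise ergodic theorem along cubes *)

(** Here [e] counts the points to be covered, [w] the total volume of the
    selected boxes and [e1] the points far from them. Weighting the two bounds
    on [e] by [beta] and by the gain converts the volume into the improved
    proportion. *)
Lemma covering_arith (R : realFieldType) (d : nat) (beta eps c e e1 w : R) :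
  0 <= c -> 0 <= beta <= 1 -> beta * (1 + eps) <= (1 + beta) / 2 ->
  e <= e1 + (1 + eps) * w -> e <= 2 ^+ d * w -> 0 <= w ->
  (beta + (1 - beta) / 2 ^+ d.+1) * c * e <= c * w + beta * c * e1.
Proof.
move=> c0 /andP[b0 b1] beps h1 h2 w0; have d2 : 0 < 2 ^+ d :> R by rewrite exprn_gt0.
have bc0 : 0 <= beta * c by rewrite mulr_ge0.
have h3 : beta * c * (e - (1 + eps) * w) <= beta * c * e1.
  by apply: ler_wpM2l => //; rewrite lerBlDr.
have h4 : (1 - beta) / 2 ^+ d.+1 * c * e <= (1 - beta) / 2 * c * w.
  have -> : (1 - beta) / 2 ^+ d.+1 * c * e = (1 - beta) / 2 * c * (e / 2 ^+ d).
    by rewrite exprS; field; rewrite gt_eqF.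
  apply: ler_wpM2l; last by rewrite ler_pdivrMr// mulrC.
  by rewrite mulr_ge0// mulr_ge0// subr_ge0.
have h5 : (beta * (1 + eps)) * (c * w) <= (1 + beta) / 2 * (c * w).
  by apply: ler_wpM2r => //; rewrite mulr_ge0.
by lra.
Qed.

Section lattice_boxes.
Context {d : nat}.
Implicit Types (u v a : lattice d) (n m : nat).

(** The corner [a] itself is left out of the box, so that the box at the origin
    is [C(n)]. *)
Definition box_point a n (f : {ffun 'I_d -> 'I_n}) : lattice d :=
  \row_j (a ord0 j + (f j).+1%:Z).

Definition box a n : {fset lattice d} :=
  [fset box_point a f | f : {ffun 'I_d -> 'I_n}]%fset.

Lemma in_box a n u :
  (u \in box a n) = [forall j, a ord0 j < u ord0 j <= a ord0 j + n%:Z].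
Proof.
apply/imfsetP/forallP => [[f _ ->] j|uP].
  by rewrite mxE; move: (nat_of_ord (f j)) (ltn_ord (f j)) (a ord0 j); clear; lia.
have bnd j : (`|(u ord0 j - a ord0 j - 1)%R| < n)%N.
  by move: (uP j); move: (u ord0 j) (a ord0 j); clear; lia.
exists [ffun j => Ordinal (bnd j)] => //.
by apply/rowP => j; rewrite mxE ffunE/=; move: (uP j);
   move: (u ord0 j) (a ord0 j); clear; lia.
Qed.

Lemma card_box a n : #|` box a n| = (n ^ d)%N.
Proof.
rewrite card_imfset/=; last first.
  move=> f g /rowP fg; apply/ffunP => j; apply/val_inj.
  by have := fg j; rewrite !mxE => /addrI [].
by rewrite -cardE card_ffun !card_ord.
Qed.

Lemma box_eq0P a n v : v \in box 0 n -> a + v \in box a n.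
Proof.
by rewrite !in_box => /forallP h; apply/forallP => j; move: (h j); rewrite !mxE;
   move: (a ord0 j) (v ord0 j); clear; lia.
Qed.

Lemma box_translate a n :
  box a n = [fset (a + v)%R | v in box 0 n]%fset.
Proof.
apply/fsetP => u; apply/idP/imfsetP => [ua|[v /= v0 ->]]; last exact: box_eq0P.
exists (u - a); last by rewrite addrC subrK.
rewrite /= in_box; apply/forallP => j.
by move: ua; rewrite in_box => /forallP/(_ j); rewrite !mxE;
   move: (a ord0 j) (u ord0 j); clear; lia.
Qed.

Lemma sum_box (V : nmodType) a n (f : lattice d -> V) :
  \sum_(u <- box a n) f u = \sum_(v <- box 0 n) f (a + v).
Proof.
by rewrite box_translate big_imfset//= => u v _ _; exact: addrI.
Qed.

Lemma box_disjoint_or_near (r : lattice d -> nat) (u0 u : lattice d) :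
  (r u <= r u0)%N -> u \notin box (u0 - const_mx (r u0)%:Z) (2 * r u0)%N ->
  [disjoint box u (r u) & box u0 (r u0)]%fset.
Proof.
move=> ru; apply: contraNT; rewrite -fsetI_eq0 => /fset0Pn[v].
rewrite in_fsetI !in_box => /andP[/forallP h1 /forallP h2].
apply/forallP => j; move: (h1 j) (h2 j) ru; rewrite !mxE.
by move: (u0 ord0 j) (u ord0 j) (v ord0 j) (r u) (r u0); clear; lia.
Qed.

(** Greedy selection: keep a largest box and discard the base points of all
    boxes that meet it. They lie in a box of twice its side, whence the factor
    [2 ^ d]. *)
Lemma vitali_boxes (E : {fset lattice d}) (r : lattice d -> nat) :
  (forall u, u \in E -> (0 < r u)%N) ->
  exists S : {fset lattice d}, [/\ (S `<=` E)%fset,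
    (forall u v, u \in S -> v \in S -> u != v ->
       [disjoint box u (r u) & box v (r v)]%fset) &
    (#|` E| <= 2 ^ d * \sum_(u <- S) r u ^ d)%N].
Proof.
have [m Em] := ubnP #|` E|; elim: m E Em => // m IH E Em r0.
have [->|[w wE]] := fset_0Vmem E.
  by exists fset0; split=> //; rewrite cardfs0.
have [u0 u0E u0max] : exists2 u0, u0 \in E & forall u, u \in E -> (r u <= r u0)%N.
  pose i0 : E := [` wE]%fset.
  pose i := [arg max_(i > i0) r (val i)].
  exists (val i) => [|u uE]; first exact: valP.
  by rewrite /i; case: arg_maxnP => // j _ /(_ [` uE]%fset isT).
pose B := box (u0 - const_mx (r u0)%:Z) (2 * r u0)%N.
have u0B : u0 \in B.
  by rewrite in_box; apply/forallP => j; rewrite !mxE; move: (r0 _ u0E);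
   move: (u0 ord0 j) (r u0); clear; lia.
pose E' := (E `\` B)%fset.
have E'E : (E' `<=` E)%fset by exact: fsubsetDl.
have ltE' : (#|` E'| < m)%N.
  rewrite -ltnS; apply: leq_trans Em; rewrite ltnS -(cardfsID B E) -[ltnLHS]add0n.
  by rewrite ltn_add2r cardfs_gt0; apply/fset0Pn; exists u0; rewrite in_fsetI u0E.
have [|S [SE' Sdis Scard]] := IH E' ltE'.
  by move=> u /(fsubsetP E'E); exact: r0.
have SB u : u \in S -> u \notin B by move=> /(fsubsetP SE'); rewrite in_fsetD => /andP[].
have u0S : u0 \notin S by apply/negP => /SB; rewrite u0B.
have dis0 u : u \in S -> [disjoint box u (r u) & box u0 (r u0)]%fset.
  move=> uS; apply: box_disjoint_or_near; last exact: SB.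
  by apply: u0max; apply: (fsubsetP E'E); exact: (fsubsetP SE').
exists (u0 |` S)%fset; split.
- apply/fsubsetP => u; rewrite in_fset1U => /orP[/eqP->//|/(fsubsetP SE')].
  exact: (fsubsetP E'E).
- move=> u v; rewrite !in_fset1U => /orP[/eqP->|uS] /orP[/eqP->|vS]; rewrite ?eqxx//.
  + by move=> _; rewrite fdisjoint_sym dis0.
  + by move=> _; rewrite dis0.
  + exact: Sdis.
- rewrite big_fsetU1//= mulnDr.
  have -> : #|` E| = (#|` (E `&` B)%fset| + #|` E'|)%N by rewrite cardfsID.
  apply: leq_add Scard; rewrite -expnMn -(card_box (u0 - const_mx (r u0)%:Z)).
  exact: fsubset_leq_card (fsubsetIr _ _).
Qed.

Lemma fsubset_boxP a n (b : lattice d) m :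
  (forall j, b ord0 j <= a ord0 j) ->
  (forall j, a ord0 j + n%:Z <= b ord0 j + m%:Z) ->
  (box a n `<=` box b m)%fset.
Proof.
move=> ab nm; apply/fsubsetP => u; rewrite !in_box => /forallP uP.
apply/forallP => j; move: (ab j) (nm j) (uP j).
by move: (a ord0 j) (b ord0 j) (u ord0 j); clear; lia.
Qed.

Lemma leq_card_bigfcup (I : choiceType) (S : seq I) (F : I -> {fset lattice d}) :
  (#|` \bigcup_(i <- S) F i|%fset <= \sum_(i <- S) #|` F i|)%N.
Proof.
elim: S => [|i S IH]; first by rewrite !big_nil cardfs0.
by rewrite !big_cons cardfsU (leq_trans (leq_subr _ _))// leq_add2l.
Qed.

(** A point is interior when the ball of radius [M] around it, a box of odd
    side, lies in the region. *)
Definition inner M (U : {fset lattice d}) u :=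
  (box (u - const_mx M.+1%:Z) (2 * M).+1 `<=` U)%fset.

Lemma in_ball M u v : (v \in box (u - const_mx M.+1%:Z) (2 * M).+1) =
  [forall j, u ord0 j - M%:Z <= v ord0 j <= u ord0 j + M%:Z].
Proof.
rewrite in_box; apply/forallP/forallP => h j; move: (h j); rewrite !mxE;
  move: (u ord0 j) (v ord0 j); clear; lia.
Qed.

Lemma leq_inner M M' U u : (M <= M')%N -> inner M' U u -> inner M U u.
Proof.
move=> MM'; apply: fsubset_trans; apply: fsubset_boxP => j; rewrite !mxE;
  move: (u ord0 j) MM'; clear; lia.
Qed.

Lemma inner_box M U u n : (n <= M)%N -> inner M U u -> (box u n `<=` U)%fset.
Proof.
move=> nM; apply: fsubset_trans; apply: fsubset_boxP => j; rewrite !mxE;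
  move: (u ord0 j) nM; clear; lia.
Qed.

Context {R : realType}.

(** Disjoint large boxes over which the average is at least [c] are removed, and
    the given bound is applied to what is left. The removed boxes contribute
    their full volume instead of the proportion [beta]; the loss along their
    boundaries is a small proportion of the volume, since their sides exceed
    [n0]. *)
Lemma covering_step (a : lattice d -> R) (c beta eps : R) (M1 M n0 m : nat)
    (G1 G : pred (lattice d)) :
  (forall u, 0 <= a u) -> 0 <= c -> 0 <= beta <= 1 ->
  beta * (1 + eps) <= (1 + beta) / 2 ->
  (forall n, (n0 <= n)%N -> (n + 2 * M1)%:R ^+ d <= (1 + eps) * n%:R ^+ d) ->
  (forall U : {fset lattice d},
     beta * c * #|` [fset u in U | inner M1 U u && G1 u]%fset|%:R
       <= \sum_(u <- U) a u) ->
  (forall u, G u -> G1 u /\ exists n, [/\ (n0 <= n <= m)%N, (0 < n)%N &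
     c * n%:R ^+ d <= \sum_(v <- box u n) a v]) ->
  (M1 <= M)%N -> (m <= M)%N ->
  forall U : {fset lattice d},
    (beta + (1 - beta) / 2 ^+ d.+1) * c *
      #|` [fset u in U | inner M U u && G u]%fset|%:R <= \sum_(u <- U) a u.
Proof.
move=> a0 c0 b0 beps n0P IH GP M1M mM U.
set E := [fset u in U | _]%fset.
have /choice[r rP] : forall u, exists n, u \in E -> [/\ (n0 <= n <= m)%N, (0 < n)%N &
     c * n%:R ^+ d <= \sum_(v <- box u n) a v].
  move=> u; have [uE|nuE] := boolP (u \in E); last by exists 0%N.
  move: uE; rewrite !inE/= => /and3P[_ _ /GP[_ [n nP]]]; exists n => _.
  exact: nP.
have [|S [SE Sdis Scard]] := @vitali_boxes E r; first by move=> u /rP[].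
pose V := (\bigcup_(u <- S) box u (r u))%fset.
have VU : (V `<=` U)%fset.
  apply/bigfcupsP => u uS _; have uE := fsubsetP SE _ uS.
  have [/andP[_ rm] _ _] := rP _ uE.
  move: uE; rewrite !inE/= => /and3P[_ + _].
  by apply: inner_box; exact: leq_trans rm mM.
pose U' := (U `\` V)%fset.
pose E1 := [fset u in U' | inner M1 U' u && G1 u]%fset.
pose v := (\sum_(u <- S) r u ^ d)%N.
have sumU : \sum_(u <- U) a u = \sum_(u <- V) a u + \sum_(u <- U') a u.
  rewrite (big_fsetID _ (mem V))/=; congr (_ + _).
    apply: eq_fbigl => u; rewrite !inE/=.
    by apply/andP/idP => [[]//|uV]; split=> //; exact: (fsubsetP VU).
  by apply: eq_fbigl => u; rewrite !inE/= andbC.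
have sumV : c * v%:R <= \sum_(u <- V) a u.
  rewrite partition_disjoint_bigfcup//= natr_sum mulr_sumr.
  rewrite big_seq [leRHS]big_seq; apply: ler_sum => u uS.
  by rewrite natrX; have [] := rP _ (fsubsetP SE _ uS).
(* A point near no selected box stays interior after the removal; the others lie
   within [M1] of a selected box. *)
have cardE : #|` E|%:R <= #|` E1|%:R + (1 + eps) * v%:R :> R.
  pose N u := box (u - const_mx M1%:Z) (r u + 2 * M1).
  have : (E `<=` E1 `|` \bigcup_(u <- S) N u)%fset.
    apply/fsubsetP => w wE; rewrite in_fsetU.
    have [//|wN] := boolP (w \in (\bigcup_(u <- S) N u)%fset); first by rewrite orbT.
    rewrite orbF; move: (wE); rewrite !inE/= => /and3P[wU wM wG].
    have [G1w _] := GP _ wG; rewrite G1w andbT.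
    suff ball : inner M1 U' w.
      rewrite ball andbT; have := fsubsetP ball w; rewrite in_fsetD; apply.
      by rewrite in_ball; apply/forallP => j; move: (w ord0 j); clear; lia.
    apply/fsubsetP => z; rewrite in_ball => /forallP zw.
    have zU : z \in U.
      apply: (fsubsetP (leq_inner M1M wM)).
      by rewrite in_ball; exact/forallP.
    rewrite in_fsetD zU andbT; apply: contra wN => /bigfcupP[u /andP[uS _]].
    rewrite in_box => /forallP zu; apply/bigfcupP; exists u; first by rewrite uS.
    rewrite in_box; apply/forallP => j; move: (zw j) (zu j); rewrite !mxE.
    by move: (w ord0 j) (z ord0 j) (u ord0 j) (r u); clear; lia.
  move=> /fsubset_leq_card; rewrite cardfsU => /leq_trans/(_ (leq_subr _ _)).
  rewrite -(ler_nat R) natrD => /le_trans; apply; rewrite lerD2l.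
  apply: (@le_trans _ _ (\sum_(u <- S) #|` N u|)%:R).
    by rewrite ler_nat leq_card_bigfcup.
  rewrite !natr_sum mulr_sumr big_seq [leRHS]big_seq; apply: ler_sum => u uS.
  rewrite card_box !natrX; apply: n0P.
  by have [/andP[]] := rP _ (fsubsetP SE _ uS).
have cardS : #|` E|%:R <= 2 ^+ d * v%:R :> R.
  by rewrite -natrX -natrM ler_nat.
have IHU := IH U'; rewrite -/E1 in IHU.
rewrite sumU; apply: le_trans (lerD sumV IHU).
by apply: covering_arith c0 b0 beps cardE cardS _.
Qed.

End lattice_boxes.

Lemma exprn1D_le (R : realFieldType) (t : R) n : 0 <= t <= 1 ->
  (1 + t) ^+ n <= 1 + (2 ^+ n - 1) * t.
Proof.
move=> /andP[t0 t1]; elim: n => [|n IH]; first by rewrite !expr0 subrr mul0r addr0.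
have p1 : 0 <= 2 ^+ n - 1 :> R by rewrite subr_ge0 exprn_ege1// ler1n.
have h : (1 + t) * (1 + t) ^+ n <= (1 + t) * (1 + (2 ^+ n - 1) * t).
  by rewrite ler_wpM2l// addr_ge0.
rewrite exprS (le_trans h)// exprS.
have : (2 ^+ n - 1) * t * t <= (2 ^+ n - 1) * t * 1.
  by apply: ler_wpM2l => //; exact: mulr_ge0.
lra.
Qed.

(** Boxes of large side have small boundary: this is where amenability
    enters. *)
Lemma box_boundary (R : realType) (d M : nat) (eps : R) : 0 < eps ->
  exists2 n0, (0 < n0)%N & forall n, (n0 <= n)%N ->
    (n + M)%:R ^+ d <= (1 + eps) * n%:R ^+ d.
Proof.
move=> e0; pose t := Num.min 1 (eps / 2 ^+ d).
have t0 : 0 < t by rewrite lt_min ltr01 divr_gt0// exprn_gt0.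
have t1 : t <= 1 by rewrite ge_min lexx.
have t2 : 2 ^+ d * t <= eps.
  by rewrite mulrC -ler_pdivlMr ?exprn_gt0// ge_min lexx orbT.
exists (Num.bound (M%:R / t)).+1 => // n n0n.
have nM : M%:R <= t * n%:R.
  rewrite mulrC -ler_pdivrMr//.
  apply: le_trans (ltW (archi_boundP _)) _; first by rewrite divr_ge0// ltW.
  by rewrite ler_nat; exact: ltnW.
apply: (@le_trans _ _ ((1 + t) ^+ d * n%:R ^+ d)).
  rewrite -exprMn lerXn2r ?nnegrE ?mulr_ge0// ?addr_ge0 ?(ltW t0)//.
  by rewrite natrD mulrDl mul1r lerD2l.
rewrite ler_wpM2r ?exprn_ge0//.
apply: le_trans (exprn1D_le _ _) _; first by rewrite t1 ltW.
by rewrite lerD2l (le_trans _ t2)// ler_wpM2r ?(ltW t0)// lerBlDr lerDl.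
Qed.

Lemma small_boundary_loss (R : realFieldType) (b : R) : 0 <= b -> b < 1 ->
  b * (1 + (1 - b) / 2) <= (1 + b) / 2.
Proof. by move=> b0 b1; nra. Qed.

Lemma almost_le (R : realFieldType) (A I : R) : 0 <= A -> 0 <= I ->
  (forall eta, 0 < eta -> eta < 1 -> A * (1 - eta) <= I * (1 + eta)) -> A <= I.
Proof.
move=> A0 I0 h; rewrite leNgt; apply/negP => IA.
have AI : 0 < 2 * (A + I) by lra.
pose eta := (A - I) / (2 * (A + I)).
have e0 : 0 < eta by rewrite divr_gt0// subr_gt0.
have e1 : eta < 1 by rewrite ltr_pdivrMr//; lra.
have eE : eta * (A + I) = (A - I) / 2 by rewrite /eta; field; rewrite gt_eqF//; lra.
by have := h eta e0 e1; lra.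
Qed.

Lemma covering_arith2 (R : realFieldType) (A I p eta N N' : R) :
  0 <= A -> 0 <= I -> 0 < N -> 1 - eta <= p -> N' <= (1 + eta) * N ->
  A * (N * p) <= N' * I -> A * (1 - eta) <= I * (1 + eta).
Proof.
move=> A0 I0 N0 h1 h2 h3.
have h4 : A * N * (1 - eta) <= A * N * p by rewrite ler_wpM2l// mulr_ge0// ltW.
have h5 : N' * I <= (1 + eta) * N * I by rewrite ler_wpM2r.
by rewrite -(ler_pM2l N0); lra.
Qed.

Lemma sum_indicator (R : pzSemiRingType) (K : choiceType) (W : {fset K})
    (p : pred K) :
  \sum_(i <- W) (p i : nat)%:R = #|` [fset u in W | p u]%fset|%:R :> R.
Proof.
rewrite -natr_sum; congr _%:R.
have -> : (\sum_(i <- W) p i = \sum_(i <- W | p i) 1)%N.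
  by rewrite [RHS]big_mkcond; apply: eq_bigr => i _; case: (p i).
have -> : (\sum_(i <- W | p i) 1 = \sum_(i <- [fset u in W | p u]%fset) 1)%N.
  by rewrite big_fset.
by rewrite sum1_size.
Qed.

Section ergodic_averages.
Context {R : realType} {d : nat} {disp : measure_display}.
Context {T : measurableType disp}.
Local Notation X := (config (lattice d) T).
Variable P : probability X R.
Hypothesis P_stat : stationary P.
Hypothesis P_erg : ergodic P.
Implicit Types (g : X -> R) (x : X) (u v : lattice d).

Lemma shiftD u v x : shift u (shift v x) = shift (v + u) x.
Proof. by apply/funext => i; rewrite /shift/= addrA. Qed.

Lemma shift0 x : shift 0 x = x.
Proof. by apply/funext => i; rewrite /shift/= add0r. Qed.

Lemma measurable_shift u : measurable_fun [set: X] (shift u).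
Proof. exact: measurable_reindex. Qed.

Lemma measurable_preimage_shift u (E : set X) : measurable E ->
  measurable (shift u @^-1` E).
Proof. by move=> mE; rewrite -[X in measurable X]setTI; exact: measurable_shift. Qed.

Lemma ge0_integral_shift (g : X -> \bar R) u : measurable_fun setT g ->
  (forall x, 0 <= g x)%E ->
  (\int[P]_x g (shift u x) = \int[P]_x g x)%E.
Proof.
move=> mg g0; transitivity (\int[pushforward P (shift u)]_x g x)%E.
  by rewrite (ge0_integral_pushforward (measurable_shift u)).
by apply: eq_measure_integral => [|mS A mA _]; [exact: measurable_shift|exact: P_stat].
Qed.

Lemma integral_region_sum (h : X -> R) (U : {fset lattice d}) :
  (forall x, 0 <= h x) -> P.-integrable setT (EFin \o h) ->
  (\int[P]_x (\sum_(u <- U) h (shift u x))%:E = (#|` U|%:R * \int[P]_x h x)%:E)%E.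
Proof.
move=> h0 hi; have mh := measurable_int _ hi.
under eq_integral do rewrite -sumEFin.
rewrite ge0_integral_sum//.
- transitivity (\sum_(u <- U) (\int[P]_x h x)%:E)%E.
    apply: eq_bigr => u _.
    by rewrite (@ge0_integral_shift (EFin \o h) u mh) ?EFin_Rintegral.
  by rewrite sumEFin big_const_seq count_predT iter_addr_0 mulr_natl.
- by move=> u; exact: (measurableT_comp mh (measurable_shift u)).
- by move=> u x _; rewrite lee_fin.
Qed.

Variable g : X -> R.
Hypothesis mg : measurable_fun setT g.
Hypothesis g0 : forall x, 0 <= g x.

Definition box_sum n x := \sum_(u <- box 0 n) g (shift u x).

Lemma box_sum_shift u n x :
  box_sum n (shift u x) = \sum_(v <- box u n) g (shift v x).
Proof. by rewrite sum_box; apply: eq_bigr => v _; rewrite shiftD. Qed.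

Lemma measurable_region_sum (U : seq (lattice d)) :
  measurable_fun setT (fun x => \sum_(u <- U) g (shift u x)).
Proof. by apply: measurable_sum => u; apply: measurableT_comp mg (measurable_shift u). Qed.

(** Over every finite region, the sum of [g] is at least [c] times a proportion
    [beta] of the typical interior points. The constant [M] and the set of
    typical points depend on the allowed exceptional probability [eta]. *)
Definition covering (c beta : R) := forall eta : R, 0 < eta ->
  exists M (Om : set X), [/\ measurable Om, (P (~` Om) <= eta%:E)%E &
    forall x (U : {fset lattice d}),
      beta * c * #|` [fset u in U | inner M U u && `[< Om (shift u x) >]]%fset|%:R
        <= \sum_(u <- U) g (shift u x)].

Lemma covering0 c : covering c 0.
Proof.
move=> eta eta0; exists 0%N, setT; split=> //.
  by rewrite setCT measure0 lee_fin ltW.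
by move=> x U; rewrite !mul0r sumr_ge0.
Qed.

(** If arbitrarily large boxes with average at least [c] start at almost every
    point, then up to probability [eta / 2] their sides can be taken below a
    fixed bound [m], and one covering step applies. *)
Lemma covering_improve c beta : 0 <= c -> 0 <= beta < 1 ->
  {ae P, forall x, forall n0, exists2 n, (n0 <= n)%N & c * n%:R ^+ d <= box_sum n x} ->
  covering c beta -> covering c (beta + (1 - beta) / 2 ^+ d.+1).
Proof.
move=> c0 /andP[b0 b1] freq cov eta eta0.
have [|M1 [Om1 [mOm1 POm1 covU]]] := cov (eta / 2); first by rewrite divr_gt0.
pose eps := (1 - beta) / 2.
have eps0 : 0 < eps by rewrite divr_gt0// subr_gt0.
have [n0 n00 n0P] := @box_boundary R d (2 * M1) eps eps0.
pose A n : set X := [set x | c * n%:R ^+ d <= box_sum n x].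
have mA n : measurable (A n).
  rewrite -[X in measurable X]setTI; apply: measurable_fun_ler => //.
  exact: measurable_region_sum.
pose G m : set X := \bigcup_(n in [set n | (n0 <= n <= m)%N]) A n.
have mG m : measurable (G m) by exact: bigcup_measurable.
have GP m x : G m x <-> exists n, [/\ (n0 <= n <= m)%N & A n x].
  by split=> [[n nm Anx]|[n [nm Anx]]]; exists n.
have [m PGm] : exists m, (P (~` G m) <= (eta / 2)%:E)%E.
  have Gcvg : (fun m => P (~` G m)) @ \oo --> P (\bigcap_m ~` G m).
    apply: (@nonincreasing_cvg_mu _ _ _ P (fun m => ~` G m)).
    - by rewrite (le_lt_trans (probability_le1 _ _))// ?ltry//; exact: measurableC.
    - by move=> m; exact: measurableC.
    - by apply: bigcap_measurable => [|m _]; [exists 0%N|exact: measurableC].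
    - move=> m m' mm'; apply/subsetPset; apply: subsetC => x /GP[n [/andP[n0n nm] Anx]].
      by apply/GP; exists n; split=> //; rewrite n0n (leq_trans nm).
  have P0 : P (\bigcap_m ~` G m) = 0%E.
    case: freq => N [mN PN sN]; apply: (subset_measure0 _ mN _ PN).
      by apply: bigcap_measurable => [|m _]; [exists 0%N|exact: measurableC].
    move=> x xG; apply: sN => /= /(_ n0)[n n0n Anx].
    by apply: (xG n I); apply/GP; exists n; rewrite n0n leqnn.
  rewrite P0 in Gcvg.
  have := Gcvg _ (open_ereal_lt' (_ : (0 < (eta / 2)%:E)%E)); rewrite lte_fin divr_gt0// => /(_ isT).
  by move=> [m _ /(_ m (leqnn m)) /ltW]; exists m.
exists (maxn M1 m), (Om1 `&` G m); split.
- exact: measurableI.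
- rewrite setCI (le_trans (measureU2 _ _ _))//; [exact: measurableC..|].
  by rewrite [leRHS](_ : _ = (eta / 2)%:E + (eta / 2)%:E)%E ?leeD// -EFinD -splitr.
- move=> x; apply: (@covering_step _ R (fun u => g (shift u x)) c beta eps M1
    (maxn M1 m) n0 m (fun u => `[< Om1 (shift u x) >]) (fun u => `[< (Om1 `&` G m) (shift u x) >])) => //.
  + by rewrite b0 ltW.
  + rewrite /eps; exact: small_boundary_loss.
  + move=> u /asboolP[/= Om1u /GP[n [nm Anu]]]; split; first exact/asboolP.
    exists n; split=> //; first by case/andP: nm => + _; exact: leq_trans.
    by rewrite -box_sum_shift.
  + exact: leq_maxl.
  + exact: leq_maxr.
Qed.

(** Each step closes the fraction [2 ^ - (d + 1)] of the gap to the full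
    proportion. *)
Lemma covering_geometric c k : 0 <= c ->
  {ae P, forall x, forall n0, exists2 n, (n0 <= n)%N & c * n%:R ^+ d <= box_sum n x} ->
  covering c (1 - (1 - (2 ^+ d.+1)^-1) ^+ k).
Proof.
move=> c0 freq.
set q := 1 - (2 ^+ d.+1)^-1; have q1 : 0 < (2 ^+ d.+1)^-1 :> R by rewrite invr_gt0 exprn_gt0.
have q2 : (2 ^+ d.+1)^-1 <= 1 :> R.
  by rewrite invf_le1 ?exprn_gt0// exprn_ege1// ler1n.
have q0 : 0 < q.
  by rewrite subr_gt0 invf_lt1 ?exprn_gt0// exprn_egt1// ltr1n.
have q1' : q <= 1 by rewrite lerBlDr lerDl ltW.
elim: k => [|k IH]; first by rewrite expr0 subrr; exact: covering0.
have := covering_improve c0 _ freq IH.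
have -> : 1 - q ^+ k + (1 - (1 - q ^+ k)) / 2 ^+ d.+1 = 1 - q ^+ k.+1.
  by rewrite [q ^+ k.+1]exprS /q; move: (2 ^- d.+1) ((1 - 2 ^- d.+1) ^+ k) => s t; ring.
by apply; rewrite subr_ge0 exprn_ile1 ?(ltW q0)//= gtrBl exprn_gt0.
Qed.

Hypothesis gi : P.-integrable setT (EFin \o g).

(** Integrate the pointwise bound over a large box: by stationarity the left
    side counts the interior points times the probability of being typical, and
    the boundary is negligible. *)
Lemma covering_le c beta : 0 <= c -> 0 <= beta -> covering c beta ->
  beta * c <= \int[P]_x g x.
Proof.
move=> c0 b0 cov; set I := \int[P]_x g x.
have I0 : 0 <= I by apply: Rintegral_ge0 => x _.
apply: almost_le => //; first exact: mulr_ge0.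
move=> eta e0 e1; have [M [Om [mOm POm covU]]] := cov _ e0.
have iOm : P.-integrable setT (EFin \o (\1_Om : X -> R)).
  apply: (@bounded_integrable _ _ _ _ _ 1); first exact: measurable_indic.
  by move=> x; rewrite indicE ger0_norm// lern1 leq_b1.
have POm' : 1 - eta <= \int[P]_x \1_Om x.
  rewrite -lee_fin (EFin_Rintegral iOm) integral_indic// setIT EFinB.
  by rewrite leeBlDr// -leeBlDl ?fin_num_measure// -probability_setC.
have [n0 n00 n0P] := @box_boundary R d (2 * M).+2 eta e0.
have {n0P} n0P := n0P n0 (leqnn n0).
pose U := box (0 : lattice d) (n0 + (2 * M).+2).
pose W := box (const_mx M.+1%:Z : lattice d) n0.
have step x : beta * c * \sum_(u <- W) (\1_Om (shift u x) : R) <=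
    \sum_(u <- U) g (shift u x).
  apply: le_trans (covU x U); rewrite ler_wpM2l ?mulr_ge0//.
  rewrite (eq_bigr (fun u => ((shift u x \in Om) : nat)%:R)); last first.
    by move=> u _; rewrite indicE.
  rewrite sum_indicator ler_nat; apply: fsubset_leq_card; apply/fsubsetP => u.
  rewrite !inE/= => /andP[uW /set_mem uOm].
  move: uW; rewrite in_box => /forallP uW; apply/and3P; split; last exact/asboolP.
    rewrite in_box; apply/forallP => j; move: (uW j); rewrite !mxE.
    by move: (u ord0 j); clear; lia.
  apply: fsubset_boxP => j; move: (uW j); rewrite !mxE;
   move: (u ord0 j); clear; lia.
have : (\int[P]_x (beta * c * \sum_(u <- W) (\1_Om (shift u x) : R))%:E <=
    \int[P]_x (\sum_(u <- U) g (shift u x))%:E)%E.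
  apply: ge0_le_integral => //.
  - by move=> x _; rewrite lee_fin !mulr_ge0// sumr_ge0.
  - apply/measurable_EFinP; apply: measurable_funM => //.
    apply: measurable_sum => u.
    exact: (measurableT_comp (measurable_indic _) (measurable_shift u)).
  - by apply/measurable_EFinP; exact: measurable_region_sum.
  - by move=> x _; rewrite lee_fin.
rewrite (integral_region_sum U g0 gi) card_box.
under eq_integral do rewrite EFinM.
rewrite ge0_integralZl//; last 3 first.
- apply/measurable_EFinP; apply: measurable_sum => u.
  exact: (measurableT_comp (measurable_indic _) (measurable_shift u)).
- by move=> x _; rewrite lee_fin sumr_ge0.
- by rewrite lee_fin mulr_ge0.
rewrite (integral_region_sum W _ iOm)// card_box -EFinM lee_fin !natrX -/I.
move=> h; have n0d : 0 < n0%:R ^+ d :> R by rewrite exprn_gt0// ltr0n.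
exact: covering_arith2 (mulr_ge0 b0 c0) I0 n0d POm' n0P h.
Qed.

(** The covered proportion can be brought arbitrarily close to [1]. *)
Lemma frequent_average_le c : 0 <= c ->
  {ae P, forall x, forall n0, exists2 n, (n0 <= n)%N & c * n%:R ^+ d <= box_sum n x} ->
  c <= \int[P]_x g x.
Proof.
move=> c0 freq; set q : R := 1 - (2 ^+ d.+1)^-1.
have q1 : 0 < (2 ^+ d.+1)^-1 :> R by rewrite invr_gt0 exprn_gt0.
have q0 : 0 < q by rewrite subr_gt0 invf_lt1 ?exprn_gt0// exprn_egt1// ltr1n.
have q1' : q < 1 by rewrite ltrBlDr ltrDl.
have h k : (1 - q ^+ k) * c <= \int[P]_x g x.
  apply: covering_le => //; last exact: covering_geometric.
  by rewrite subr_ge0 exprn_ile1 ?ltW.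
have cvgq : (fun k => (1 - q ^+ k) * c) @ \oo --> c.
  rewrite -[X in _ --> X]mul1r -[1 in X in _ --> X]subr0.
  apply: cvgMr_tmp; apply: cvgB; first exact: cvg_cst.
  by apply: cvg_expr; rewrite ger0_norm// ltW.
rewrite -(cvg_lim (@Rhausdorff R) cvgq); apply: limr_le; last exact: nearW.
exact: cvgP cvgq.
Qed.

(** The event that the upper limit of the averages is at least [c]. It is not
    obviously invariant, but its preimages under translations by nonnegative
    vectors are contained in it. *)
Definition limsup_ge (c : R) : set X := [set x | forall k n0 : nat,
  exists2 n, (n0 <= n)%N & (c - k.+1%:R^-1) * n%:R ^+ d <= box_sum n x].

(** A box at [e >= 0] of side [n] lies in the box at the origin of side [n + m]
    with [m] bounded, and the two volumes are nearly equal. *)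
Lemma limsup_ge_shift (c : R) (e : lattice d) x : (forall j, 0 <= e ord0 j) ->
  limsup_ge c (shift e x) -> limsup_ge c x.
Proof.
move=> e0 cx k n0; set c' := c - _.
have [c'0|c'0] := leP c' 0.
  exists n0 => //; apply: le_trans (_ : 0 <= _); last by rewrite sumr_ge0.
  by rewrite mulr_le0_ge0// exprn_ge0.
pose c2 := c - k.+2%:R^-1.
have cc : c' < c2 by rewrite ltrD2l ltrN2 ltf_pV2 ?posrE// ltr_nat.
have eps0 : 0 < c2 / c' - 1 by rewrite subr_gt0 ltr_pdivlMr// mul1r.
pose m := (\max_(j < d) `|e ord0 j|)%N.
have [n1 _ n1P] := @box_boundary R d m _ eps0.
have [n] := cx k.+1 (maxn n0 n1); rewrite geq_max -/c2 => /andP[n0n n1n] h.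
exists (n + m)%N; first exact: leq_trans n0n (leq_addr _ _).
apply: (@le_trans _ _ (c2 * n%:R ^+ d)).
  have := n1P n n1n; rewrite -(ler_pM2l c'0) => /le_trans; apply.
  by rewrite mulrA addrCA subrr addr0 [c' * _]mulrC divfK// gt_eqF.
apply: (le_trans h); rewrite box_sum_shift /box_sum.
rewrite [leRHS](big_fsetID _ (mem (box e n)))/=.
have -> : [fset u | u in box 0 (n + m) & u \in box e n]%fset = box e n.
  apply/fsetP => u; rewrite !inE/= andb_idl//; apply/fsubsetP: u.
  apply: fsubset_boxP => j; rewrite !mxE//.
  have := e0 j; have : (`|e ord0 j| <= m)%N by exact: (leq_bigmax j).
  by generalize (e ord0 j) m; clear; lia.
by rewrite lerDl sumr_ge0.
Qed.

Lemma measurable_limsup_ge c : measurable (limsup_ge c).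
Proof.
have -> : limsup_ge c = \bigcap_k \bigcap_n0 \bigcup_(n in [set n | (n0 <= n)%N])
    [set x | (c - k.+1%:R^-1) * n%:R ^+ d <= box_sum n x].
  apply/seteqP; split=> x h k.
    by move=> _ n0 _; have [n n0n hn] := h k n0; exists n.
  by move=> n0; have [n n0n hn] := h k I n0 I; exists n.
apply: bigcap_measurable => [|k _]; first by exists 0%N.
apply: bigcap_measurable => [|n0 _]; first by exists 0%N.
apply: bigcup_measurable => n _.
rewrite -[X in measurable X]setTI; apply: measurable_fun_ler => //.
exact: measurable_region_sum.
Qed.

(** The translates along the diagonal decrease; their intersection is strictly
    invariant and has the same probability as each of them by stationarity. *)
Lemma limsup_ge_01 c : P (limsup_ge c) = 0%E \/ P (limsup_ge c) = 1%E.
Proof.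
set E := limsup_ge c; have mE : measurable E by exact: measurable_limsup_ge.
pose F k := shift (const_mx k%:Z : lattice d) @^-1` E.
have mF k : measurable (F k) by exact: measurable_preimage_shift.
have PF k : P (F k) = P E by exact: P_stat.
have mono u v x : (forall j, u ord0 j <= v ord0 j) -> E (shift v x) -> E (shift u x).
  move=> uv; rewrite -(subrK u v) addrC -shiftD; apply: limsup_ge_shift => j.
  by rewrite !mxE subr_ge0.
have mIF : measurable (\bigcap_k F k) by apply: bigcap_measurable => [|k _]; first by exists 0%N.
have <- : P (\bigcap_k F k) = P E.
  have : P \o F @ \oo --> P (\bigcap_k F k).
    apply: nonincreasing_cvg_mu => //.
      by rewrite (le_lt_trans (probability_le1 _ _))// ltry.
    move=> k k' kk'; apply/subsetPset => x; apply: mono => j.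
    by rewrite !mxE; move: kk'; lia.
  rewrite (_ : P \o F = cst (P E)); last by apply/funext => k /=; exact: PF.
  move=> /(cvg_lim (@ereal_hausdorff R)) <-; exact: lim_cst.
apply: P_erg => // u.
have half u' x : (\bigcap_k F k) x -> (\bigcap_k F k) (shift u' x).
  move=> xF k _; rewrite /F/= shiftD.
  pose m := (k + \max_(j < d) `|u' ord0 j|)%N.
  apply: (mono _ (const_mx m%:Z)); last exact: (xF m I).
  move=> j; rewrite !mxE /m; have : (`|u' ord0 j| <= \max_(j < d) `|u' ord0 j|)%N.
    exact: (leq_bigmax j).
  by move: (u' ord0 j) (\max_(_ < _) _)%N; clear; lia.
apply/seteqP; split => [x|x]; last exact: half.
by move/(half (- u)); rewrite shiftD addrN shift0.
Qed.

(** Otherwise the upper limit would be at least [c] almost surely, and the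
    integral at least [c]. *)
Lemma eventually_average_lt c : \int[P]_x g x < c ->
  {ae P, forall x, \forall n \near \oo, box_sum n x < c * n%:R ^+ d}.
Proof.
move=> Ic; have I0 : 0 <= \int[P]_x g x by apply: Rintegral_ge0.
have mE := measurable_limsup_ge c.
have [E0|E1] := limsup_ge_01 c.
  exists (limsup_ge c); split=> // x /= nx; apply: contrapT => xE; apply: nx.
  move: xE; rewrite /limsup_ge/= -existsNE => -[k].
  rewrite -existsNE => -[n0 hn0]; exists n0 => //= n n0n.
  apply: (@lt_le_trans _ _ ((c - k.+1%:R^-1) * n%:R ^+ d)).
    by rewrite ltNge; apply: contra_notN hn0 => h; exists n.
  by rewrite ler_wpM2r ?exprn_ge0// lerBlDr lerDl.
exfalso; pose k := Num.bound (c - \int[P]_x g x)^-1.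
have kP : k.+1%:R^-1 < c - \int[P]_x g x.
  rewrite invf_plt ?posrE ?subr_gt0//.
  apply: (@lt_le_trans _ _ k%:R); last by rewrite ler_nat.
  by apply: archi_boundP; rewrite invr_ge0 subr_ge0 ltW.
have : c - k.+1%:R^-1 <= \int[P]_x g x.
  apply: frequent_average_le; first by rewrite subr_ge0 ltW// (lt_le_trans kP)// gerBl.
  exists (~` limsup_ge c); split.
  - exact: measurableC.
  - by rewrite probability_setC// E1 subee.
  - by move=> x /= nx xE; apply: nx => n0; exact: (xE k n0).
by rewrite leNgt => /negP; apply; rewrite ltrBrDr -ltrBrDl.
Qed.

End ergodic_averages.

Lemma exists_invn_lt (R : realType) (e : R) : 0 < e ->
  exists n : nat, n.+1%:R^-1 < e.
Proof.
move=> e0; exists (Num.bound e^-1); rewrite invf_plt ?posrE//.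
apply: (@lt_le_trans _ _ (Num.bound e^-1)%:R); last by rewrite ler_nat.
by apply: archi_boundP; rewrite invr_ge0 ltW.
Qed.

Lemma ergodic_low_arith (R : realFieldType) (K S N p t e I : R) : 0 < N ->
  K * N - S < (K - p + t) * N -> t < e / 2 -> I - e / 2 < p ->
  N * (- e + I) < S.
Proof.
move=> N0 h1 h2 h3; have : N * (- e + I) < N * (p - t) by rewrite ltr_pM2l//; lra.
lra.
Qed.

Lemma ergodic_up_arith (R : realFieldType) (S N t e I : R) : 0 < N ->
  S < (I + t) * N -> t < e / 2 -> 0 < e -> S < N * (e + I).
Proof.
move=> N0 h1 h2 e0; have : N * (I + t) < N * (e + I) by rewrite ltr_pM2l//; lra.
lra.
Qed.

(** Only upper bounds on averages are available, because [eventually_average_lt]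
    concerns nonnegative functions. The lower bound comes from the upper bound
    for [k - min(g, k)] as [k] grows. *)
Theorem pointwise_ergodic {R : realType} {d : nat} {disp : measure_display}
    {T : measurableType disp} (P : probability (config (lattice d) T) R)
    (g : config (lattice d) T -> R) :
  stationary P -> ergodic P -> (forall x, 0 <= g x) ->
  P.-integrable setT (EFin \o g) ->
  {ae P, forall x,
    (n%:R ^+ d)^-1 * \sum_(u <- box 0 n) g (shift u x) @[n --> \oo]
      --> \int[P]_x g x}.
Proof.
move=> Pst Perg g0 gi; have mg : measurable_fun setT g.
  by apply/measurable_EFinP; exact: measurable_int gi.
set I := \int[P]_x g x.
pose gk (k : nat) x := Num.min (g x) k%:R.
have gk0 k x : 0 <= gk k x by rewrite le_min g0 ler0n.
have mgk k : measurable_fun setT (gk k) by exact: measurable_minr.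
have gki k : P.-integrable setT (EFin \o gk k).
  apply: (@bounded_integrable _ _ _ _ _ k%:R) => // x.
  by rewrite ger0_norm// ge_min lexx orbT.
have hki k : P.-integrable setT (EFin \o (fun x => k%:R - gk k x)).
  by apply: integrableD_EFin; [exact: finite_measure_integrable_cst|exact: integrableN_EFin].
have Ihk k : \int[P]_x (k%:R - gk k x) = k%:R - \int[P]_x gk k x.
  rewrite (RintegralB measurableT _ (gki k)) ?Rintegral_prob_cst//.
  exact: finite_measure_integrable_cst.
have Igk : (fun k => \int[P]_x gk k x) @ \oo --> I.
  apply: fine_cvg; rewrite (EFin_Rintegral gi).
  apply: (@dominated_cvg _ _ _ P setT measurableT (fun k x => (gk k x)%:E)
    (fun x => (g x)%:E) (fun x => (g x)%:E)) => //.
  - by move=> k; exact/measurable_EFinP.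
  - move=> x _; apply: cvg_EFin; first exact: nearW.
    apply: cvg_near_cst; exists (Num.bound (g x)) => // k /= kx.
    rewrite /gk min_l// ltW// (lt_le_trans (archi_boundP (g0 x)))// ler_nat//.
  - by move=> k x _; rewrite /= lee_fin ger0_norm// ge_min lexx.
have up : {ae P, forall x, forall j : nat,
    \forall n \near \oo, box_sum g n x < (I + j.+1%:R^-1) * n%:R ^+ d}.
  apply/ae_foralln => j; apply: eventually_average_lt => //.
  by rewrite ltrDl invr_gt0.
have low : {ae P, forall x, forall k j : nat,
    \forall n \near \oo, box_sum (fun x => k%:R - gk k x) n x <
      (k%:R - \int[P]_x gk k x + j.+1%:R^-1) * n%:R ^+ d}.
  apply/ae_foralln => k; apply/ae_foralln => j.
  apply: eventually_average_lt => //.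
  - by apply: measurable_funB.
  - by move=> x; rewrite subr_ge0 ge_min lexx orbT.
  - by rewrite Ihk ltrDl invr_gt0.
move: up low; apply: filterS2 => x up low.
apply/cvgrPdist_lt => e e0.
have e2 : 0 < e / 2 by rewrite divr_gt0.
have [j jP] := exists_invn_lt e2.
have [k kP] : exists k : nat, I - e / 2 < \int[P]_x gk k x.
  have [|k _ /(_ k (leqnn k)) kP] := cvgr_gt _ Igk (I - e / 2); first by rewrite ltrBlDr ltrDl.
  by exists k.
have n0 : \forall n \near \oo, (0 < n)%N by exists 1%N.
near=> n.
have nd : 0 < n%:R ^+ d :> R by rewrite exprn_gt0// ltr0n; near: n.
rewrite distrC ltr_norml ltrBDr ltrBlDr; apply/andP; split.
  have : box_sum (fun x => k%:R - gk k x) n x <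
    (k%:R - \int[P]_x gk k x + j.+1%:R^-1) * n%:R ^+ d by near: n; exact: low.
  have : box_sum (fun x => k%:R - gk k x) n x >= k%:R * n%:R ^+ d - box_sum g n x.
    rewrite /box_sum sumrB lerB//; last by apply: ler_sum => u _; rewrite ge_min lexx.
    by rewrite big_const_seq count_predT iter_addr_0 card_box -[leRHS]mulr_natr natrX.
  rewrite -/(box_sum g n x) => h1 h2; rewrite ltr_pdivlMl//.
  exact: ergodic_low_arith nd (le_lt_trans h1 h2) jP kP.
have : box_sum g n x < (I + j.+1%:R^-1) * n%:R ^+ d by near: n; exact: up.
rewrite -/(box_sum g n x) => h1; rewrite ltr_pdivrMl//.
exact: ergodic_up_arith nd h1 jP e0.
Unshelve. all: by end_near.
Qed.

(** * Exponential decay of ball probabilities *)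

Section exponential_decay.
Context {R : realType} {disp : measure_display} {T : measurableType disp}.
Variables (Q : probability T R) (N : nat -> R) (Z : nat -> T -> R).
Hypothesis N0 : \forall n \near \oo, 0 < N n.
Hypothesis Noo : N n @[n --> \oo] --> +oo.
Hypothesis mZ : forall n, measurable_fun setT (Z n).
Hypothesis Z0 : forall n y, 0 <= Z n y.

Definition ball_prob (D : R) n : R := \int[Q]_y ((Z n y <= D)%R : nat)%:R.

Definition mgf n (l : R) : R := \int[Q]_y expR (N n * l * Z n y).

Definition log_mgf_limit (l L : R) :=
  (N n)^-1 * ln (mgf n l) @[n --> \oo] --> L.

(** That is, [p n = exp(- N n (r + o(1)))]. *)
Definition decay_rate (p : nat -> R) (r : R) := forall e, 0 < e ->
  \forall n \near \oo,
    expR (- (N n * (r + e))) <= p n <= expR (- (N n * (r - e))).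

Lemma integrable_mgf n (l : R) : 0 < N n -> l <= 0 ->
  Q.-integrable setT (EFin \o (fun y => expR (N n * l * Z n y))).
Proof.
move=> Nn l0; apply: (@bounded_integrable _ _ _ _ _ 1).
  by apply: measurableT_comp => //; exact: measurable_funM.
move=> y; rewrite ger0_norm ?expR_ge0// -expR0 ler_expR.
by rewrite mulr_le0_ge0// mulr_ge0_le0// ltW.
Qed.

Lemma measurable_indicator_le n (D : R) :
  measurable_fun setT (fun y => ((Z n y <= D)%R : nat)%:R : R).
Proof.
rewrite (_ : (fun y => _) = (fun y => if (Z n y <= D)%R then 1 else 0 : R)); last first.
  by apply/funext => y; case: ifP.
by apply: measurable_fun_ifT => //; exact: measurable_fun_ler.
Qed.

Lemma integrable_indicator_le n (D : R) :
  Q.-integrable setT (EFin \o (fun y => ((Z n y <= D)%R : nat)%:R : R)).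
Proof.
apply: (@bounded_integrable _ _ _ _ _ 1); first exact: measurable_indicator_le.
by move=> y; rewrite ger0_norm// lern1 leq_b1.
Qed.

Lemma mgf_gt0 n (l : R) : 0 < N n -> l <= 0 -> 0 < mgf n l.
Proof.
by move=> Nn l0; apply: Rintegral_gt0 => [|y]; [exact: integrable_mgf|exact: expR_gt0].
Qed.

Lemma mgf_near (l L e : R) : l <= 0 -> log_mgf_limit l L -> 0 < e ->
  \forall n \near \oo,
    expR (N n * (L - e)) <= mgf n l <= expR (N n * (L + e)).
Proof.
move=> l0 /cvgrPdist_lt/(_ _ _) lim e0; have {}lim := lim _ e0.
near=> n; have Nn : 0 < N n by near: n.
have : `|L - (N n)^-1 * ln (mgf n l)| < e by near: n.
rewrite ltr_distlC => /andP[h1 h2].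
rewrite -(lnK (mgf_gt0 Nn l0 : mgf n l \is Num.pos)) !ler_expR.
by rewrite -ler_pdivlMl// (ltW h1) -ler_pdivrMl// ltW.
Unshelve. all: by end_near. Qed.

Lemma chernoff n (l D : R) : 0 < N n -> l <= 0 ->
  ball_prob D n <= expR (- (N n * (l * D))) * mgf n l.
Proof.
move=> Nn l0; have im := integrable_mgf Nn l0.
rewrite -(RintegralZl _ measurableT im); apply: le_Rintegral => //.
- exact: integrable_indicator_le.
- exact: integrableZ_EFin.
move=> y _; rewrite -expRD; have [ZD|_] := leP (Z n y) D; last exact: expR_ge0.
rewrite -expR0 ler_expR.
have -> : - (N n * (l * D)) + N n * l * Z n y = N n * (l * (Z n y - D)) by ring.
by rewrite mulr_ge0 ?(ltW Nn)// mulr_le0// subr_le0.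
Qed.

Lemma decay_upper (l L D e : R) : l <= 0 -> log_mgf_limit l L -> 0 < e ->
  \forall n \near \oo, ball_prob D n <= expR (- (N n * (l * D - L - e))).
Proof.
move=> l0 lim e0; near=> n; have Nn : 0 < N n by near: n.
apply: (le_trans (chernoff _ Nn l0)).
have -> : - (N n * (l * D - L - e)) = - (N n * (l * D)) + N n * (L + e) by ring.
rewrite expRD ler_pM2l ?expR_gt0//.
have /andP[//] : expR (N n * (L - e)) <= mgf n l <= expR (N n * (L + e)).
by near: n; exact: mgf_near.
Unshelve. all: by end_near. Qed.

(** Exponential change of measure. Under the law tilted by [l], the variable
    exceeds [D] or falls below [D1] with exponentially small probability, as the
    values of the moment generating function at [l + t] and [l - t] show. *)
Lemma tilted_ball_prob n (l t D1 D : R) : 0 < N n -> l <= 0 -> 0 < t -> l + t <= 0 ->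
  expR (- (N n * (l * D1))) *
    (mgf n l - expR (- (N n * (t * D))) * mgf n (l + t)
             - expR (N n * (t * D1)) * mgf n (l - t)) <= ball_prob D n.
Proof.
move=> Nn l0 t0 lt0; have lt0' : l - t <= 0 by lra.
have i1 := integrable_mgf Nn l0.
have i2 := integrableZ_EFin (expR (- (N n * (t * D)))) (integrable_mgf Nn lt0).
have i3 := integrableZ_EFin (expR (N n * (t * D1))) (integrable_mgf Nn lt0').
have i12 := integrableD_EFin i1 (integrableN_EFin i2).
have i123 := integrableD_EFin i12 (integrableN_EFin i3).
rewrite -(RintegralZl _ measurableT (integrable_mgf Nn lt0)).
rewrite -(RintegralZl _ measurableT (integrable_mgf Nn lt0')).
rewrite -(RintegralB measurableT i1 i2) -(RintegralB measurableT i12 i3).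
rewrite -(RintegralZl _ measurableT i123); apply: le_Rintegral => //.
- exact: integrableZ_EFin.
- exact: integrable_indicator_le.
(* Pointwise, the bracket is at most [0] outside the interval from [D1] to [D],
   and at most [exp(N l z)] inside. *)
move=> y _; rewrite -!expRD; set z := Z n y.
have e2 : - (N n * (t * D)) + N n * (l + t) * z = N n * l * z + N n * (t * (z - D)) by ring.
have e3 : N n * (t * D1) + N n * (l - t) * z = N n * l * z + N n * (t * (D1 - z)) by ring.
rewrite e2 e3 !expRD; set w := expR (N n * l * z).
have w0 : 0 < w by exact: expR_gt0.
have pos (a : R) : 0 < expR a by exact: expR_gt0.
have big a : 0 <= a -> 1 <= expR (N n * (t * a)).
  by move=> a0; rewrite -expR0 ler_expR !mulr_ge0// ltW.
have [zD|zD] := leP z D; last first.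
  rewrite /= pmulr_rle0//; have := big (z - D) _; rewrite subr_ge0 ltW// => /(_ isT).
  have := mulr_gt0 w0 (pos (N n * (t * (D1 - z)))).
  by rewrite -(ler_pM2l w0) mulr1; lra.
have [zD1|zD1] := ltP z D1.
  have h := big (D1 - z) _; rewrite subr_ge0 (ltW zD1) in h.
  have {}h := h isT; rewrite -(ler_pM2l w0) mulr1 in h.
  apply: (@le_trans _ _ 0); last by [].
  by rewrite pmulr_rle0//; have := mulr_gt0 w0 (pos (N n * (t * (z - D)))); lra.
apply: (@le_trans _ _ (expR (- (N n * (l * D1))) * w)).
  rewrite ler_pM2l//.
  have := mulr_gt0 w0 (pos (N n * (t * (z - D)))).
  by have := mulr_gt0 w0 (pos (N n * (t * (D1 - z)))); lra.
rewrite -expRD -expR0 ler_expR.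
have -> : - (N n * (l * D1)) + N n * l * z = N n * (l * (z - D1)) by ring.
by rewrite mulr_ge0_le0 ?(ltW Nn)// mulr_le0_ge0// subr_ge0.
Qed.

Lemma decay_lower (l t L Lp Lm D1 D e : R) : l <= 0 -> 0 < t -> l + t <= 0 ->
  log_mgf_limit l L -> log_mgf_limit (l + t) Lp -> log_mgf_limit (l - t) Lm ->
  Lp - L < t * D -> Lm - L < - (t * D1) -> 0 < e ->
  \forall n \near \oo, expR (- (N n * (l * D1 - L + e))) <= ball_prob D n.
Proof.
move=> l0 t0 lt0 limL limp limm hp hm e0.
pose s := Num.min (e / 2) (Num.min ((t * D - (Lp - L)) / 4) ((- (t * D1) - (Lm - L)) / 4)).
have s0 : 0 < s.
  by rewrite !lt_min !divr_gt0// subr_gt0.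
near=> n; have Nn : 0 < N n by near: n.
apply: le_trans (@tilted_ball_prob n l t D1 D Nn l0 t0 lt0).
have /andP[m1 _] : expR (N n * (L - s)) <= mgf n l <= expR (N n * (L + s)).
  by near: n; exact: mgf_near.
have /andP[_ m2] : expR (N n * (Lp - s)) <= mgf n (l + t) <= expR (N n * (Lp + s)).
  by near: n; exact: mgf_near.
have /andP[_ m3] : expR (N n * (Lm - s)) <= mgf n (l - t) <= expR (N n * (Lm + s)).
  by near: n; apply: mgf_near => //; lra.
have Ns : 4 <= expR (N n * s).
  have h : 4 <= N n * s.
    by rewrite -ler_pdivrMr//; near: n; exact: cvgry_ge.
  by apply: le_trans (expR_ge1Dx _); clear -h; lra.
(* The main term is at least four times [a], and each correction at most [a]. *)
pose a := expR (N n * (L - 2 * s)).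
have a0 : 0 < a by exact: expR_gt0.
have b1 : 4 * a <= mgf n l.
  apply: le_trans m1; rewrite (_ : N n * (L - s) = N n * s + N n * (L - 2 * s)).
    by rewrite expRD ler_pM2r.
  by ring.
have sp : 4 * s <= t * D - (Lp - L).
  by rewrite mulrC -ler_pdivlMr// !ge_min lexx !orbT.
have sm : 4 * s <= - (t * D1) - (Lm - L).
  by rewrite mulrC -ler_pdivlMr// !ge_min lexx !orbT.
have se : 2 * s <= e by rewrite mulrC -ler_pdivlMr// ge_min lexx.
have b2 : expR (- (N n * (t * D))) * mgf n (l + t) <= a.
  apply: (@le_trans _ _ (expR (- (N n * (t * D))) * expR (N n * (Lp + s)))).
    by rewrite ler_pM2l// expR_gt0.
  rewrite -expRD ler_expR -mulrN -mulrDr ler_pM2l//.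
  by clear -sp s0; lra.
have b3 : expR (N n * (t * D1)) * mgf n (l - t) <= a.
  apply: (@le_trans _ _ (expR (N n * (t * D1)) * expR (N n * (Lm + s)))).
    by rewrite ler_pM2l// expR_gt0.
  rewrite -expRD ler_expR -mulrDr ler_pM2l//.
  by clear -sm s0; lra.
rewrite (_ : - (N n * (l * D1 - L + e)) = - (N n * (l * D1)) + N n * (L - e)); last by ring.
rewrite expRD ler_pM2l ?expR_gt0//; apply: (@le_trans _ _ a).
  by rewrite ler_expR ler_pM2l//; clear -se; lra.
by clear -b1 b2 b3 a0; lra.
Unshelve. all: by end_near. Qed.

End exponential_decay.

(** * Second moments and lattice distances *)

Lemma second_moment_arith (R : realFieldType) (n p c q F : R) : 0 < n * p ->
  F <= n * (n * p ^+ 2 + c * p) ->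
  (n * p) ^+ 2 * q <= F + - (2 * (n * p)) * (n * p) + (n * p) ^+ 2 ->
  n * p * q <= c.
Proof.
move=> m0 h1 h2; rewrite -(ler_pM2l m0).
by move: h1 h2; rewrite !expr2; nra.
Qed.

Lemma leq_expn2r (a b e : nat) : (a <= b)%N -> (a ^ e <= b ^ e)%N.
Proof. by case: e => // e ab; rewrite leq_exp2r. Qed.

Lemma expn_increment (d a : nat) : (a.+2 ^ d <= a ^ d + 2 * d * a.+2 ^ d.-1)%N.
Proof.
elim: d => [|d IH]; first by rewrite !expn0.
have h : (a * a.+2 ^ d <= a * a ^ d + 2 * d * a.+2 ^ d)%N.
  apply: (@leq_trans (a * (a ^ d + 2 * d * a.+2 ^ d.-1))).
    by rewrite leq_mul2l IH orbT.
  rewrite mulnDr leq_add2l mulnCA leq_mul2l; case: (d) => [//|k].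
  by rewrite /= expnS leq_mul2r -addn2 leq_addr !orbT.
by rewrite expnS (expnS a) /=; move: (a.+2 ^ d)%N (a ^ d)%N h => p q; lia.
Qed.

Lemma miss_arith (R : realFieldType) (p S1 S2 N D C : R) : 0 < p ->
  S1 <= N -> S2 <= D -> p + (S1 + p * S2) <= N + (1 + D) * p.
Proof.
move=> p0 h1 h2; have : p * S2 <= p * D by rewrite ler_pM2l.
by clear -h1; lra.
Qed.

Section second_moment.
Context {R : realType} {disp : measure_display} {T : measurableType disp}.
Variable Q : probability T R.

Lemma integrable_indic_prob (E : set T) : measurable E ->
  Q.-integrable setT (EFin \o (\1_E : T -> R)).
Proof.
move=> mE; apply: (@bounded_integrable _ _ _ _ _ 1); first exact: measurable_indic.
by move=> x; rewrite indicE ger0_norm// lern1 leq_b1.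
Qed.

Lemma Rintegral_indic (E : set T) : measurable E ->
  \int[Q]_x \1_E x = fine (Q E).
Proof. by move=> mE; rewrite /Rintegral integral_indic// setIT. Qed.

Lemma Rintegral_sum (I : Type) (s : seq I) (f : I -> T -> R) :
  (forall i, Q.-integrable setT (EFin \o f i)) ->
  Q.-integrable setT (EFin \o (fun x => \sum_(i <- s) f i x)) /\
  \int[Q]_x (\sum_(i <- s) f i x) = \sum_(i <- s) \int[Q]_x f i x.
Proof.
move=> fi; elim: s => [|i s [IH1 IH2]].
  split.
    rewrite (_ : _ \o _ = cst 0%:E); last by apply/funext => x /=; rewrite big_nil.
    exact: finite_measure_integrable_cst.
  by rewrite big_nil; under eq_Rintegral do rewrite big_nil; rewrite Rintegral_prob_cst.
have e : (fun x => \sum_(i <- i :: s) f i x) = (fun x => f i x + \sum_(i <- s) f i x).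
  by apply/funext => x; rewrite big_cons.
rewrite e big_cons; split; first exact: integrableD_EFin.
by rewrite (RintegralD measurableT (fi i) IH1) IH2.
Qed.

Lemma measurable_none (K : choiceType) (I : {fset K}) (E : K -> set T) :
  (forall k, measurable (E k)) ->
  measurable [set y | forall k, k \in I -> ~ E k y].
Proof.
move=> mE; rewrite (_ : [set _ | _] = \bigcap_(k in [set` I]) ~` E k).
  by apply: fin_bigcap_measurable => // k _; exact: measurableC.
by apply/seteqP; split=> y h k kI; exact: h.
Qed.

(** Chebyshev's inequality for the number of events that occur: by the bound on
    the pairs its variance is at most [c] times its mean. *)
Lemma second_moment (K : choiceType) (I : {fset K}) (E : K -> set T) (p c : R) :
  (forall k, measurable (E k)) ->
  (forall k, k \in I -> fine (Q (E k)) = p) ->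
  (forall k, k \in I ->
     \sum_(k' <- I) fine (Q (E k `&` E k')) <= #|` I|%:R * p ^+ 2 + c * p) ->
  0 < #|` I|%:R * p ->
  #|` I|%:R * p * fine (Q [set y | forall k, k \in I -> ~ E k y]) <= c.
Proof.
move=> mE pE pair m0; set m := _ * p in m0 *; set A := [set y | _].
have mA : measurable A by exact: measurable_none.
pose e k : T -> R := \1_(E k).
have ei k : Q.-integrable setT (EFin \o e k) by exact: integrable_indic_prob.
have eei k k' : Q.-integrable setT (EFin \o (fun y => e k y * e k' y)).
  rewrite (_ : _ \o _ = EFin \o \1_(E k `&` E k')); last first.
    by apply/funext => y; rewrite /= /e indicI.
  by apply: integrable_indic_prob; exact: measurableI.
pose f y := \sum_(k <- I) e k y.
have [fi If] := Rintegral_sum I ei.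
have Ifm : \int[Q]_y f y = m.
  rewrite If (eq_big_seq (fun=> p)).
    by rewrite big_const_seq count_predT iter_addr_0 -mulr_natl.
  by move=> k kI; rewrite Rintegral_indic// pE.
have [ffi Iff] := Rintegral_sum I (fun k => (Rintegral_sum I (eei k)).1).
have ff y : f y ^+ 2 = \sum_(k <- I) \sum_(k' <- I) e k y * e k' y.
  by rewrite expr2 mulr_suml; apply: eq_bigr => k _; rewrite mulr_sumr.
have Iffm : \int[Q]_y (f y ^+ 2) <= #|` I|%:R * (#|` I|%:R * p ^+ 2 + c * p).
  under eq_Rintegral do rewrite ff.
  rewrite Iff big_seq.
  apply: (@le_trans _ _ (\sum_(k <- I | k \in I) (#|` I|%:R * p ^+ 2 + c * p))).
    apply: ler_sum => k kI; apply: le_trans (pair k kI).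
    rewrite (Rintegral_sum I (eei k)).2; apply: ler_sum => k' _.
    rewrite -Rintegral_indic; last exact: measurableI.
    rewrite le_eqVlt; apply/orP; left; apply/eqP.
    by apply: eq_Rintegral => y _; rewrite /e indicI.
  by rewrite -big_seq big_const_seq count_predT iter_addr_0 -[leLHS]mulr_natl lexx.
have ffi' : Q.-integrable setT (EFin \o (fun y => f y ^+ 2)).
  rewrite (_ : (fun y => f y ^+ 2) = (fun y => \sum_(k <- I) \sum_(k' <- I) e k y * e k' y))//.
  by apply/funext => y; exact: ff.
have cheb : m ^+ 2 * fine (Q A) <= \int[Q]_y ((f y ^+ 2 + (- (2 * m)) * f y) + m ^+ 2).
  rewrite -(Rintegral_indic mA) -(RintegralZl _ measurableT (integrable_indic_prob mA)).
  apply: le_Rintegral => //.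
  - exact: integrableZ_EFin (integrable_indic_prob mA).
  - apply: integrableD_EFin; last exact: finite_measure_integrable_cst.
    by apply: integrableD_EFin => //; exact: integrableZ_EFin.
  - move=> y _; have -> : f y ^+ 2 + (- (2 * m)) * f y + m ^+ 2 = (f y - m) ^+ 2 by ring.
    have [yA|yA] := pselect (A y); last by rewrite indicE memNset//= mulr0 sqr_ge0.
    rewrite (_ : f y = 0) ?sub0r ?sqrrN ?indicE ?mem_set ?mulr1//.
    by rewrite /f big_seq big1// => k kI; rewrite /e indicE memNset//; exact: yA.
have i2 := integrableZ_EFin (- (2 * m)) fi.
move: cheb; rewrite (RintegralD measurableT (integrableD_EFin ffi' i2)); last first.
  exact: finite_measure_integrable_cst.
rewrite (RintegralD measurableT ffi' i2) (RintegralZl _ measurableT fi).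
rewrite Rintegral_prob_cst -/f Ifm.
exact: second_moment_arith.
Qed.

End second_moment.

Section lattice_distance.
Context {d : nat}.
Implicit Types (u v : lattice d).

Lemma ldist_leP u v (j : nat) :
  (ldist u v <= j)%N = [forall i, v ord0 i - j%:Z <= u ord0 i <= v ord0 i + j%:Z].
Proof.
apply/idP/forallP => [h i|h].
  have : (`|u ord0 i - v ord0 i| <= j)%N by apply: leq_trans h; exact: (leq_bigmax i).
  by move: (u ord0 i) (v ord0 i); clear; lia.
by apply/bigmax_leqP => i _; move: (h i); move: (u ord0 i) (v ord0 i); clear; lia.
Qed.

(** The sphere is the difference of two boxes whose sides differ by [2]. *)
Lemma sphere_card (I : {fset lattice d}) v j : (0 < j)%N ->
  (#|` [fset u in I | ldist u v == j]%fset| <= 2 * d * (2 * j).+1 ^ d.-1)%N.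
Proof.
move=> j0.
pose B := box (v - const_mx j.+1%:Z) (2 * j).+1.
pose B' := box (v - const_mx j%:Z) (2 * j).-1.
have B'B : (B' `<=` B)%fset.
  apply: fsubset_boxP => i; rewrite !mxE; move: (v ord0 i) j0; clear; lia.
apply: (@leq_trans #|` (B `\` B')%fset|).
  apply: fsubset_leq_card; apply/fsubsetP => u; rewrite !inE/= => /andP[_ /eqP uv].
  apply/andP; split.
    apply: contraTN j0 => uB'; have : (ldist u v <= j.-1)%N.
      rewrite ldist_leP; apply/forallP => i; move: uB'; rewrite in_box => /forallP/(_ i).
      by rewrite !mxE; move: (u ord0 i) (v ord0 i); clear; lia.
    by rewrite uv; clear; lia.
  have : (ldist u v <= j)%N by rewrite uv.
  rewrite ldist_leP => /forallP h; rewrite in_box; apply/forallP => i; move: (h i).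
  by rewrite !mxE; move: (u ord0 i) (v ord0 i); clear; lia.
rewrite cardfsDS// !card_box.
have := expn_increment d (2 * j).-1; rewrite (_ : (2 * j).-1.+2 = (2 * j).+1)%N.
  by clear; lia.
by move: j0; clear; lia.
Qed.

(** Summing a function of the distance over the shells around [v]. *)
Lemma sum_ldist_le (R : realType) (I : {fset lattice d}) v m (F : nat -> R) :
  (forall j, 0 <= F j) ->
  (forall u, u \in I -> (ldist u v < m)%N) ->
  \sum_(u <- I | u != v) F (ldist u v) <=
    (2 * d * 2 ^ d.-1)%:R * \sum_(1 <= j < m) j.+1%:R ^+ d.-1 * F j.
Proof.
move=> F0 Im.
have h u : u \in I -> u != v -> F (ldist u v) =
    \sum_(1 <= j < m) (ldist u v == j : nat)%:R * F j.
  move=> uI uv; have uv1 : (1 <= ldist u v)%N.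
    rewrite lt0n; apply: contra uv => /eqP uv0.
    have : (ldist u v <= 0)%N by rewrite uv0.
    rewrite ldist_leP => /forallP uvi; apply/eqP/rowP => i; move: (uvi i).
    by move: (u ord0 i) (v ord0 i); clear; lia.
  rewrite (bigD1_seq (ldist u v)) ?iota_uniq//=; last by rewrite mem_index_iota uv1 Im.
  rewrite eqxx mul1r big1 ?addr0// => j; rewrite eq_sym => /negbTE ->.
  by rewrite mul0r.
rewrite big_seq_cond; under eq_bigr => u /andP[uI uv] do rewrite h//.
rewrite -big_seq_cond exchange_big/= mulr_sumr big_nat [leRHS]big_nat.
apply: ler_sum => j /andP[j1 jm].
rewrite -mulr_suml mulrA; apply: ler_wpM2r => //.
apply: (@le_trans _ _ (\sum_(u <- I) (ldist u v == j : nat)%:R)).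
  rewrite big_mkcond; apply: ler_sum => u _; case: ifP => // _.
rewrite sum_indicator.
apply: (@le_trans _ _ (2 * d * (2 * j).+1 ^ d.-1)%:R).
  by rewrite ler_nat sphere_card.
rewrite -natrX -natrM ler_nat -[leqRHS]mulnA leq_mul2l; apply/orP; right.
by rewrite -expnMn leq_expn2r// mulnS; clear; lia.
Qed.

End lattice_distance.

(** * Hitting times at exponential scales *)

Section borel_cantelli.
Context {R : realType} {disp : measure_display} {T : measurableType disp}.
Variable Q : probability T R.

Lemma eventually_not_ae (E : nat -> set T) (C q : R) :
  (forall n, measurable (E n)) -> 0 <= C -> 0 <= q -> q < 1 ->
  (\forall n \near \oo, (Q (E n) <= (C * q ^+ n)%:E)%E) ->
  {ae Q, forall y, \forall n \near \oo, ~ E n y}.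
Proof.
move=> mE C0 q0 q1 [n0 _ hn0].
pose F n := if (n < n0)%N then set0 else E n.
have mF n : measurable (F n) by rewrite /F; case: ifP.
have QF n : (Q (F n) <= (C * q ^+ n)%:E)%E.
  rewrite /F; case: ltnP => [_|h]; last exact: hn0.
  by rewrite measure0 lee_fin mulr_ge0// exprn_ge0.
have lim0 : Q (lim_sup_set F) = 0%E.
  apply: lim_sup_set_cvg0 => //.
  apply: (@le_lt_trans _ _ (\sum_(0 <= n <oo) (C * q ^+ n)%:E)%E).
    by apply: lee_nneseries => n _; rewrite ?QF// measure_ge0.
  have := @cvg_geometric_series R C q; rewrite ger0_norm// => /(_ q1) h.
  rewrite (_ : (fun k => _) = EFin \o series (geometric C q)); last first.
    by apply/funext => k /=; rewrite sumEFin.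
  rewrite (cvg_lim _ (cvg_EFin _ h))//; first exact: ltry.
  exact: nearW.
exists (lim_sup_set F); split=> //.
  apply: bigcap_measurable => [|n _]; first by exists 0%N.
  exact: bigcup_measurable.
move=> y /= hy n _; apply: contrapT => nF; apply: hy.
exists (maxn n n0) => // m /=; rewrite geq_max => /andP[nm n0m] Em.
by apply: nF; exists m => //; rewrite /F ltnNge n0m.
Qed.

End borel_cantelli.

Section waiting_asymptotics.
Context {R : realType}.
Variables (d : nat) (r : R).
Hypothesis d_gt0 : (0 < d)%N.
Hypothesis r0 : 0 <= r.

(** A search box of this side has volume at most [exp(n^d (r - 2 e))]. *)
Definition early (e : R) n : nat := Num.truncn (expR (n%:R ^+ d * (r - 2 * e) / d%:R)).

(** Number of grid points along each side of the box searched by time [late];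
    the grid has at least [exp(n^d (r + 2 e))] points. *)
Definition grid_side (e : R) n : nat :=
  (Num.truncn (expR (n%:R ^+ d * (r + 2 * e) / d%:R))).+1.

(** The mesh [2 n^d] times the side of the grid. The factor [2 n^d] is
    subexponential on the scale [n^d], so it does not change the exponent. *)
Definition late (e : R) n : nat := (2 * n ^ d * grid_side e n)%N.

Lemma early_pow (e : R) n : (early e n)%:R ^+ d <= expR (n%:R ^+ d * (r - 2 * e)).
Proof.
apply: (@le_trans _ _ (expR (n%:R ^+ d * (r - 2 * e) / d%:R) ^+ d)).
  by rewrite lerXn2r ?nnegrE ?expR_ge0// /early truncn_le expR_ge0.
by rewrite -expRM_natl mulrC divfK// pnatr_eq0 -lt0n.
Qed.

Lemma early_lt (e : R) n : expR (n%:R ^+ d * (r - 2 * e)) < (early e n).+1%:R ^+ d.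
Proof.
apply: (@le_lt_trans _ _ (expR (n%:R ^+ d * (r - 2 * e) / d%:R) ^+ d)).
  by rewrite -expRM_natl [d%:R * _]mulrC divfK// pnatr_eq0 -lt0n.
by rewrite ltrXn2r ?expR_ge0 ?truncnS_gt// -lt0n.
Qed.

Lemma grid_side_pow (e : R) n :
  expR (n%:R ^+ d * (r + 2 * e)) <= (grid_side e n)%:R ^+ d.
Proof.
apply: (@le_trans _ _ (expR (n%:R ^+ d * (r + 2 * e) / d%:R) ^+ d)).
  by rewrite -expRM_natl [d%:R * _]mulrC divfK// pnatr_eq0 -lt0n.
by rewrite lerXn2r ?nnegrE ?expR_ge0// ltW// truncnS_gt.
Qed.

Lemma ln_volume_small (e : R) : 0 < e ->
  \forall n \near \oo, d%:R * ln (4 * n%:R ^+ d) <= n%:R ^+ d * e :> R.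
Proof.
move=> e0; have d0 : 0 < d%:R :> R by rewrite ltr0n.
pose a := e / (8 * d%:R); have a0 : 0 < a by rewrite divr_gt0// mulr_gt0.
pose k := d%:R * (- 1 - ln a).
near=> n; have n1 : 1 <= n%:R :> R by near: n; exact: nbhs_infty_ger.
have kn : 2 * k / e <= n%:R by near: n; exact: nbhs_infty_ger.
have nN : n%:R <= n%:R ^+ d :> R by rewrite ler_eXnr.
move: (n%:R ^+ d : R) nN => N nN.
have N0 : 0 < N by rewrite (lt_le_trans _ nN)// (lt_le_trans _ n1).
have h : ln (4 * N) <= a * (4 * N) - 1 - ln a.
  have l4 : ln (a * (4 * N)) = ln a + ln (4 * N).
    by rewrite lnM// posrE// mulr_gt0.
  have e4 : expR (ln (a * (4 * N))) = a * (4 * N) by rewrite lnK// posrE mulr_gt0// mulr_gt0.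
  by have := expR_ge1Dx (ln (a * (4 * N))); rewrite e4 l4; clear; lra.
have kN : k <= N * e / 2.
  move: kn; rewrite ler_pdivrMr// => kn.
  have : n%:R * e <= N * e by rewrite ler_wpM2r// ltW.
  by clear -kn; lra.
have : d%:R * ln (4 * N) <= d%:R * (a * (4 * N) - 1 - ln a) by rewrite ler_wpM2l// ltW.
have -> : d%:R * (a * (4 * N) - 1 - ln a) = N * e / 2 + k.
  by rewrite /k /a; field; rewrite gt_eqF.
by clear -kN; lra.
Unshelve. all: by end_near. Qed.

Lemma late_le (e : R) : 0 < e -> \forall n \near \oo,
  (0 < late e n)%N /\ ln ((late e n)%:R ^+ d) <= n%:R ^+ d * (r + 3 * e).
Proof.
move=> e0; have d0 : 0 < d%:R :> R by rewrite ltr0n.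
near=> n; have n1 : (0 < n)%N by near: n; exists 1%N.
have N0 : 0 < n%:R ^+ d :> R by rewrite exprn_gt0// ltr0n.
have nl : (0 < late e n)%N by rewrite /late !muln_gt0/= expn_gt0 n1.
split=> //; set b := n%:R ^+ d * (r + 2 * e) / d%:R.
have b0 : 0 <= b.
  by rewrite divr_ge0 ?(ltW d0)// mulr_ge0 ?(ltW N0)// addr_ge0// mulr_ge0// ltW.
have lateb : (late e n)%:R <= 4 * n%:R ^+ d * expR b.
  rewrite /late !natrM natrX.
  have : (grid_side e n)%:R <= 2 * expR b.
    rewrite /grid_side -natr1 -/b.
    have : (Num.truncn (expR b))%:R <= expR b by rewrite truncn_le expR_ge0.
    by have := expR_ge1Dx b; clear -b0; lra.
  move=> h; apply: (@le_trans _ _ (2 * n%:R ^+ d * (2 * expR b))).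
    by rewrite ler_wpM2l// mulr_ge0// ltW.
  by rewrite le_eqVlt; apply/orP; left; apply/eqP; ring.
rewrite lnXn ?ltr0n// -[X in X <= _]mulr_natl.
apply: (@le_trans _ _ (d%:R * ln (4 * n%:R ^+ d * expR b))).
  by rewrite ler_pM2l// ler_ln// posrE ?ltr0n// !mulr_gt0 ?expR_gt0.
rewrite lnM ?posrE ?mulr_gt0 ?expR_gt0// expRK mulrDr.
have -> : d%:R * b = n%:R ^+ d * (r + 2 * e) by rewrite /b mulrC divfK// gt_eqF.
have : d%:R * ln (4 * n%:R ^+ d) <= n%:R ^+ d * e :> R by near: n; exact: ln_volume_small.
by move: (n%:R ^+ d) => N h; clear -h; lra.
Unshelve. all: by end_near. Qed.

Definition hitting (h : nat -> Prop) : \bar R :=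
  ereal_inf [set i%:R%:E | i in [set i : nat | (0 < i)%N /\ h i]].

Lemma hitting_ge (h : nat -> Prop) m : (forall i, (0 < i <= m)%N -> ~ h i) ->
  (m.+1%:R%:E <= hitting h)%E.
Proof.
move=> hm; apply: le_ereal_inf_tmp => _ [i [i0 hi] <-]; rewrite lee_fin ler_nat.
by rewrite ltnNge; apply/negP => im; apply: (hm i) => //; rewrite i0.
Qed.

Lemma hitting_le (h : nat -> Prop) i : (0 < i)%N -> h i ->
  (hitting h <= i%:R%:E)%E.
Proof. by move=> i0 hi; apply: ereal_inf_lbound; exists i. Qed.

Lemma cvg_ereal_real (u : nat -> \bar R) (l : R) :
  (forall e, 0 < e -> \forall n \near \oo, ((l - e)%:E <= u n <= (l + e)%:E)%E) ->
  u n @[n --> \oo] --> l%:E.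
Proof.
move=> h; apply/fine_cvgP; split.
  near=> n; have : ((l - 1)%:E <= u n <= (l + 1)%:E)%E by near: n; exact: h.
  by case: (u n) => [s _|/andP[_]|/andP[]].
apply/cvgrPdist_le => e e0; near=> n.
have : ((l - e)%:E <= u n <= (l + e)%:E)%E by near: n; exact: h.
rewrite /= distrC ler_norml; case: (u n) => [s| |] /andP[]//.
by rewrite !lee_fin /= => h1 h2; clear -h1 h2; lra.
Unshelve. all: by end_near. Qed.

(** The hitting time lies between the two scales for large [n], for every [e] of
    a sequence tending to [0]. *)
Lemma log_hitting_cvg (h : nat -> nat -> Prop) :
  (forall n i j, (i <= j)%N -> h n i -> h n j) ->
  (forall j : nat, \forall n \near \oo, ~ h n (early j.+1%:R^-1 n)) ->
  (forall j : nat, \forall n \near \oo, h n (late j.+1%:R^-1 n)) ->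
  (((n%:R ^+ d)^-1)%:E * lne (hitting (h n) ^+ d))%E @[n --> \oo] --> r%:E.
Proof.
move=> mono hearly hlate; apply: cvg_ereal_real => e e0.
have [j je] := exists_invn_lt (divr_gt0 e0 (ltr0n R 3)).
set e' := j.+1%:R^-1 in je; have e'0 : 0 < e' by rewrite invr_gt0.
near=> n; have n1 : (0 < n)%N by near: n; exists 1%N.
have N0 : 0 < n%:R ^+ d :> R by rewrite exprn_gt0// ltr0n.
have [l0 lle] : (0 < late e' n)%N /\ ln ((late e' n)%:R ^+ d) <= n%:R ^+ d * (r + 3 * e').
  by near: n; exact: late_le.
have W1 : ((early e' n).+1%:R%:E <= hitting (h n))%E.
  apply: hitting_ge => i /andP[_ ie] hi.
  have : ~ h n (early e' n) by near: n; exact: hearly.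
  by apply; exact: mono hi.
have W2 : (hitting (h n) <= (late e' n)%:R%:E)%E.
  by apply: hitting_le => //; near: n; exact: hlate.
case: (hitting (h n)) W1 W2 => [w| |]//; rewrite !lee_fin => W1 W2.
have w0 : 0 < w by rewrite (lt_le_trans _ W1).
rewrite -EFin_expe lne_EFin ?exprn_gt0// -EFinM !lee_fin.
rewrite ler_pdivlMl// ler_pdivrMl//; apply/andP; split.
  apply: (@le_trans _ _ (n%:R ^+ d * (r - 2 * e'))).
    by rewrite ler_pM2l//; clear -je e'0; lra.
  rewrite -ler_expR lnK ?posrE ?exprn_gt0//.
  apply: le_trans (ltW (early_lt _ _)) _.
  by rewrite lerXn2r// nnegrE// ltW.
apply: (@le_trans _ _ (n%:R ^+ d * (r + 3 * e'))).
  apply: le_trans lle; rewrite ler_ln ?posrE ?exprn_gt0 ?ltr0n//.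
  by rewrite lerXn2r// nnegrE// ltW.
by rewrite ler_pM2l//; clear -je e'0; lra.
Unshelve. all: by end_near. Qed.

End waiting_asymptotics.

Lemma le_measure_bigcup_fset {R : realType} {disp : measure_display}
    {T : measurableType disp} (Q : probability T R) (K : choiceType)
    (I : {fset K}) (F : K -> set T) :
  (forall k, measurable (F k)) ->
  (Q (\bigcup_(k in [set` I]) F k) <= \sum_(k <- I) Q (F k))%E.
Proof.
move=> mF; rewrite bigcup_fset; elim: (enum_fset I) => [|k s IH].
  by rewrite !big_nil measure0.
rewrite !big_cons; apply: le_trans (measureU2 _ _ _) _ => //.
  exact: bigsetU_measurable.
by rewrite leeD2l.
Qed.

Section hits.
Context {R : realType} {d : nat} {disp : measure_display}.
Context {T : measurableType disp}.
Local Notation Y := (config (lattice d) T).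
Variable Q : probability Y R.
Hypothesis Q_stat : stationary Q.
Hypothesis d_gt0 : (0 < d)%N.

Definition hit (M : set Y) (i : nat) (y : Y) : Prop :=
  exists2 u, search_box d i u & M (shift u y).

Lemma search_boxE i : search_box d i = [set` box (const_mx (-1)) i].
Proof.
apply/seteqP; split=> u.
  move=> h; rewrite /= in_box; apply/forallP => j; move: (h j); rewrite !mxE.
  by move: (u ord0 j); clear; lia.
rewrite /= in_box => /forallP h j; move: (h j); rewrite !mxE.
by move: (u ord0 j); clear; lia.
Qed.

Lemma hit_mono M i j y : (i <= j)%N -> hit M i y -> hit M j y.
Proof.
move=> ij [u ui My]; exists u => // k; move: (ui k) ij.
by move: (u ord0 k); clear; lia.
Qed.

Lemma hitE M i : [set y | hit M i y] =
  \bigcup_(u in [set` box (const_mx (-1) : lattice d) i]) (shift u @^-1` M).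
Proof. by rewrite -search_boxE; apply/seteqP; split=> y [u ui My]; exists u. Qed.

Lemma measurable_hit M i : measurable M -> measurable [set y | hit M i y].
Proof.
move=> mM; rewrite hitE; apply: fin_bigcup_measurable => // u _.
exact: measurable_preimage_shift.
Qed.

(** By stationarity each of the [i ^ d] translates has the probability of
    [M]. *)
Lemma hit_le M i : measurable M ->
  (Q [set y | hit M i y] <= (i%:R ^+ d * fine (Q M))%:E)%E.
Proof.
move=> mM; rewrite hitE.
apply: le_trans (le_measure_bigcup_fset _ _ _) _ => [u|].
  exact: measurable_preimage_shift.
rewrite (eq_bigr (fun=> (fine (Q M))%:E)); last first.
  by move=> u _; rewrite Q_stat// fineK// fin_num_measure.
by rewrite sumEFin big_const_seq count_predT iter_addr_0 card_box -natrX mulr_natl.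
Qed.

(** Second moment method along a grid of mesh [2 n^d] inside the search box,
    which makes the translates far enough apart for the hypothesis on pairs; the
    correlations are then summed over shells around each grid point. *)
Lemma miss_le M (n K : nat) (psi : nat -> R) (C : R) : measurable M ->
  (0 < n)%N -> (forall j, 0 <= psi j) ->
  (forall u v j, (0 < j)%N ->
     (2 * n ^ d * j <= ldist u v)%N ->
     fine (Q (shift u @^-1` M `&` shift v @^-1` M)) <=
       fine (Q M) * (fine (Q M) + psi j)) ->
  (forall m, \sum_(1 <= j < m) j.+1%:R ^+ d.-1 * psi j <= C) ->
  0 < fine (Q M) -> (0 < K)%N ->
  K%:R ^+ d * fine (Q M) * fine (Q [set y | ~ hit M (2 * n ^ d * K) y]) <=
    1 + (2 * d * 2 ^ d.-1)%:R * C.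
Proof.
move=> mM n0 psi0 pair psiC p0 K0; set p := fine (Q M) in pair p0 *.
pose I := box (const_mx (-1) : lattice d) K.
pose s := (2 * n ^ d)%N; have s0 : (0 < s)%N by rewrite muln_gt0 expn_gt0 n0.
pose E (k : lattice d) := shift (s%:Z *: k) @^-1` M.
have mE k : measurable (E k) by exact: measurable_preimage_shift.
have QE k : fine (Q (E k)) = p by rewrite /E Q_stat.
have cardI : #|` I|%:R = K%:R ^+ d :> R by rewrite card_box natrX.
have ldistI k k' : k \in I -> k' \in I -> (ldist k' k < K)%N.
  rewrite !in_box => /forallP h /forallP h'.
  suff : (ldist k' k <= K.-1)%N by rewrite -ltnS prednK.
  rewrite ldist_leP; apply/forallP => i; move: (h i) (h' i) K0; rewrite !mxE.
  by move: (k ord0 i) (k' ord0 i); clear; lia.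
have ldistZ (k k' : lattice d) : (s * ldist k k' <= ldist (s%:Z *: k) (s%:Z *: k'))%N.
  rewrite mulnC -leq_divRL//; apply/bigmax_leqP => i _; rewrite leq_divRL//.
  apply: leq_trans (leq_bigmax i); rewrite !mxE -mulrBr abszM mulnC.
  exact: leqnn.
(* The diagonal term contributes [p], the other pairs [p^2] and the sum of
   [p psi] over the shells. *)
have pairI k : k \in I -> \sum_(k' <- I) fine (Q (E k `&` E k')) <=
    #|` I|%:R * p ^+ 2 + (1 + (2 * d * 2 ^ d.-1)%:R * C) * p.
  move=> kI; rewrite (big_fsetD1 k)//= setIid QE.
  apply: (@le_trans _ _ (p + \sum_(k' <- (I `\ k)%fset) (p ^+ 2 + p * psi (ldist k' k)))).
    rewrite lerD2l big_seq [leRHS]big_seq; apply: ler_sum => k'.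
    rewrite in_fsetD1 => /andP[k'k k'I].
    rewrite setIC (_ : p ^+ 2 + _ = p * (p + psi (ldist k' k))); last by ring.
    apply: pair; last by rewrite ldistZ.
    rewrite lt0n; apply: contra k'k => /eqP k0; apply/eqP/rowP => i.
    have : (ldist k' k <= 0)%N by rewrite k0.
    rewrite ldist_leP => /forallP/(_ i).
    by move: (k ord0 i) (k' ord0 i); clear; lia.
  rewrite big_split/= -[X in p + (_ + X)]mulr_sumr.
  have h1 : \sum_(k' <- (I `\ k)%fset) p ^+ 2 <= #|` I|%:R * p ^+ 2.
    rewrite big_const_seq count_predT iter_addr_0 -[leLHS]mulr_natl.
    by rewrite ler_wpM2r ?sqr_ge0// ler_nat fsubset_leq_card// fsubsetDl.
  have h2 : \sum_(k' <- (I `\ k)%fset) psi (ldist k' k) <= (2 * d * 2 ^ d.-1)%:R * C.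
    apply: (@le_trans _ _ ((2 * d * 2 ^ d.-1)%:R * \sum_(1 <= j < K) j.+1%:R ^+ d.-1 * psi j)).
      rewrite -[leLHS](_ : \sum_(k' <- I | k' != k) psi (ldist k' k) = _).
        by apply: sum_ldist_le => // k' k'I; exact: ldistI.
      by rewrite big_fset_condE; apply: eq_fbigl => x; rewrite !inE/= andbC.
    by rewrite ler_wpM2l.
  exact: miss_arith.
have m0 : 0 < #|` I|%:R * p by rewrite mulr_gt0// cardI exprn_gt0// ltr0n.
have := second_moment mE (fun k _ => QE k) pairI m0.
rewrite cardI; apply: le_trans; rewrite ler_pM2l; last by rewrite -cardI.
have mA : measurable [set y | forall k, k \in I -> ~ E k y].
  exact: measurable_none.
have mh : measurable [set y | ~ hit M (2 * n ^ d * K) y].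
  exact: measurableC (measurable_hit _ mM).
apply: fine_le; rewrite ?fin_num_measure//; apply: le_measure; rewrite ?inE//.
move=> y /= nhit k kI Eky; apply: nhit; exists (s%:Z *: k) => //.
move=> i; move: kI; rewrite in_box => /forallP/(_ i); rewrite !mxE.
move: (k ord0 i) s0 K0; rewrite /s; move: (2 * n ^ d)%N => t; clear; nia.
Qed.

End hits.

(** * From matching probabilities to waiting times *)

Section quenched_waiting.
Context {R : realType} {d : nat} {disp : measure_display}.
Context {T : measurableType disp}.
Local Notation Y := (config (lattice d) T).
Variable Q : probability Y R.
Hypothesis Q_stat : stationary Q.
Hypothesis d_gt0 : (0 < d)%N.
Variable r : R.
Hypothesis r0 : 0 <= r.
Variable M : nat -> set Y.
Hypothesis mM : forall n, measurable (M n).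
Hypothesis rate_M : decay_rate (fun n => n%:R ^+ d) (fun n => fine (Q (M n))) r.

Lemma expRN_pow (e : R) n : 0 < e -> expR (- (n%:R ^+ d * e)) <= expR (- e) ^+ n.
Proof.
move=> e0; rewrite -expRM_natl ler_expR mulrN lerN2 ler_wpM2r ?(ltW e0)//.
by case: n => [|n]; rewrite ?exprn_ge0// ler_eXnr// ler1n.
Qed.

Lemma expRN_lt1 (e : R) : 0 < e -> expR (- e) < 1.
Proof. by move=> e0; rewrite expR_lt1 oppr_lt0. Qed.

(** By [hit_le] the probability of a hit is at most [exp(n^d (r - 2 e))] times
    [exp(- n^d (r - e))]. *)
Lemma eventually_not_early e : 0 < e ->
  {ae Q, forall y, \forall n \near \oo, ~ hit (M n) (early d r e n) y}.
Proof.
move=> e0.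
apply: (@eventually_not_ae _ _ _ Q (fun n => [set y | hit (M n) (early d r e n) y])
    1 (expR (- e))) => //; rewrite ?expR_ge0 ?expRN_lt1//.
  by move=> n; exact: measurable_hit.
near=> n; apply: le_trans (hit_le Q_stat _ (mM n)) _; rewrite lee_fin mul1r.
apply: le_trans (expRN_pow n e0).
have /andP[_ pn] : expR (- (n%:R ^+ d * (r + e))) <= fine (Q (M n)) <=
  expR (- (n%:R ^+ d * (r - e))) by near: n; exact: rate_M.
apply: (@le_trans _ _ (expR (n%:R ^+ d * (r - 2 * e)) * expR (- (n%:R ^+ d * (r - e))))).
  apply: ler_pM; [exact: exprn_ge0|exact: fine_ge0| |exact: pn].
  exact: early_pow.
rewrite -expRD ler_expR le_eqVlt; apply/orP; left; apply/eqP; ring.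
Unshelve. all: by end_near. Qed.

(** By [miss_le] the probability of a miss is at most a constant over the mean
    number of hits on the grid, and this mean is at least [exp(n^d (r + 2 e))]
    times [exp(- n^d (r + e))]. *)
Lemma eventually_late (psi : nat -> nat -> R) (C : R) e : 0 < e ->
  (forall n j, 0 <= psi n j) ->
  (\forall n \near \oo, (forall u v j, (0 < j)%N ->
     (2 * n ^ d * j <= ldist u v)%N ->
     fine (Q (shift u @^-1` M n `&` shift v @^-1` M n)) <=
       fine (Q (M n)) * (fine (Q (M n)) + psi n j)) /\
    (forall m, \sum_(1 <= j < m) j.+1%:R ^+ d.-1 * psi n j <= C)) ->
  {ae Q, forall y, \forall n \near \oo, hit (M n) (late d r e n) y}.
Proof.
move=> e0 psi0 hpair.
set C' := 1 + (2 * d * 2 ^ d.-1)%:R * `|C|.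
have : {ae Q, forall y, \forall n \near \oo, ~ ~ hit (M n) (late d r e n) y}.
  apply: (@eventually_not_ae _ _ _ Q (fun n => [set y | ~ hit (M n) (late d r e n) y])
    C' (expR (- e))) => //; rewrite ?expR_ge0 ?expRN_lt1//.
  - by move=> n; apply: measurableC; exact: measurable_hit.
  - by rewrite addr_ge0// mulr_ge0.
  near=> n.
  have n0 : (0 < n)%N by near: n; exists 1%N.
  have [pairn psin] : (forall u v j, (0 < j)%N ->
     (2 * n ^ d * j <= ldist u v)%N ->
     fine (Q (shift u @^-1` M n `&` shift v @^-1` M n)) <=
       fine (Q (M n)) * (fine (Q (M n)) + psi n j)) /\
    (forall m, \sum_(1 <= j < m) j.+1%:R ^+ d.-1 * psi n j <= C) by near: n.
  have /andP[pn _] : expR (- (n%:R ^+ d * (r + e))) <= fine (Q (M n)) <=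
    expR (- (n%:R ^+ d * (r - e))) by near: n; exact: rate_M.
  have p0 : 0 < fine (Q (M n)) by rewrite (lt_le_trans _ pn)// expR_gt0.
  have K0 : (0 < grid_side d r e n)%N by [].
  have := miss_le Q_stat (mM n) n0 (psi0 n) pairn psin p0 K0.
  rewrite -/(late d r e n) => h.
  have mh : measurable [set y | ~ hit (M n) (late d r e n) y].
    by apply: measurableC; exact: measurable_hit.
  rewrite -[leLHS]fineK ?fin_num_measure// lee_fin.
  set q := fine (Q [set y | ~ _]) in h *.
  have q0 : 0 <= q by rewrite fine_ge0.
  apply: (@le_trans _ _ (C' * expR (- (n%:R ^+ d * e)))); last first.
    by rewrite ler_wpM2l ?expRN_pow// addr_ge0// mulr_ge0.
  rewrite -ler_pdivrMr ?expR_gt0// -expRN opprK mulrC.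
  apply: (@le_trans _ _ (1 + (2 * d * 2 ^ d.-1)%:R * C)); last first.
    by rewrite lerD2l ler_wpM2l// ler_norm.
  apply: le_trans h; rewrite ler_wpM2r//.
  apply: (@le_trans _ _ (expR (n%:R ^+ d * (r + 2 * e)) * expR (- (n%:R ^+ d * (r + e))))).
    rewrite -expRD ler_expR le_eqVlt; apply/orP; left; apply/eqP; ring.
  by apply: ler_pM => //; rewrite ?expR_ge0 ?grid_side_pow.
apply: filterS => y; apply: filterS => n; exact: contrapT.
Unshelve. all: by end_near. Qed.

End quenched_waiting.

Section independent_pairs.
Context {R : realType} {dispO dispA dispB : measure_display}.
Context {Omega : measurableType dispO} {S : measurableType dispA} {T : measurableType dispB}.
Variables (Pr : probability Omega R) (X : {RV Pr >-> S}) (Y : {RV Pr >-> T}).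
Hypothesis XY_indep : independent_fields X Y.

Lemma measurable_joint : measurable_fun setT (fun w => (X w, Y w)).
Proof. by apply/measurable_fun_pairP; split; exact: measurable_funPT. Qed.

(** Both sides are measures that agree on products of sets. *)
Lemma joint_law G : measurable G -> (distribution Pr X \x distribution Pr Y)%E G =
    pushforward Pr (fun w => (X w, Y w)) G.
Proof.
move=> mG; pose m' := pushforward Pr (mfun_Sub (mem_set measurable_joint)).
apply: (@product_measure_unique _ _ _ _ R (distribution Pr X) (distribution Pr Y) m') => //.
Qed.

(** Under the product law, an event almost all of whose sections are full is
    full. *)
Lemma independent_ae (G : set (S * T)) : measurable G ->
  {ae distribution Pr X, forall x, {ae distribution Pr Y, forall y, G (x, y)}} ->
  {ae Pr, forall w, G (X w, Y w)}.
Proof.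
move=> mG aeG; have mXY := measurable_joint.
exists ((fun w => (X w, Y w)) @^-1` (~` G)); split => //.
- by rewrite -[X in measurable X]setTI; apply: mXY => //; exact: measurableC.
- rewrite -[LHS]/(pushforward Pr (fun w => (X w, Y w)) (~` G)) -joint_law; last first.
    exact: measurableC.
  rewrite /product_measure1/=.
  rewrite (eq_integral (fun x => `|distribution Pr Y (xsection (~` G) x)|%E)); last first.
    by move=> x _; rewrite gee0_abs.
  apply/ae_eq_integral_abs => //.
    by apply: measurable_fun_xsection; exact: measurableC.
  apply: filterS aeG => x aeGx _ /=; apply/negligibleP.
    by apply: measurable_xsection; exact: measurableC.
  apply: negligibleS aeGx => y /=; rewrite /xsection/= inE.
  by [].
Qed.

Lemma integral_indep (f : S -> \bar R) (g : T -> \bar R) :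
  measurable_fun setT f -> measurable_fun setT g ->
  (forall x, 0 <= f x)%E -> (forall y, 0 <= g y)%E ->
  (\int[Pr]_w (f (X w) * g (Y w)) = (\int[Pr]_w f (X w)) * \int[Pr]_w g (Y w))%E.
Proof.
move=> mf mg f0 g0.
have mfg : measurable_fun setT (fun z : S * T => f z.1 * g z.2)%E.
  apply: emeasurable_funM; exact: measurableT_comp.
have fg0 z : (0 <= f z.1 * g z.2)%E by exact: mule_ge0.
transitivity (\int[pushforward Pr (fun w => (X w, Y w))]_z (f z.1 * g z.2))%E.
  by rewrite (ge0_integral_pushforward measurable_joint).
transitivity (\int[distribution Pr X \x distribution Pr Y]_z (f z.1 * g z.2))%E.
  apply: eq_measure_integral => [|mS A mA _]; first exact: measurable_joint.
  exact: esym (joint_law mA).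
rewrite (@fubini_tonelli1 _ _ _ _ _ _ _ (fun z => f z.1 * g z.2)%E)//=.
rewrite /fubini_F/=; under eq_integral do rewrite ge0_integralZl//.
rewrite ge0_integralZr//; last by apply: integral_ge0.
by rewrite !ge0_integral_distribution.
Qed.

End independent_pairs.

Section waiting_limit.
Context {R : realType} {d : nat} {dispO dispA dispB : measure_display}.
Context {Omega : measurableType dispO} {S : measurableType dispA} {T : measurableType dispB}.
Local Notation config := (config (lattice d) T).
Variables (Pr : probability Omega R) (X : {RV Pr >-> S}) (Y : {RV Pr >-> config}).
Hypothesis XY_indep : independent_fields X Y.
Hypothesis Y_stat : stationary (distribution Pr Y).
Hypothesis d_gt0 : (0 < d)%N.
Variable M : nat -> S -> set config.
Hypothesis mM : forall n, measurable [set z : S * config | M n z.1 z.2].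

Lemma measurable_joint_hit n i : measurable [set z | hit (M n z.1) i z.2].
Proof.
rewrite (_ : [set z | _] = \bigcup_(u in [set` box (const_mx (-1) : lattice d) i])
    (fun z : S * config => (z.1, shift u z.2)) @^-1` [set z | M n z.1 z.2]); last first.
  by rewrite -search_boxE; apply/seteqP; split=> z [u ui Mz]; exists u.
apply: fin_bigcup_measurable => // u _; rewrite -[X in measurable X]setTI.
apply: measurable_fun_pair => //; exact: measurableT_comp (measurable_shift u) _.
Qed.

Lemma measurable_slice n x : measurable (M n x).
Proof.
have := measurable_xsection x (mM n); congr measurable.
by apply/seteqP; split=> y; rewrite /xsection/= inE.
Qed.

Lemma measurable_eventually (E : nat -> set (S * config)) :
  (forall n, measurable (E n)) ->
  measurable [set z | \forall n \near \oo, E n z].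
Proof.
move=> mE; rewrite (_ : [set z | _] = \bigcup_m \bigcap_(n in [set n | (m <= n)%N]) E n).
  by apply: bigcup_measurable => m _; apply: bigcap_measurable => //; exists m => /=.
by apply/seteqP; split=> z [m _ h]; exists m.
Qed.

(** The decay of [M n x] and the decoupling of its translates are assumed for
    almost every [x] separately, so that the almost sure bounds are first
    obtained for [x] fixed and then transferred to the pair. *)
Lemma waiting_limit (r : R) : 0 <= r ->
  {ae distribution Pr X, forall x,
    decay_rate (fun n => n%:R ^+ d) (fun n => fine (distribution Pr Y (M n x))) r} ->
  {ae distribution Pr X, forall x, exists psi C, [/\ forall n j, 0 <= psi n j :> R &
     \forall n \near \oo, (forall u v j, (0 < j)%N ->
       (2 * n ^ d * j <= ldist u v)%N ->
       fine (distribution Pr Y (shift u @^-1` M n x `&` shift v @^-1` M n x)) <=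
         fine (distribution Pr Y (M n x)) *
           (fine (distribution Pr Y (M n x)) + psi n j)) /\
      (forall m, \sum_(1 <= j < m) j.+1%:R ^+ d.-1 * psi n j <= C :> R)]} ->
  {ae Pr, forall w,
    (((n%:R ^+ d)^-1)%:E * lne (hitting (fun i => hit (M n (X w)) i (Y w)) ^+ d))%E
      @[n --> \oo] --> r%:E}.
Proof.
move=> r0 hrate hpair.
pose E1 j n := [set z : S * config | ~ hit (M n z.1) (early d r j.+1%:R^-1 n) z.2].
pose E2 j n := [set z : S * config | hit (M n z.1) (late d r j.+1%:R^-1 n) z.2].
pose G := \bigcap_j ([set z | \forall n \near \oo, E1 j n z] `&`
                     [set z | \forall n \near \oo, E2 j n z]).
have mG : measurable G.
  apply: bigcapT_measurable => j; apply: measurableI; apply: measurable_eventually => n.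
    by apply: measurableC; exact: measurable_joint_hit.
  exact: measurable_joint_hit.
have aeG : {ae distribution Pr X, forall x, {ae distribution Pr Y, forall y, G (x, y)}}.
  apply: filterS2 hrate hpair => x rx [psi [C [psi0 px]]].
  have ej j : 0 < j.+1%:R^-1 :> R by rewrite invr_gt0.
  apply/ae_foralln => j.
  have := eventually_not_early Y_stat d_gt0 (fun n => measurable_slice n x) rx (ej j).
  have := eventually_late Y_stat d_gt0 (fun n => measurable_slice n x) rx (ej j) psi0 px.
  by apply: filterS2 => y h2 h1 _; split.
have := independent_ae XY_indep mG aeG; apply: filterS => w Gw.
apply: log_hitting_cvg => //.
- by move=> n i j; exact: hit_mono.
- by move=> j; have [] := Gw j I.
- by move=> j; have [] := Gw j I.
Qed.

End waiting_limit.

(** * Block costs *)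

Lemma measurable_eval {disp : measure_display} {I : Type} {T : measurableType disp}
  (i : I) : measurable_fun [set: config I T] (fun x => x i).
Proof.
move=> _ B mB; rewrite setTI; apply: sub_sigma_algebra; by exists i, B.
Qed.

Lemma cubeE d n : cube d n = [set` box (0 : lattice d) n].
Proof.
apply/seteqP; split=> u.
  move=> h; rewrite /= in_box; apply/forallP => j; move: (h j); rewrite !mxE.
  by move: (u ord0 j); clear; lia.
rewrite /= in_box => /forallP h j; move: (h j); rewrite !mxE.
by move: (u ord0 j); clear; lia.
Qed.

Lemma finite_cube d n : finite_set [set: cube d n].
Proof.
have -> : [set: cube d n] = (set_val : cube d n -> lattice d) @^-1` cube d n.
  by apply/seteqP; split=> u // _; exact: set_valP.
apply: finite_preimage; last by rewrite cubeE; exact: finite_fset.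
by move=> u v _ _; exact: val_inj.
Qed.

Lemma Rintegral_le0 {R : realType} {disp : measure_display} {T : measurableType disp}
    (P : probability T R) (f : T -> R) : (forall x, f x <= 0) ->
  \int[P]_x f x = - fine (\int[P]_x (- f x)%:E)%E.
Proof.
move=> f0; rewrite /Rintegral -fineN; congr fine.
rewrite -integral_ge0N; last by move=> x _; rewrite lee_fin oppr_ge0.
by apply: eq_integral => x _; rewrite -EFinN opprK.
Qed.

Section block_cost.
Context {R : realType} {d : nat} {dispA dispB : measure_display}.
Context {A : measurableType dispA} {B : measurableType dispB}.
Variable rho : A -> B -> R.
Hypothesis rho0 : forall a b, 0 <= rho a b.
Hypothesis mrho : measurable_fun setT (fun z : A * B => rho z.1 z.2).
Local Notation XA := (config (lattice d) A).
Local Notation XB := (config (lattice d) B).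

(** The cost [rho_n] read on whole configurations. Working on one space for all
    [n] lets ergodic averages and limits in [n] be taken at a fixed pair [x],
    [y]. *)
Definition block_cost (n : nat) (x : XA) (y : XB) : R :=
  (n%:R ^+ d)^-1 * \sum_(u <- box 0 n) rho (x u) (y u).

Lemma block_costE n x y :
  block_cost n x y = (n%:R ^+ d)^-1 * \sum_(u <- box 0 n) rho (x u) (y u).
Proof. by []. Qed.

Lemma rho_n_restr n x y :
  rho_n rho (restr (cube d n) x) (restr (cube d n) y) = block_cost n x y.
Proof.
rewrite /rho_n /block_cost; congr (_ * _).
rewrite [RHS]fsbig_seq ?fset_uniq// -cubeE.
rewrite (@reindex_fsbig _ _ _ _ _ (set_val : cube d n -> lattice d) [set: cube d n])//.
Qed.

Lemma block_cost_ge0 n x y : 0 <= block_cost n x y.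
Proof. by rewrite mulr_ge0 ?invr_ge0 ?exprn_ge0// sumr_ge0. Qed.

Lemma rho_n_ge0 n (x : config (cube d n) A) (y : config (cube d n) B) :
  0 <= rho_n rho x y.
Proof.
rewrite mulr_ge0 ?invr_ge0 ?exprn_ge0//.
by apply: fsumr_ge0.
Qed.

Lemma measurable_site {I : Type} (u : I) :
  measurable_fun setT (fun z : config I A * config I B => rho (z.1 u) (z.2 u)).
Proof.
have h : measurable_fun setT (fun z : config I A * config I B => (z.1 u, z.2 u)).
  apply/measurable_fun_pairP; split.
    exact: (measurableT_comp (measurable_eval u)).
  exact: (measurableT_comp (measurable_eval u)).
exact: (measurableT_comp mrho h).
Qed.

Lemma measurable_block_cost n :
  measurable_fun setT (fun z : XA * XB => block_cost n z.1 z.2).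
Proof.
apply: measurable_funM => //; apply: measurable_sum => u.
exact: measurable_site.
Qed.

Lemma measurable_rho_n n :
  measurable_fun setT (fun z : config (cube d n) A * config (cube d n) B =>
    rho_n rho z.1 z.2).
Proof.
apply: measurable_funM => //.
rewrite (_ : (fun z => _) = (fun z : config (cube d n) A * config (cube d n) B =>
    \sum_(u <- fset_set [set: cube d n]) rho (z.1 u) (z.2 u))); last first.
  by apply/funext => z; rewrite fsbig_finite//; exact: finite_cube.
apply: measurable_sum => u.
exact: measurable_site.
Qed.

End block_cost.

Section block_laws.
Context {R : realType} {d : nat} {dispA dispB : measure_display}.
Context {A : measurableType dispA} {B : measurableType dispB}.
Variable rho : A -> B -> R.
Hypothesis rho0 : forall a b, 0 <= rho a b.
Hypothesis mrho : measurable_fun setT (fun z : A * B => rho z.1 z.2).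
Variables (P : probability (config (lattice d) A) R) (Q : probability (config (lattice d) B) R).
Local Notation Pn n := (law_on P (cube d n)).
Local Notation Qn n := (law_on Q (cube d n)).
Local Notation block_cost := (block_cost rho).
Local Notation rho_n := (@rho_n R d _ _ A B rho _).

Lemma ge0_integral_law_on {disp : measure_display} {T : measurableType disp}
    (P' : probability (config (lattice d) T) R) (U : set (lattice d))
    (f : config U T -> \bar R) :
  measurable_fun setT f -> (forall x, 0 <= f x)%E ->
  (\int[law_on P' U]_x f x = \int[P']_x f (restr U x))%E.
Proof.
by move=> mf f0; rewrite /law_on ge0_integral_distribution.
Qed.

Lemma partition_fun_restr n l x :
  partition_fun (Qn n) rho_n l (restr (cube d n) x) = partition_fun Q (block_cost n) l x.
Proof.
rewrite /partition_fun /Rintegral; congr fine.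
rewrite ge0_integral_law_on.
- by apply: eq_integral => y _; rewrite rho_n_restr.
- apply/measurable_EFinP; apply: measurableT_comp => //; apply: measurable_funM => //.
  exact: (measurable_section (@measurable_rho_n R d _ _ A B rho mrho n)).
- by move=> y; rewrite lee_fin expR_ge0.
Qed.

Lemma free_energy_restr n l x :
  free_energy (Qn n) rho_n l (restr (cube d n) x) = free_energy Q (block_cost n) l x.
Proof. by rewrite /free_energy partition_fun_restr. Qed.

Lemma log_mgf_block n l : l <= 0 ->
  log_mgf (Pn n) (Qn n) rho_n l = log_mgf P Q (block_cost n) l.
Proof.
move=> l0.
have mr := @measurable_rho_n R d _ _ A B rho mrho n; have r0 := @rho_n_ge0 R d _ _ A B rho rho0 n.
rewrite /log_mgf Rintegral_le0; last by move=> x; exact: (free_energy_le0 _ r0 mr x l0).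
rewrite Rintegral_le0; last by move=> x; exact: (free_energy_le0 Q (block_cost_ge0 rho0 n) (measurable_block_cost mrho n) x l0).
congr (- fine _); rewrite ge0_integral_law_on.
- by apply: eq_integral => x _; rewrite free_energy_restr.
- apply/measurable_EFinP; apply: measurableT_comp => //.
  exact: (measurable_free_energy _ mr).
- move=> x; rewrite lee_fin oppr_ge0.
  exact: (free_energy_le0 _ r0 mr x l0).
Qed.

Lemma mean_cost_restr n : mean_cost (Pn n) (Qn n) rho_n = mean_cost P Q (block_cost n).
Proof.
have mr := @measurable_rho_n R d _ _ A B rho mrho n; have r0 := @rho_n_ge0 R d _ _ A B rho rho0 n.
rewrite /mean_cost ge0_integral_law_on.
- apply: eq_integral => x _; rewrite ge0_integral_law_on.
  + by apply: eq_integral => y _; rewrite rho_n_restr.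
  + by apply/measurable_EFinP; exact: (measurable_section mr).
  + by move=> y; rewrite lee_fin rho_n_ge0.
- exact: (measurable_mean_section Q r0 mr) || exact: (measurable_mean_section _ r0 mr).
- by move=> x; apply: integral_ge0 => y _; rewrite lee_fin rho_n_ge0.
Qed.

(** The mean cost at any single site, which is also the mean cost of any
    block. *)
Definition site_cost : \bar R := mean_cost P Q (fun x y => rho (x 0) (y 0)).

Hypotheses (P_stat : stationary P) (Q_stat : stationary Q).

Lemma mean_cost_site u : mean_cost P Q (fun x y => rho (x u) (y u)) = site_cost.
Proof.
rewrite /site_cost /mean_cost.
have m0 := measurable_site mrho (0 : lattice d).
rewrite -[RHS](ge0_integral_shift P_stat u); last 2 first.
- exact: (measurable_mean_section Q (c := fun (x : config (lattice d) A) (y : config (lattice d) B) => rho (x 0) (y 0)) (fun _ _ => rho0 _ _) m0).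
- by move=> x; apply: integral_ge0 => y _; rewrite lee_fin.
apply: eq_integral => x _; rewrite -[RHS](ge0_integral_shift Q_stat u).
- by apply: eq_integral => y _; rewrite /shift/= addr0.
- by apply/measurable_EFinP; exact: (measurable_section (c := fun (x : config (lattice d) A) (y : config (lattice d) B) => rho (x 0) (y 0)) m0).
- by move=> y; rewrite lee_fin.
Qed.

Lemma mean_cost_block n : (0 < n)%N -> mean_cost P Q (block_cost n) = site_cost.
Proof.
move=> n0; have N0 : 0 < n%:R ^+ d :> R by rewrite exprn_gt0// ltr0n.
rewrite (mean_cost_prod P Q (block_cost_ge0 rho0 n) (measurable_block_cost mrho n)).
under eq_integral do rewrite EFinM -sumEFin.
rewrite ge0_integralZl ?lee_fin ?invr_ge0 ?(ltW N0)//; last 2 first.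
- by apply: emeasurable_sum => u; apply/measurable_EFinP; exact: measurable_site.
- by move=> z _; apply: sume_ge0 => u _; rewrite lee_fin.
rewrite ge0_integral_sum//; last 2 first.
- by move=> u; apply/measurable_EFinP; exact: measurable_site.
- by move=> u z _; rewrite lee_fin.
rewrite (eq_bigr (fun=> site_cost)); last first.
  move=> u _; rewrite -(mean_cost_site u).
  rewrite (mean_cost_prod P Q (c := fun (x : config (lattice d) A) (y : config (lattice d) B) => rho (x u) (y u)))//.
  exact: measurable_site.
rewrite big_const_seq count_predT (_ : iter _ _ _ = (n%:R ^+ d)%:E * site_cost)%E.
  by rewrite muleA -EFinM mulVf ?mul1e// gt_eqF.
rewrite -natrX card_box mule_natl; elim: (n ^ d)%N => [|k IH]//=.
by rewrite IH; case: k {IH} => //=; rewrite adde0.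
Qed.

Lemma D_avE : D_av rho P Q = site_cost.
Proof.
rewrite -(mean_cost_block (n := 1))// -mean_cost_restr /D_av.
rewrite (mean_cost_prod _ _ (@rho_n_ge0 R d _ _ A B rho rho0 1))//.
exact: measurable_rho_n.
Qed.

(** The infimum of the scaled entropies is the scaled infimum; this connects the
    rate to [min_entropy]. *)
Lemma rate_nE n D : (0 < n)%N ->
  rate_n rho P Q n D = (((n%:R ^+ d)^-1)%:E * min_entropy (Pn n) (Qn n) rho_n D)%E.
Proof.
move=> n0; have N0 : 0 < n%:R ^+ d :> R by rewrite exprn_gt0// ltr0n.
rewrite /rate_n /min_entropy.
apply/eqP; rewrite eq_le; apply/andP; split.
  rewrite muleC -lee_pdivrMr ?invr_gt0// invrK.
  apply: le_ereal_inf_tmp => _ [V VD <-].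
  rewrite muleC -lee_pdivlMl//.
  by apply: ereal_inf_lbound; exists V.
apply: le_ereal_inf_tmp => _ [V VD <-].
rewrite lee_pmul2l ?lte_fin ?invr_gt0//; apply: ereal_inf_lbound; by exists V.
Qed.

End block_laws.

(** * Events carried by finite regions *)

Section extension.
Context {d : nat} {disp : measure_display} {T : measurableType disp}.
Local Notation Y := (config (lattice d) T).

Definition extend (U : set (lattice d)) (z : config U T) : Y :=
  fun v => if insub v is Some w then z w else point.

Lemma measurable_extend U : measurable_fun setT (@extend U).
Proof.
apply: (measurability (@cylinders _ (lattice d) T)) => // _ [_ [v [B mB ->]] <-].
rewrite setTI /preimage/= /extend; case: insub => [w|].
  by rewrite -[X in measurable X]setTI; exact: measurable_eval.
have [Bp|nBp] := pselect (B point).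
  by rewrite (_ : mkset _ = setT)//; apply/seteqP; split.
by rewrite (_ : mkset _ = set0)//; apply/seteqP; split.
Qed.

(** Freezing the coordinates outside [U] keeps the configuration space fixed, so
    that events over different regions can be compared there. *)
Definition localize (U : set (lattice d)) (y : Y) : Y := extend (restr U y).

Lemma localizeE U y v : localize U y v = if v \in U then y v else point.
Proof.
rewrite /localize /extend; case: insubP => [w -> <-|/negbTE -> //].
by [].
Qed.

Lemma measurable_localize U : measurable_fun setT (localize U).
Proof. exact: measurableT_comp (@measurable_extend U) _. Qed.

Definition depends_on (U : set (lattice d)) (M : set Y) :=
  forall y, M (localize U y) <-> M y.

Lemma events_on_depends U M : measurable M -> depends_on U M -> events_on U M.
Proof.
move=> mM UM; exists (@extend U @^-1` M).
  by rewrite -[X in measurable X]setTI; exact: measurable_extend.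
by rewrite setTI; apply/seteqP; split=> y /UM.
Qed.

End extension.

Section independence.
Context {R : realType} {d : nat} {disp : measure_display} {T : measurableType disp}.
Local Notation Y := (config (lattice d) T).
Variable Q : probability Y R.
Hypothesis Q_iid : iid Q.

Definition rectangle (s : {fset lattice d}) (E : lattice d -> set T) : set Y :=
  [set y | forall u, u \in s -> E u (y u)].

Lemma measurable_rectangle s E : (forall u, measurable (E u)) ->
  measurable (rectangle s E).
Proof.
move=> mE; rewrite (_ : rectangle s E = \bigcap_(u in [set` s]) ((fun y => y u) @^-1` E u)).
  apply: fin_bigcap_measurable => // u _.
  by rewrite -[X in measurable X]setTI; exact: measurable_eval.
by apply/seteqP; split.
Qed.

Definition rectangles : set (set Y) :=
  [set M | exists s E, (forall u, measurable (E u)) /\ M = rectangle s E].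

Lemma rectangles_setI : setI_closed rectangles.
Proof.
move=> _ _ [s [E [mE ->]]] [t [F [mF ->]]].
exists (s `|` t)%fset, (fun u => (if u \in s then E u else setT) `&`
                                (if u \in t then F u else setT)); split.
  by move=> u; apply: measurableI; case: ifP.
apply/seteqP; split=> y.
  by move=> [h1 h2] u ust; split; case: ifP => // us; [exact: h1|exact: h2].
move=> h; split=> u us; have := h u; rewrite in_fsetU us ?orbT => /(_ isT)[]//.
Qed.

Lemma measurable_rectangles : @measurable _ Y = <<s rectangles >>.
Proof.
apply/seteqP; split.
  apply: smallest_sub; first exact: smallest_sigma_algebra.
  move=> _ [u [B mB ->]]; apply: sub_sigma_algebra.
  exists [fset u]%fset, (fun=> B); split=> //.
  apply/seteqP; split=> y; first by move=> h v; rewrite in_fset1 => /eqP ->.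
  by apply; rewrite in_fset1.
apply: smallest_sub; first exact: sigma_algebra_measurable.
by move=> _ [s [E [mE ->]]]; exact: measurable_rectangle.
Qed.

(** Restricting [Q] to [G] gives a measure that is proportional to [Q] on
    rectangles over [W]. After localization to [W], every rectangle is a
    rectangle over [W] or empty, and rectangles generate the events. *)
Lemma rectangle_indep (W : {fset lattice d}) (G F : set Y) :
  measurable G -> measurable F ->
  (forall s E, (forall u, measurable (E u)) -> (s `<=` W)%fset ->
    Q (G `&` rectangle s E) = Q G * Q (rectangle s E))%E ->
  depends_on [set` W] F -> Q (G `&` F) = (Q G * Q F)%E.
Proof.
move=> mG mF GE WF.
have mk : measurable_fun setT (localize [set` W] : Y -> Y) := measurable_localize _.
pose QG := fine (Q G); have QGE : (QG%:E = Q G)%E by rewrite fineK// fin_num_measure.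
have QG0 : 0 <= QG by rewrite fine_ge0.
pose m1 := pushforward (mrestr Q mG) (mfun_Sub (mem_set mk)).
pose m2 := mscale (NngNum QG0) (distribution Q (mfun_Sub (mem_set mk))).
have E12 s E : (forall u, measurable (E u)) -> m1 (rectangle s E) = m2 (rectangle s E).
  move=> mE; rewrite /m1 /m2 /distribution /pushforward /mscale /mrestr/= QGE [X in Q X]setIC.
  rewrite -[distribution Q _ _]/(Q (localize [set` W] @^-1` rectangle s E)).
  pose E' u := if u \in W then E u else setT.
  have mE' u : measurable (E' u) by rewrite /E'; case: ifP.
  have [Ep|nEp] := pselect (forall u, u \in s -> u \notin W -> E u point).
    suff -> : localize [set` W] @^-1` rectangle s E = rectangle (s `&` W)%fset E'.
      by apply: GE => //; exact: fsubsetIr.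
    apply/seteqP; split=> y h u.
      rewrite in_fsetI => /andP[us uW]; rewrite /E' uW.
      by have := h u us; rewrite localizeE mem_setE uW.
    move=> us; rewrite localizeE mem_setE; case: ifPn => uW; last exact: Ep.
    by have := h u; rewrite in_fsetI us uW /E' uW; apply.
  suff -> : localize [set` W] @^-1` rectangle s E = set0.
    by rewrite setI0 !measure0 mule0.
  apply/seteqP; split=> // y h; apply: nEp => u us uW.
  by have := h u us; rewrite localizeE mem_setE (negbTE uW).
have : m1 F = m2 F.
  apply: (@measure_unique _ _ _ rectangles (fun=> setT)) => //.
  - exact: measurable_rectangles.
  - exact: rectangles_setI.
  - move=> _; exists fset0, (fun=> setT); split => //.
    by apply/seteqP; split => // y _ u; rewrite in_fset0.
  - by rewrite bigcup_const.
  - by move=> _ [s [E [mE ->]]]; exact: E12.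
  - move=> _; rewrite /m1 /pushforward /mrestr/=.
    apply: le_lt_trans (ltry 1); apply: probability_le1.
    by rewrite preimage_setT setTI.
have WF' : localize [set` W] @^-1` F = F by apply/seteqP; split=> y /WF.
rewrite /m1 /m2 /pushforward /mscale /mrestr/= QGE.
by rewrite -[distribution Q _ F]/(Q (localize [set` W] @^-1` F)) WF' setIC.
Qed.

(** Apply [rectangle_indep] once for each of the two events, starting from two
    rectangles. *)
Lemma iid_indep (U W : {fset lattice d}) (G F : set Y) :
  measurable G -> measurable F -> [disjoint U & W]%fset ->
  depends_on [set` U] G -> depends_on [set` W] F ->
  Q (G `&` F) = (Q G * Q F)%E.
Proof.
move=> mG mF UW UG WF; apply: (rectangle_indep mG mF _ WF) => s E mE sW.
have mS := measurable_rectangle s mE.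
rewrite setIC muleC; apply: (rectangle_indep mS mG _ UG) => t E' mE' tU.
pose E2 u := if u \in s then E u else E' u.
have mE2 u : measurable (E2 u) by rewrite /E2; case: ifP.
have st u : u \in t -> u \notin s.
  move=> ut; apply/negP => us; move/fdisjointP: UW => /(_ u).
  by rewrite (fsubsetP tU _ ut) (fsubsetP sW _ us) => /(_ isT).
have -> : rectangle s E `&` rectangle t E' = rectangle (s `|` t)%fset E2.
  apply/seteqP; split=> y.
    move=> [h1 h2] u; rewrite in_fsetU /E2; case: ifP => us /= ut; first exact: h1.
    exact: h2.
  move=> h; split=> u ut; have := h u; rewrite in_fsetU ut ?orbT /E2 ?ut; first exact.
  by rewrite (negbTE (st _ ut)); exact.
have [_ prodE] := Q_iid.
rewrite /rectangle !prodE//.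
rewrite (perm_big (s ++ t))/= ?big_cat/=; last first.
  apply: uniq_perm; rewrite ?fset_uniq//.
    rewrite cat_uniq !fset_uniq andbT/=; apply/hasPn => u /= ut; exact: st.
  by move=> u; rewrite mem_cat in_fsetU.
congr (_ * _)%E; rewrite big_seq [RHS]big_seq; apply: eq_bigr => u ut; rewrite /E2.
  by rewrite ut.
by rewrite (negbTE (st _ ut)).
Qed.

Lemma depends_on_localize (U : set (lattice d)) (F : set Y) : depends_on U (localize U @^-1` F).
Proof.
move=> y; rewrite /preimage/= (_ : localize U (localize U y) = localize U y)//.
apply/funext => v; rewrite 2!localizeE.
by case: (v \in U).
Qed.

(** Induction on the sites: the first factor and the remaining product are
    functions of the configuration localized to disjoint regions, and these
    localized configurations are independent. *)
Lemma iid_integral_prod (s : seq (lattice d)) (h : lattice d -> T -> R) : uniq s ->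
  (forall v, measurable_fun setT (h v)) -> (forall v a, 0 <= h v a) ->
  (\int[Q]_y (\prod_(v <- s) h v (y v))%:E = \prod_(v <- s) \int[Q]_y (h v (y v))%:E)%E.
Proof.
move=> + mh h0; elim: s => [_|u s IH /= /andP[us uniqs]].
  rewrite big_nil; under eq_integral do rewrite big_nil.
  exact: integral_prob_cst.
rewrite big_cons -IH//.
pose W := [fset v in s]%fset; pose U := [fset u]%fset.
have mU := @measurable_localize _ _ T [set` U]; have mW := @measurable_localize _ _ T [set` W].
pose X1 : {RV Q >-> Y} := mfun_Sub (mem_set mU).
pose X2 : {RV Q >-> Y} := mfun_Sub (mem_set mW).
have ind : independent_fields X1 X2.
  move=> E F mE mF.
  apply: (@iid_indep U W); [| | |exact: depends_on_localize|exact: depends_on_localize].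
  - by rewrite -[X in measurable X]setTI; exact: measurable_localize.
  - by rewrite -[X in measurable X]setTI; exact: measurable_localize.
  - by apply/fdisjointP => v; rewrite in_fset1 => /eqP ->; rewrite in_fset.
have := @integral_indep _ _ _ _ _ _ _ _ X1 X2 ind (fun y => (h u (y u))%:E)
  (fun y => (\prod_(v <- s) h v (y v))%:E).
have e1 y : X1 y u = y u by rewrite /X1/= localizeE mem_setE in_fset1 eqxx.
have e2 y : \prod_(v <- s) h v (X2 y v) = \prod_(v <- s) h v (y v).
  rewrite big_seq [RHS]big_seq; apply: eq_bigr => v vs.
  by rewrite /X2/= localizeE mem_setE in_fset vs.
under eq_integral do rewrite e1 e2.
under [X in _ = (X * _)%E]eq_integral do rewrite e1.
under [X in _ = (_ * X)%E]eq_integral do rewrite e2.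
under [X in _ -> X = _]eq_integral do rewrite big_cons EFinM.
apply.
- by apply/measurable_EFinP; exact: measurableT_comp (mh u) (measurable_eval u).
- apply/measurable_EFinP; apply: measurable_prod => v _.
  exact: measurableT_comp (mh v) (measurable_eval v).
- by move=> y; rewrite lee_fin.
- by move=> y; rewrite lee_fin prodr_ge0.
Qed.

End independence.

(** * Matches between two fields *)

Section matching.
Context {R : realType} {d : nat} {dispO dispA dispB : measure_display}.
Context {Omega : measurableType dispO} {A : measurableType dispA} {B : measurableType dispB}.
Variable rho : A -> B -> R.
Hypothesis rho0 : forall a b, 0 <= rho a b.
Hypothesis mrho : measurable_fun setT (fun z : A * B => rho z.1 z.2).
Local Notation XA := (config (lattice d) A).
Local Notation XB := (config (lattice d) B).
Local Notation block_cost := (@block_cost R d dispA dispB A B rho).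

Definition match_at (D : R) (n : nat) (x : XA) : set XB :=
  [set y | block_cost n x y <= D].

Lemma measurable_match D n : measurable [set z : XA * XB | match_at D n z.1 z.2].
Proof.
rewrite -[X in measurable X]setTI; apply: measurable_fun_le => //.
exact: measurable_block_cost.
Qed.

Lemma measurable_match_at D n x : measurable (match_at D n x).
Proof. exact: (measurable_slice (measurable_match D)). Qed.

Lemma match_ball_prob (Q : probability XB R) D n x :
  fine (Q (match_at D n x)) = ball_prob Q (fun n => block_cost n x) D n.
Proof.
rewrite -Rintegral_indic; last exact: measurable_match_at.
apply: eq_Rintegral => y _.
by rewrite indicE /match_at; congr (nat_of_bool _)%:R; apply/idP/idP; rewrite inE.
Qed.

(** A match of the block at [u] only looks at the sites of that block. *)
Lemma match_shift_depends D n x u :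
  depends_on [set` box u n] (shift u @^-1` match_at D n x).
Proof.
move=> y; rewrite /preimage /match_at/=.
suff -> : block_cost n x (shift u (localize [set` box u n] y)) = block_cost n x (shift u y) by [].
rewrite !block_costE big_seq [in RHS]big_seq; congr (_ * _).
apply: eq_bigr => v vn; congr rho; rewrite /shift/= localizeE mem_setE ifT//.
move: vn; rewrite !in_box => /forallP h; apply/forallP => i; move: (h i); rewrite !mxE.
by move: (u ord0 i) (v ord0 i); clear; lia.
Qed.

Lemma box_disjoint (u v : lattice d) n : (n <= ldist u v)%N -> (0 < n)%N ->
  [disjoint box u n & box v n]%fset.
Proof.
move=> uvn n0; apply/fdisjointP => w; rewrite !in_box => /forallP hu; apply/negP => /forallP hv.
have : (ldist u v <= n.-1)%N.
  rewrite ldist_leP; apply/forallP => i; move: (hu i) (hv i) n0.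
  by move: (u ord0 i) (v ord0 i) (w ord0 i); clear; lia.
by rewrite leqNgt prednK// uvn.
Qed.

Lemma log_waitingE D x y n : log_waiting rho D x y n =
  (((n%:R ^+ d)^-1)%:E * lne (hitting (fun i => hit (match_at D n x) i y) ^+ d))%E.
Proof.
rewrite /log_waiting /waiting_time /hitting; congr (_ * lne (ereal_inf _ ^+ d))%E.
apply/seteqP; split=> _ [i [i0 [u ui h]] <-]; exists i => //; split=> //; exists u => //.
  by rewrite /match_at/= -rho_n_restr.
by rewrite rho_n_restr.
Qed.

Variables (Pr : probability Omega R) (X : {RV Pr >-> XA}) (Y : {RV Pr >-> XB}).
Hypothesis XY_indep : independent_fields X Y.
Local Notation P := (distribution Pr X).
Local Notation Q := (distribution Pr Y).
Hypothesis Q_stat : stationary Q.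
Hypothesis d_gt0 : (0 < d)%N.

(** What is left of the waiting-time asymptotics: the decay of the matching
    probability, and a decoupling of events carried by distant blocks. The
    decoupling does not involve the first field. *)
Lemma log_waiting_cvg (D r : R) (psi : nat -> nat -> R) (C : R) : 0 <= r ->
  {ae P, forall x, decay_rate (fun n => n%:R ^+ d) (ball_prob Q (fun n => block_cost n x) D) r} ->
  (forall n j, 0 <= psi n j) ->
  (\forall n \near \oo, (forall u v j (G F : set XB), (0 < j)%N ->
      (2 * n ^ d * j <= ldist u v)%N -> measurable G -> measurable F ->
      depends_on [set` box u n] G -> depends_on [set` box v n] F ->
      fine (Q (G `&` F)) <= fine (Q F) * (fine (Q G) + psi n j)) /\
    (forall m, \sum_(1 <= j < m) j.+1%:R ^+ d.-1 * psi n j <= C)) ->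
  {ae Pr, forall w, log_waiting rho D (X w) (Y w) n @[n --> \oo] --> r%:E}.
Proof.
move=> r0 hrate psi0 hpair.
suff h : {ae Pr, forall w, (((n%:R ^+ d)^-1)%:E *
    lne (hitting (fun i => hit (match_at D n (X w)) i (Y w)) ^+ d))%E @[n --> \oo] --> r%:E}.
  apply: filterS h => w.
  rewrite (_ : log_waiting rho D (X w) (Y w) = (fun n => ((n%:R ^+ d)^-1)%:E *
    lne (hitting (fun i => hit (match_at D n (X w)) i (Y w)) ^+ d))%E)//.
  by apply/funext => n; rewrite log_waitingE.
apply: (waiting_limit XY_indep Q_stat d_gt0 (measurable_match D) r0).
  apply: filterS hrate => x; congr (decay_rate _ _ _).
  by apply/funext => n; rewrite match_ball_prob.
apply: aeW => x; exists psi, C; split => //; apply: filterS hpair => n [h psiC].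
have mM := measurable_match_at D n x.
split => // u v j j0 uvj.
apply: le_trans (h u v j _ _ j0 uvj (measurable_preimage_shift u mM)
  (measurable_preimage_shift v mM) (match_shift_depends D n x u)
  (match_shift_depends D n x v)) _.
by rewrite !Q_stat.
Qed.

(** Blocks at distance at least [2 n^d] are disjoint, so [psi = 0] will do. *)
Lemma iid_decoupled : iid Q ->
  (\forall n \near \oo, (forall u v j (G F : set XB), (0 < j)%N ->
      (2 * n ^ d * j <= ldist u v)%N -> measurable G -> measurable F ->
      depends_on [set` box u n] G -> depends_on [set` box v n] F ->
      fine (Q (G `&` F)) <= fine (Q F) * (fine (Q G) + 0 : R)) /\
    (forall m, \sum_(1 <= j < m) j.+1%:R ^+ d.-1 * 0 <= 0 :> R)).
Proof.
move=> Q_iid; near=> n; have n0 : (0 < n)%N by near: n; exists 1%N.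
split=> [u v j G F j0 uvj mG mF uG vF|m]; last first.
  by rewrite big1// => j _; rewrite mulr0.
rewrite (iid_indep Q_iid mG mF _ uG vF).
  by rewrite fineM ?fin_num_measure// addr0 mulrC.
apply: box_disjoint => //; apply: leq_trans uvj.
have : (n <= n ^ d)%N by rewrite -[leqLHS]expn1 leq_pexp2l.
by move: (n ^ d)%N j0 => N; clear; nia.
Unshelve. all: by end_near. Qed.

End matching.

(** * Slopes and essential infima *)

Lemma continuous_at_near (R : realType) (f : R -> R) (l d : R) :
  {for l, continuous f} -> 0 < d ->
  exists2 t, 0 < t & forall s, `|s| < t -> `|f l - f (l + s)| < d.
Proof.
move=> /cvgrPdist_lt fl d0; have [t /= t0 ht] := fl _ d0; exists t => // s st.
by apply: ht; rewrite /= opprD addNKr normrN.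
Qed.

Section tilting_arithmetic.
Variable R : realFieldType.
Implicit Types a b l t x D e r : R.

Lemma half_step_neg l t : l < 0 -> t <= - l / 2 -> l + t < 0.
Proof. lra. Qed.

Lemma near_below D b x : `|D - b - x| < b -> x < D.
Proof. by rewrite ltr_norml => /andP[]; lra. Qed.

Lemma near_above D b x : `|D - x| < b -> D - b < x.
Proof. by rewrite ltr_norml => /andP[]; lra. Qed.

Lemma increment_right l t x D a b : b + (l - (l + t)) * x <= a ->
  t * x < t * D -> b - a < t * D.
Proof. by lra. Qed.

Lemma increment_left l t x D a b : b + (l - (l - t)) * x <= a ->
  t * D < t * x -> b - a < - (t * D).
Proof. by lra. Qed.

Lemma exponent_shift l l1 D b e r a : l * D - a <= r -> (l1 - l) * b <= 0 ->
  2 * (- l1) * b <= e -> l * (D - b - b) - a <= r + e.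
Proof. by nra. Qed.

Lemma steep_slope a D b : - a < D * b -> - b * D - a < 0.
Proof. by lra. Qed.

End tilting_arithmetic.

Section tilting_bounds.
Context {R : realType} {dS dT : measure_display}.
Context {S : measurableType dS} {T : measurableType dT}.
Variables (mu : probability S R) (nu : probability T R).
Variable c : S -> T -> R.
Hypothesis c0 : forall x y, 0 <= c x y.
Hypothesis mc : measurable_fun setT (fun z : S * T => c z.1 z.2).
Hypothesis cfin : (mean_cost mu nu c < +oo)%E.
Local Notation L := (log_mgf mu nu c).
Local Notation f := (tilted_cost mu nu c).

(** With [D0] slightly below [D], tilt at the slope [l] of mean cost [D0]: on
    the two sides of [l] the increments of [L] are controlled by [D] and by
    [D1 = 2 D0 - D], and the exponent is nearly that of [D]. *)
Lemma exists_lower_tilt (D l1 r e : R) : (D%:E < mean_cost mu nu c)%E -> l1 < 0 ->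
  l1 * D - L l1 < 0 -> (forall l, l <= 0 -> l * D - L l <= r) -> 0 < e ->
  exists l t D1, [/\ l <= 0, 0 < t, l + t <= 0 &
    [/\ L (l + t) - L l < t * D, L (l - t) - L l < - (t * D1) &
        l * D1 - L l <= r + e]].
Proof.
move=> Dc l10 l1D hr e0.
(* Moving [D] by [2 delta] costs at most [e] in the exponent, slopes being at
   least [l1]; moving it by [delta] leaves the value at [l1] negative. *)
pose delta := Num.min (e / (2 * (- l1))) ((L l1 - l1 * D) / (2 * (- l1))).
have nl1 : 0 < - l1 by rewrite oppr_gt0.
have delta0 : 0 < delta.
  by rewrite lt_min !divr_gt0 ?mulr_gt0// subr_gt0 -subr_lt0.
have de : 2 * (- l1) * delta <= e.
  by rewrite mulrC -ler_pdivlMr ?mulr_gt0// ge_min lexx.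
have dl : l1 * (D - delta) - L l1 < 0.
  have : delta <= (L l1 - l1 * D) / (2 * (- l1)) by rewrite ge_min lexx orbT.
  rewrite ler_pdivlMr; last by rewrite mulr_gt0.
  by move: (L l1) l1D; clear; intros; lra.
pose D0 := D - delta.
have D0c : (D0%:E < mean_cost mu nu c)%E.
  by apply: lt_trans Dc; rewrite lte_fin ltrBlDr ltrDl.
have [l [l1l l0 fl]] := exists_tilt c0 mc cfin D0c l10 dl.
have cf := continuous_tilted_cost c0 mc cfin l0.
have [s0 s0p ht0] := continuous_at_near cf delta0; rewrite fl in ht0.
have [t [t0 lt0 tD tD1]] : exists t, [/\ 0 < t, l + t < 0, f (l + t) < D & D0 - delta < f (l - t)].
  pose t := Num.min (s0 / 2) (- l / 2).
  have tp : 0 < t by rewrite lt_min !divr_gt0// oppr_gt0.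
  have tt0 : t < s0.
    by rewrite (@le_lt_trans _ _ (s0 / 2))// ?ge_min ?lexx// gtr_pMr// invf_lt1// ltr1n.
  have tl : t <= - l / 2 by rewrite ge_min lexx orbT.
  exists t; split => //.
  - exact: half_step_neg.
  - have : `|D0 - f (l + t)| < delta by apply: ht0; rewrite gtr0_norm.
    exact: near_below.
  - have : `|D0 - f (l - t)| < delta.
      by apply: ht0; rewrite normrN gtr0_norm.
    exact: near_above.
exists l, t, (D0 - delta); split; rewrite ?(ltW l0) ?(ltW lt0)//; split.
- apply: increment_right (log_mgf_subgradient c0 mc cfin lt0 (ltW l0)) _.
  by rewrite ltr_pM2l.
- have lm0 : l - t < 0 by rewrite subr_lt0 (lt_trans l0).
  apply: increment_left (log_mgf_subgradient c0 mc cfin lm0 (ltW l0)) _.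
  by rewrite ltr_pM2l.
- apply: exponent_shift (hr l (ltW l0)) _ de.
  by rewrite mulr_le0_ge0 ?subr_le0// ltW.
Qed.

Local Notation ess_cost x := (ess_inf nu (fun y => (c x y)%:E)).

(** The quotient [- ln Z / s] is a mean cost seen at slope [- s]; as [s] grows
    it only feels the cheapest [y]. *)
Lemma free_energy_cvg_ess_inf x :
  ((- free_energy nu c (- n.+1%:R) x / n.+1%:R)%:E @[n --> \oo] --> ess_cost x)%E.
Proof.
have n0 n : - n.+1%:R <= 0 :> R by rewrite oppr_le0.
pose h n := - free_energy nu c (- n.+1%:R) x / n.+1%:R.
have mcx := measurable_section mc x.
have low (a : R) n : (a%:E <= ess_cost x)%E -> a <= h n.
  move/ess_infP => aec; rewrite /h ler_pdivlMr// lerNr -ler_expR.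
  rewrite (expR_free_energy nu c0 mc x (n0 n)) -[leRHS](Rintegral_prob_cst nu) -lee_fin.
  rewrite !EFin_Rintegral; first last.
  - exact: integrable_expc.
  - exact: finite_measure_integrable_cst.
  apply: le_integral_ae; [exact: integrable_expc|by []|].
  apply: filterS aec => y; rewrite !lee_fin ler_expR => ay.
  by rewrite mulNr lerN2 mulrC ler_wpM2l.
(* If [c x] is below [a] with probability [p > 0], then [Z >= p exp(- s a)]. *)
have up (a : R) : (ess_cost x < a%:E)%E -> exists k : R, forall n, h n <= a + k / n.+1%:R.
  move=> ea; pose E := [set y | c x y < a].
  have mE : measurable E.
    by rewrite -[X in measurable X]setTI; apply: measurable_fun_ltr.
  pose p := fine (nu E).
  have p0 : 0 < p.
    rewrite lt_neqAle fine_ge0// andbT; apply/eqP => p0.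
    move: ea; rewrite ltNge => /negP; apply; apply/ess_infP.
    exists E; split=> //; first by rewrite -[LHS]fineK ?fin_num_measure// -/p -p0.
    by move=> y /= /negP; rewrite -ltNge lte_fin.
  exists (- ln p) => n; rewrite /h ler_pdivrMr// mulrDl divfK//.
  rewrite lerNl opprD opprK -ler_expR (expR_free_energy nu c0 mc x (n0 n)) expRD lnK//.
  rewrite mulrC /p -(Rintegral_indic nu mE).
  have iE : nu.-integrable setT (EFin \o (\1_E : T -> R)).
    by apply: (@bounded_integrable _ _ _ _ _ 1) => // y; rewrite indicE; case: (_ \in _); rewrite ?normr0 ?normr1.
  rewrite -RintegralZr//; apply: le_Rintegral => //.
  - have := integrableZ_EFin (expR (- (a * n.+1%:R))) iE; congr (integrable _ _ _).
    by apply/funext => y /=; rewrite mulrC.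
  - exact: integrable_expc.
  - move=> y _; rewrite indicE; have [|_] := boolP (y \in E); last by rewrite mul0r expR_ge0.
    rewrite inE /E/= => ya; rewrite mul1r ler_expR mulNr lerN2 mulrC.
    by rewrite ler_wpM2r// ltW.
have e0 : (0%:E <= ess_cost x)%E by apply/ess_infP; apply: aeW => y; rewrite lee_fin.
have efin : ess_cost x \is a fin_num.
  rewrite ge0_fin_numE// ltey; apply/eqP => eoo.
  by have := low (h 0%N + 1) 0%N; rewrite eoo leey => /(_ isT); rewrite gerDl ler10.
rewrite -(fineK efin) in low up *; move: (fine _) low up => e low up.
apply: cvg_ereal_real => eps eps0.
have [k hk] : exists k : R, forall n, h n <= e + eps / 2 + k / n.+1%:R.
  by apply: up; rewrite lte_fin ltrDl divr_gt0.
near=> n; rewrite !lee_fin; apply/andP; split.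
  by apply: (@le_trans _ _ e); [rewrite gerBl ltW|exact: low].
apply: le_trans (hk n) _; rewrite -addrA lerD2l [leRHS]splitr lerD2l.
rewrite ler_pdivrMr// mulrC -ler_pdivrMr ?divr_gt0//.
apply: (@le_trans _ _ n%:R); last by rewrite ler_nat.
by near: n; exact: nbhs_infty_ger.
Unshelve. all: by end_near. Qed.

(** Below every level exceeding the mean essential infimum, some steep enough
    slope makes the dual objective negative. The quotients [- ln Z / s] are
    dominated by the mean cost of [x], so their means converge too. *)
Lemma ess_inf_slope (D : R) : (\int[mu]_x ess_cost x < D%:E)%E ->
  exists2 l1, l1 < 0 & l1 * D - L l1 < 0.
Proof.
move=> eD.
have n0 n : - n.+1%:R <= 0 :> R by rewrite oppr_le0.
pose h n x := - free_energy nu c (- n.+1%:R) x / n.+1%:R.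
have mh n : measurable_fun setT (fun x => (h n x)%:E).
  apply/measurable_EFinP; apply: measurable_funM => //; apply: measurableT_comp => //.
  exact: measurable_free_energy.
have me : measurable_fun setT (fun x => ess_cost x).
  apply: (@emeasurable_fun_cvg _ _ _ setT (fun n x => (h n x)%:E)) => //.
  by move=> x _; exact: free_energy_cvg_ess_inf.
have mG := measurable_mean_section nu c0 mc.
have G0 x : (0 <= \int[nu]_y (c x y)%:E)%E.
  by apply: integral_ge0 => y _; rewrite lee_fin.
have iG : mu.-integrable setT (fun x => \int[nu]_y (c x y)%:E)%E.
  apply/integrableP; split=> //; under eq_integral do rewrite gee0_abs//.
  exact: cfin.
have hG : {ae mu, forall x n, setT x -> (`|(h n x)%:E| <= \int[nu]_y (c x y)%:E)%E}.
  apply: aeW => x n _; rewrite gee0_abs; last first.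
    by rewrite lee_fin divr_ge0// oppr_ge0 free_energy_le0.
  have := free_energy_ge nu c0 mc x (n0 n); rewrite opprK /h EFinM muleC => hh.
  by rewrite lee_pdivrMr.
have hE : {ae mu, forall x, setT x -> (h n x)%:E @[n --> \oo] --> ess_cost x}.
  by apply: aeW => x _; exact: free_energy_cvg_ess_inf.
have [_ _ cv] := dominated_convergence measurableT mh me hE iG hG.
have i1 n := integrable_free_energy c0 mc cfin (n0 n).
have ih n : (\int[mu]_x (h n x)%:E = (n.+1%:R^-1 * - L (- n.+1%:R))%:E)%E.
  have i2 := integrableZ_EFin (- n.+1%:R^-1) (i1 n).
  rewrite mulrN -mulNr -(RintegralZl _ measurableT (i1 n)) EFin_Rintegral//.
  by apply: eq_integral => x _; rewrite /h mulNr mulrC mulNr.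
have : \forall n \near \oo, (\int[mu]_x (h n x)%:E < D%:E)%E.
  exact: (cv _ (open_ereal_lt' eD)).
move=> [n _ /(_ n (leqnn n))]/=; rewrite ih lte_fin => hD.
exists (- n.+1%:R); first by rewrite oppr_lt0.
by move: hD; rewrite mulrC ltr_pdivrMr// => /steep_slope.
Qed.

End tilting_bounds.

(** * Independent letters *)

Lemma Rintegral_shift_le0 {R : realType} {d : nat} {disp : measure_display}
    {T : measurableType disp} (P : probability (config (lattice d) T) R)
    (g : config (lattice d) T -> R) (u : lattice d) :
  stationary P -> measurable_fun setT g -> (forall x, g x <= 0) ->
  \int[P]_x g (shift u x) = \int[P]_x g x.
Proof.
move=> P_stat mg g0; rewrite !Rintegral_le0//; congr (- fine _).
apply: (@ge0_integral_shift _ _ _ _ P P_stat (fun x => (- g x)%:E) u).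
- by apply/measurable_EFinP; exact: measurableT_comp.
- by move=> x; rewrite lee_fin oppr_ge0.
Qed.

Lemma cvg_volume (R : realType) (d : nat) : (0 < d)%N ->
  (n%:R ^+ d : R) @[n --> \oo] --> +oo.
Proof.
move=> d0; apply/cvgryPge => M; near=> n.
have n1 : (0 < n)%N by near: n; exists 1%N.
apply: (@le_trans _ _ n%:R); first by near: n; exact: nbhs_infty_ger.
by rewrite ler_eXnr// ler1n.
Unshelve. all: by end_near. Qed.

Lemma half_slack (R : realFieldType) (a r e : R) : a <= r + e / 2 -> a + e / 2 <= r + e.
Proof. by lra. Qed.

Section memoryless.
Context {R : realType} {d : nat} {dispA dispB : measure_display}.
Context {A : measurableType dispA} {B : measurableType dispB}.
Variable rho : A -> B -> R.
Hypothesis rho0 : forall a b, 0 <= rho a b.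
Hypothesis mrho : measurable_fun setT (fun z : A * B => rho z.1 z.2).
Local Notation XA := (config (lattice d) A).
Local Notation XB := (config (lattice d) B).
Variables (P : probability XA R) (Q : probability XB R).
Hypotheses (P_stat : stationary P) (P_erg : ergodic P) (Q_stat : stationary Q).
Hypothesis d_gt0 : (0 < d)%N.
Local Notation block_cost := (@block_cost R d dispA dispB A B rho).
Local Notation N := (fun n : nat => n%:R ^+ d : R).

Definition letter_cost (u : lattice d) (x : XA) (y : XB) : R := rho (x u) (y u).

Local Notation c0 := (fun x y => rho0 (x 0) (y 0)).
Local Notation mc u := (measurable_site mrho u).

Lemma partition_fun_shift l u x :
  partition_fun Q (letter_cost u) l x = partition_fun Q (letter_cost 0) l (shift u x).
Proof.
rewrite /partition_fun /Rintegral; congr fine.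
rewrite -[RHS](ge0_integral_shift Q_stat u).
- by apply: eq_integral => y _; rewrite /letter_cost /shift/= addr0.
- apply/measurable_EFinP; apply: measurableT_comp => //; apply: measurable_funM => //.
  exact: (measurable_section (c := letter_cost 0) (mc 0)).
- by move=> y; rewrite lee_fin expR_ge0.
Qed.

Lemma free_energy_shift l u x :
  free_energy Q (letter_cost u) l x = free_energy Q (letter_cost 0) l (shift u x).
Proof. by rewrite /free_energy partition_fun_shift. Qed.

Lemma block_cost1 x y : block_cost 1 x y = letter_cost (const_mx 1) x y.
Proof.
rewrite block_costE expr1n invr1 mul1r (_ : box 0 1 = [fset const_mx 1]%fset) ?big_seq_fset1//.
apply/fsetP => u; rewrite in_box in_fset1; apply/forallP/eqP => [h|-> i]; last first.
  by rewrite !mxE.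
by apply/rowP => i; move: (h i); rewrite !mxE; move: (u ord0 i); clear; lia.
Qed.

Lemma free_energy0_le0 l : l <= 0 ->
  forall x, free_energy Q (letter_cost 0) l x <= 0.
Proof.
move=> l0 x.
exact: (free_energy_le0 Q (c := letter_cost 0) (fun _ _ => rho0 _ _) (mc 0) x l0).
Qed.

Local Notation L := (log_mgf P Q (letter_cost 0)).

Lemma log_mgf_block1 l : l <= 0 -> log_mgf P Q (block_cost 1) l = L l.
Proof.
move=> l0; have -> : block_cost 1 = letter_cost (const_mx 1).
  by apply/funext => x; apply/funext => y; exact: block_cost1.
rewrite /log_mgf; under eq_Rintegral do rewrite free_energy_shift.
exact: (Rintegral_shift_le0 _ P_stat
  (measurable_free_energy Q (c := letter_cost 0) (mc 0) l) (free_energy0_le0 l0)).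
Qed.

Hypothesis Q_iid : iid Q.

Lemma iid_log_mgf n l x : (0 < n)%N -> l <= 0 ->
  ln (mgf Q N (fun n => block_cost n x) n l) =
  \sum_(u <- box 0 n) free_energy Q (letter_cost 0) l (shift u x).
Proof.
move=> n0 l0; have N0 : 0 < n%:R ^+ d :> R by rewrite exprn_gt0// ltr0n.
have p0 u : 0 < partition_fun Q (letter_cost u) l x.
  exact: (partition_fun_gt0 Q (c := letter_cost u) (fun _ _ => rho0 _ _) (mc u) x l0).
have -> : mgf Q N (fun n => block_cost n x) n l =
    \prod_(u <- box 0 n) partition_fun Q (letter_cost u) l x.
  rewrite /mgf /Rintegral -[RHS]/(fine (_%:E)); congr fine.
  transitivity (\int[Q]_y (\prod_(u <- box 0 n) expR (l * rho (x u) (y u)))%:E)%E.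
    apply: eq_integral => y _; rewrite block_costE.
    rewrite -expR_sum -mulr_sumr; congr (expR _)%:E.
    by rewrite mulrACA mulfV ?mul1r// gt_eqF.
  rewrite (iid_integral_prod Q_iid (h := fun u b => expR (l * rho (x u) b))).
  - rewrite [RHS](big_morph EFin (@EFinM R) (erefl _)); apply: eq_bigr => u _.
    rewrite EFin_Rintegral//.
    exact: (integrable_expc Q (c := letter_cost u) (fun _ _ => rho0 _ _) (mc u) x l0).
  - exact: fset_uniq.
  - move=> u; apply: measurableT_comp => //; apply: measurable_funM => //.
    exact: (measurable_section mrho).
  - by move=> u b; exact: expR_ge0.
rewrite [RHS](eq_bigr (fun u => ln (partition_fun Q (letter_cost u) l x))); last first.
  by move=> u _; rewrite /free_energy -partition_fun_shift.
have [//] : ln (\prod_(u <- box 0 n) partition_fun Q (letter_cost u) l x) =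
    \sum_(u <- box 0 n) ln (partition_fun Q (letter_cost u) l x) /\
    0 < \prod_(u <- box 0 n) partition_fun Q (letter_cost u) l x.
elim/big_rec2: _ => [|u a b _ [IH b0]]; first by rewrite ln1.
by rewrite lnM ?posrE// IH mulr_gt0.
Qed.

Hypothesis cfin : (site_cost rho P Q < +oo)%E.

(** Independence turns the log moment generating function of a block into an
    ergodic sum. *)
Lemma iid_log_mgf_limit l : l <= 0 ->
  {ae P, forall x, log_mgf_limit Q N (fun n => block_cost n x) l (L l)}.
Proof.
move=> l0; have f0 := free_energy0_le0 l0.
have iF : P.-integrable setT (EFin \o free_energy Q (letter_cost 0) l).
  exact: (integrable_free_energy (c := letter_cost 0) (fun _ _ => rho0 _ _) (mc 0) cfin l0).
pose g x := - free_energy Q (letter_cost 0) l x.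
have g0 x : 0 <= g x by rewrite oppr_ge0.
have := pointwise_ergodic P_stat P_erg g0 (integrableN_EFin iF).
apply: filterS => x h; have -> : L l = - \int[P]_x g x.
  by rewrite /log_mgf Rintegral_le0// /Rintegral.
have : - ((n%:R ^+ d)^-1 * \sum_(u <- box 0 n) g (shift u x)) @[n --> \oo] --> - \int[P]_x g x.
  exact: cvgN.
apply: cvg_trans; apply: near_eq_cvg; near=> n.
have n0 : (0 < n)%N by near: n; exists 1%N.
by rewrite iid_log_mgf// -mulrN -sumrN; congr (_ * _); apply: eq_bigr => u _; rewrite opprK.
Unshelve. all: by end_near. Qed.

Local Notation D_min1 := (D_min rho P Q 1).

(** With independent letters, the constrained entropy of one letter is the
    quenched decay rate of the matching probability: both are the supremum of
    [l D - L l], attained at the slope of mean cost [D]. *)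
Lemma iid_decay_rate (D : R) : (D_min1 < D%:E)%E -> (D%:E < site_cost rho P Q)%E ->
  exists r : R, [/\ 0 <= r, rate_n rho P Q 1 D = r%:E &
    {ae P, forall x, decay_rate N (ball_prob Q (fun n => block_cost n x) D) r}].
Proof.
move=> Dmin Dav.
have c10 := @rho_n_ge0 R d _ _ A B rho rho0 1.
have mc1 := @measurable_rho_n R d _ _ A B rho mrho 1.
have mean1 : mean_cost (law_on P (cube d 1)) (law_on Q (cube d 1)) (@rho_n R d _ _ A B rho 1)
    = site_cost rho P Q.
  by rewrite mean_cost_restr// mean_cost_block.
have cfin1 := cfin; rewrite -mean1 in cfin1 Dav.
have L1 l : l <= 0 ->
    log_mgf (law_on P (cube d 1)) (law_on Q (cube d 1)) (@rho_n R d _ _ A B rho 1) l = L l.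
  by move=> l0; exact: (etrans (log_mgf_block rho0 mrho P Q 1 l0) (log_mgf_block1 l0)).
(* A slope with negative objective exists because [D] exceeds the mean essential
   infimum. *)
have [l1 l10 l1D] := ess_inf_slope c10 mc1 cfin1 Dmin.
have [lD [l1lD lD0 flD minD]] := min_entropy_dual c10 mc1 cfin1 Dav l10 l1D.
pose r := lD * D - L lD; rewrite (L1 lD (ltW lD0)) -/r in minD.
have hr l : l <= 0 ->
    l * D - log_mgf (law_on P (cube d 1)) (law_on Q (cube d 1)) (@rho_n R d _ _ A B rho 1) l <= r.
  by move=> l0; have := min_entropy_ge c10 mc1 cfin1 D l0; rewrite minD lee_fin.
exists r; split.
- by have := hr 0 (lexx _); rewrite log_mgf0 mul0r subr0.
- by rewrite rate_nE// minD expr1n invr1 mul1e.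
have Noo := @cvg_volume R d d_gt0.
have Nev : \forall n \near \oo, 0 < N n.
  by exists 1%N => // n /= n0; rewrite exprn_gt0// ltr0n.
have mZ x n : measurable_fun setT (block_cost n x).
  exact: (measurable_section (measurable_block_cost mrho n)).
have Z0 x n y : 0 <= block_cost n x y by exact: block_cost_ge0.
have up : {ae P, forall x, forall k : nat, \forall n \near \oo,
    ball_prob Q (fun n => block_cost n x) D n <= expR (- (N n * (r - k.+1%:R^-1)))}.
  apply: filterS (iid_log_mgf_limit (ltW lD0)) => x limx k.
  have k0 : 0 < k.+1%:R^-1 :> R by rewrite invr_gt0.
  exact: (decay_upper Nev (mZ x) (Z0 x) D (ltW lD0) limx k0).
have low : {ae P, forall x, forall k : nat, \forall n \near \oo,
    expR (- (N n * (r + k.+1%:R^-1))) <= ball_prob Q (fun n => block_cost n x) D n}.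
  apply/ae_foralln => k.
  have k0 : 0 < k.+1%:R^-1 / 2 :> R by rewrite divr_gt0// invr_gt0.
  have [l [t [D1 [l0 t0 lt0 [hp hm hD1]]]]] := exists_lower_tilt c10 mc1 cfin1 Dav l10 l1D hr k0.
  have lmt0 : l - t <= 0 by rewrite subr_le0 (le_trans l0)// ltW.
  rewrite !L1// in hp hm hD1.
  apply: filterS3 (iid_log_mgf_limit l0) (iid_log_mgf_limit lt0) (iid_log_mgf_limit lmt0) => x h1 h2 h3.
  have := decay_lower Nev Noo (mZ x) (Z0 x) l0 t0 lt0 h1 h2 h3 hp hm k0.
  apply: filterS2 Nev => n Nn; apply: le_trans; rewrite ler_expR lerN2 ler_pM2l//.
  exact: half_slack.
clearbody r; apply: filterS2 up low => x upx lowx e e0.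
have [k ke] := exists_invn_lt e0.
apply: filterS3 Nev (upx k) (lowx k) => n Nn u l; apply/andP; split.
  by apply: le_trans l; rewrite ler_expR lerN2 ler_pM2l// lerD2l ltW.
by apply: le_trans u _; rewrite ler_expR lerN2 ler_pM2l// lerD2l lerN2 ltW.
Qed.

End memoryless.

(** * From large deviations to exponents *)

Lemma limn_esup_lt {R : realType} (u : nat -> \bar R) (c : \bar R) :
  (limn_esup u < c)%E -> \forall n \near \oo, (u n < c)%E.
Proof.
move=> /ereal_inf_lt[_ [V oV <-]] Vc; apply: filterS oV => n Vn.
by apply: le_lt_trans Vc; apply: ereal_sup_ubound; exists n.
Qed.

Lemma limn_einf_gt {R : realType} (u : nat -> \bar R) (c : \bar R) :
  (c < limn_einf u)%E -> \forall n \near \oo, (c < u n)%E.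
Proof.
rewrite /limn_einf lteNr => /limn_esup_lt; apply: filterS => n.
by rewrite lteN2.
Qed.

Lemma lne_scaled_lt {R : realType} (N p b : R) : 0 < N -> 0 <= p ->
  ((N^-1)%:E * lne p%:E < b%:E)%E -> p <= expR (N * b).
Proof.
move=> N0; rewrite le_eqVlt => /predU1P[<- _|p0]; first exact: expR_ge0.
rewrite lne_EFin// -EFinM lte_fin ltr_pdivrMl// => /ltW.
by rewrite -[X in _ -> X <= _](lnK p0) ler_expR.
Qed.

Lemma lne_scaled_gt {R : realType} (N p b : R) : 0 < N -> 0 <= p ->
  (b%:E < (N^-1)%:E * lne p%:E)%E -> expR (N * b) <= p.
Proof.
move=> N0; rewrite le_eqVlt => /predU1P[<-|p0].
  by rewrite le0_lneNy// gt0_muleNy ?lte_fin ?invr_gt0// ltNge leNye.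
rewrite lne_EFin// -EFinM lte_fin ltr_pdivlMl// => /ltW.
by rewrite -[X in _ -> _ <= X](lnK p0) ler_expR.
Qed.

Lemma cell_arith (R : realFieldType) (l a w z L e : R) : l <= 0 -> - l * w <= e ->
  z <= a + w -> l * a - L - e <= l * z - L.
Proof.
move=> l0 lw zw; have : l * (a + w) <= l * z by rewrite ler_wnM2l.
lra.
Qed.

Lemma half_line_loss (R : realFieldType) (l e : R) : l <= 0 -> 0 < e ->
  - l * (e / 3 / (1 - l)) <= e / 3.
Proof.
move=> l0 e0; rewrite mulrCA ger_pMr ?divr_gt0// ler_pdivrMr ?mul1r; lra.
Qed.

Lemma tilt_loss (R : realFieldType) (l z a w L e : R) : - l * w <= e / 3 ->
  L - e / 3 < l * z - a -> L - e <= l * (z + w) + (- a - e / 3).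
Proof. by move=> h1 h2; lra. Qed.

Lemma scaled_dist_le (R : realFieldType) (N x L e : R) : 0 < N ->
  N * (L - e) <= x -> x <= N * (L + e) -> `|L - N^-1 * x| <= e.
Proof.
move=> N0; rewrite -ler_pdivlMl// => h1; rewrite -ler_pdivrMl// => h2; rewrite ler_norml.
by apply/andP; split; lra.
Qed.

Section exponents.
Context {R : realType} {disp : measure_display} {T : measurableType disp}.
Variables (d : nat) (Q : probability T R) (Z : nat -> T -> R) (I : R -> \bar R).
Hypothesis d_gt0 : (0 < d)%N.
Hypothesis mZ : forall n, measurable_fun setT (Z n).
Hypothesis Z0 : forall n y, 0 <= Z n y.
Variable M : R.
Hypothesis ZM : forall n y, Z n y <= M.
Hypothesis I0 : forall z, (0 <= I z)%E.
Hypothesis ldp : LDP d Q Z I.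
Local Notation N := (fun n : nat => n%:R ^+ d : R).

Let Nev : \forall n \near \oo, 0 < N n.
Proof. by exists 1%N => // n /= n0; rewrite exprn_gt0// ltr0n. Qed.

Lemma ldp_upper (G : set R) (b e : R) : measurable G -> closed G ->
  (forall z, G z -> (b%:E <= I z)%E) -> 0 < e ->
  \forall n \near \oo, fine (Q (Z n @^-1` G)) <= expR (N n * (- b + e)).
Proof.
move=> mG cG bI e0; have [_ _ up] := ldp mG.
have : (limn_esup (fun n => ((n%:R ^+ d)^-1)%:E * lne (Q (Z n @^-1` G))) < (- b + e)%:E)%E.
  apply: le_lt_trans up _; apply: (@le_lt_trans _ _ (- b%:E)%E); last first.
    by rewrite lte_fin ltrDl.
  rewrite leeN2; apply: le_ereal_inf_tmp => _ [z Gz <-]; apply: bI.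
  by move: Gz; rewrite -(closure_id G).1.
move=> /limn_esup_lt; apply: filterS2 Nev => n Nn h.
apply: lne_scaled_lt => //; first exact: fine_ge0.
by rewrite fineK// fin_num_measure// -[X in measurable X]setTI; exact: mZ.
Qed.

Lemma ldp_lower (G : set R) (z b e : R) : measurable G -> open G -> G z ->
  (I z <= b%:E)%E -> 0 < e ->
  \forall n \near \oo, expR (N n * (- b - e)) <= fine (Q (Z n @^-1` G)).
Proof.
move=> mG oG Gz Ib e0; have [low _ _] := ldp mG.
have : ((- b - e)%:E < limn_einf (fun n => ((n%:R ^+ d)^-1)%:E * lne (Q (Z n @^-1` G))))%E.
  apply: lt_le_trans low; apply: (@lt_le_trans _ _ (- b%:E)%E).
    by rewrite lte_fin gtrDl oppr_lt0.
  rewrite leeN2; apply: le_trans Ib; apply: ereal_inf_lbound; exists z => //.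
  by rewrite (interior_id G).1.
move=> /limn_einf_gt; apply: filterS2 Nev => n Nn h.
apply: lne_scaled_gt => //; first exact: fine_ge0.
by rewrite fineK// fin_num_measure// -[X in measurable X]setTI; exact: mZ.
Qed.

(** The supremum is taken among real numbers: points where [I] is infinite
    contribute nothing. *)
Definition dual_values (l : R) : set R := [set s | exists z a, I z = a%:E /\ s = l * z - a].

Definition dual_rate (l : R) : R := sup (dual_values l).

(** The half line below [0] is open and carries no mass. *)
Lemma rate_neg z : z < 0 -> I z = +oo%E.
Proof.
move=> z0; apply/eqP; rewrite -leye_eq; have [//|Iz] := leP +oo%E (I z).
have [b Ib] : exists b : R, I z = b%:E.
  by case: (I z) (I0 z) Iz => // b; exists b.
have mG : measurable [set t : R | t < 0] by apply: open_measurable; exact: open_lt.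
have Ib' : (I z <= b%:E)%E by rewrite Ib.
have /filter_ex[n] := ldp_lower mG (@open_lt _ 0) z0 Ib' ltr01.
rewrite (_ : _ @^-1` _ = set0) ?measure0//.
  by rewrite leNgt expR_gt0.
by apply/seteqP; split=> // y /=; rewrite ltNge Z0.
Qed.

(** Otherwise the probability of the whole line would decrease exponentially. *)
Lemma exists_rate_le (e : R) : 0 < e -> exists z, (I z <= e%:E)%E.
Proof.
move=> e0; apply: contrapT => nz.
have eI z : (e%:E <= I z)%E.
  by rewrite leNgt; apply/negP => Iz; apply: nz; exists z; exact: ltW.
have e2 : 0 < e / 2 by rewrite divr_gt0.
have /filter_ex[n [Nn]] : \forall n \near \oo, 0 < N n /\
    fine (Q (Z n @^-1` setT)) <= expR (N n * (- e + e / 2)).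
  apply: filter_app (ldp_upper measurableT closedT (fun z _ => eI z) e2).
  by apply: filterS Nev => n Nn h; split.
rewrite preimage_setT fine_probability_setT leNgt expR_lt1 => /negP; apply.
by rewrite nmulr_llt0// {1}(splitr e) opprD subrK oppr_lt0.
Qed.

Lemma dual_values_neq0 l : dual_values l !=set0.
Proof.
have [z Iz] := exists_rate_le ltr01.
have [a Ia] : exists a : R, I z = a%:E.
  by case: (I z) (I0 z) Iz => // a; exists a.
by exists (l * z - a), z, a.
Qed.

Lemma dual_values_le0 l : l <= 0 -> ubound (dual_values l) 0.
Proof.
move=> l0 _ [z [a [Iz ->]]]; have z0 : 0 <= z.
  by rewrite leNgt; apply/negP => /rate_neg; rewrite Iz.
have a0 : 0 <= a by have := I0 z; rewrite Iz lee_fin.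
by rewrite subr_le0 (le_trans _ a0)// mulr_le0_ge0.
Qed.

Lemma has_sup_dual_values l : l <= 0 -> has_sup (dual_values l).
Proof.
by move=> l0; split; [exact: dual_values_neq0|exists 0; exact: dual_values_le0].
Qed.

Lemma dual_rate_le0 l : l <= 0 -> dual_rate l <= 0.
Proof. by move=> l0; apply: ge_sup; [exact: dual_values_neq0|exact: dual_values_le0]. Qed.

Lemma dual_rate_young l z : l <= 0 -> ((l * z - dual_rate l)%:E <= I z)%E.
Proof.
move=> l0; have : (0 <= I z)%E by [].
case Iz : (I z) => [a| |]// _; last by rewrite leey.
rewrite lee_fin lerBlDr -lerBlDl; apply: ub_le_sup; first by have [] := has_sup_dual_values l0.
by exists z, a.
Qed.

Lemma dual_rate_adherent l e : l <= 0 -> 0 < e ->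
  exists z a, I z = a%:E /\ dual_rate l - e < l * z - a.
Proof.
move=> l0 e0; have [_ [z [a [Iz ->]]] h] := sup_adherent e0 (has_sup_dual_values l0).
by exists z, a.
Qed.

Lemma integrable_mgf_term n l : 0 < N n -> l <= 0 ->
  Q.-integrable setT (EFin \o (fun y => expR (N n * l * Z n y))).
Proof. by move=> Nn l0; exact: (integrable_mgf Q (N := N) mZ Z0 Nn l0). Qed.

Lemma integrable_indic_scaled (E : set T) (a : R) : measurable E ->
  Q.-integrable setT (EFin \o (fun y => a * \1_E y)).
Proof.
move=> mE; apply: integrableZ_EFin; apply: (@bounded_integrable _ _ _ _ _ 1) => // y.
by rewrite indicE; case: (_ \in _); rewrite ?normr0 ?normr1.
Qed.

Lemma measurable_Z_preimage n (G : set R) : measurable G -> measurable (Z n @^-1` G).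
Proof. by move=> mG; rewrite -[X in measurable X]setTI; exact: mZ. Qed.

Lemma mgf_ge_half_line n l t : 0 < N n -> l <= 0 ->
  expR (N n * l * t) * fine (Q (Z n @^-1` [set s | s < t])) <= mgf Q N Z n l.
Proof.
move=> Nn l0; have mE : measurable (Z n @^-1` [set s | s < t]).
  by apply: measurable_Z_preimage; apply: open_measurable; exact: open_lt.
rewrite -(Rintegral_indic Q mE) -RintegralZl//; last first.
  have := integrable_indic_scaled 1 mE; congr (integrable _ _ _).
  by apply/funext => y /=; rewrite mul1r.
apply: le_Rintegral => //; [exact: integrable_indic_scaled|exact: integrable_mgf_term|].
move=> y _; rewrite indicE; have [|_] := boolP (y \in _); last by rewrite mulr0 expR_ge0.
rewrite inE /= => yt; rewrite mulr1 ler_expR ler_wnM2l ?(ltW yt)//.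
by rewrite mulr_ge0_le0// ltW.
Qed.

Hypothesis M0 : 0 < M.

Lemma mgf_le_cells n l k : 0 < N n -> l <= 0 -> (0 < k)%N ->
  mgf Q N Z n l <= \sum_(i < k.+1) expR (N n * l * (i%:R * (M / k%:R))) *
    fine (Q (Z n @^-1` [set s | i%:R * (M / k%:R) <= s <= i.+1%:R * (M / k%:R)])).
Proof.
move=> Nn l0 k0; pose w := M / k%:R.
have w0 : 0 < w by rewrite divr_gt0// ltr0n.
pose E (i : 'I_k.+1) := Z n @^-1` [set s | i%:R * w <= s <= i.+1%:R * w].
have mE i : measurable (E i).
  apply: measurable_Z_preimage.
  rewrite (_ : mkset _ = `[i%:R * w, i.+1%:R * w]%classic)//.
have [iS eS] := @Rintegral_sum _ _ _ Q _ (enum 'I_k.+1)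
  (fun i y => expR (N n * l * (i%:R * w)) * \1_(E i) y)
  (fun i => integrable_indic_scaled _ (mE i)).
apply: (@le_trans _ _ (\int[Q]_y \sum_(i <- enum 'I_k.+1) expR (N n * l * (i%:R * w)) * \1_(E i) y)).
  apply: le_Rintegral => //; first exact: integrable_mgf_term.
  move=> y _; pose i := Num.truncn (Z n y / w).
  have Zw0 : 0 <= Z n y / w by rewrite divr_ge0// ltW.
  have ik : (i < k.+1)%N.
    rewrite ltnS -(ler_nat R) (@le_trans _ _ (Z n y / w))//; first by rewrite /i truncn_le.
    by rewrite ler_pdivrMr// /w mulrCA divff ?mulr1// pnatr_eq0 -lt0n.
  rewrite (bigD1_seq (Ordinal ik)) ?mem_enum ?enum_uniq//=.
  apply: ler_wpDr.
    by apply: sumr_ge0 => j _; rewrite mulr_ge0 ?expR_ge0.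
  have iZ : i%:R * w <= Z n y by rewrite -ler_pdivlMr// truncn_le.
  rewrite indicE mem_set ?mulr1; last first.
    by rewrite /E/= iZ/= -ler_pdivrMr// ltW// truncnS_gt.
  by rewrite ler_expR ler_wnM2l// mulr_ge0_le0// ltW.
rewrite eS big_enum/=; apply: ler_sum => i _.
rewrite RintegralZl//; last first.
  have := integrable_indic_scaled 1 (mE i); congr (integrable _ _ _).
  by apply/funext => y /=; rewrite mul1r.
by rewrite Rintegral_indic.
Qed.

(** Laplace's principle: cut the range of [Z n] into [k] short cells. On a cell
    the exponential is nearly constant, the probability of the cell is
    controlled by the upper bound on closed sets, and a fixed number of cells
    does not change the exponent. *)
Lemma dual_rate_upper l e : l <= 0 -> 0 < e ->
  \forall n \near \oo, mgf Q N Z n l <= expR (N n * (dual_rate l + e)).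
Proof.
move=> l0 e0; have e4 : 0 < e / 4 by rewrite divr_gt0.
have [k k0 kM] : exists2 k, (0 < k)%N & - l * (M / k%:R) <= e / 4.
  exists (Num.truncn (- l * M / (e / 4))).+1 => //.
  rewrite mulrA ler_pdivrMr ?ltr0n// -ler_pdivrMl// mulrC ltW//.
  exact: truncnS_gt.
pose w := M / k%:R.
pose G (i : 'I_k.+1) := [set s : R | i%:R * w <= s <= i.+1%:R * w].
have GE i : G i = `[i%:R * w, i.+1%:R * w]%classic.
  by apply/seteqP; split=> s; rewrite /= in_itv.
have cells : \forall n \near \oo, forall i : 'I_k.+1,
    fine (Q (Z n @^-1` G i)) <= expR (N n * (- (l * (i%:R * w) - dual_rate l - e / 4) + e / 4)).
  apply: filter_forall => i; apply: ldp_upper => //.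
  - by rewrite GE; exact: measurable_itv.
  - by rewrite GE; exact: itv_closed.
  - move=> z /andP[z1 z2]; apply: le_trans (dual_rate_young z l0).
    rewrite lee_fin; apply: cell_arith l0 kM _.
    by rewrite -/w -[X in _ + X]mul1r -mulrDl natr1.
near=> n; have Nn : 0 < N n by near: n.
apply: le_trans (mgf_le_cells Nn l0 k0) _.
have cn : forall i : 'I_k.+1, fine (Q (Z n @^-1` G i)) <=
    expR (N n * (- (l * (i%:R * w) - dual_rate l - e / 4) + e / 4)) by near: n.
apply: (@le_trans _ _ (\sum_(i < k.+1) expR (N n * (dual_rate l + e / 2)))).
  apply: ler_sum => i _.
  apply: le_trans (ler_wpM2l (expR_ge0 _) (cn i)) _.
  rewrite -expRD ler_expR le_eqVlt; apply/orP; left; apply/eqP.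
  by rewrite -/w; field.
rewrite sumr_const card_ord -[X in X <= _]mulr_natl.
rewrite -[X in X * _](@lnK R) ?posrE// -expRD ler_expR.
have : ln k.+1%:R / (e / 2) <= N n by near: n; move/cvgryPge: (@cvg_volume R d d_gt0); apply.
rewrite ler_pdivrMr ?divr_gt0// => h.
apply: (le_trans (lerD h (lexx _))).
by rewrite -mulrDr le_eqVlt; apply/orP; left; apply/eqP; field.
Unshelve. all: by end_near. Qed.

(** The half line just above a nearly optimal point [z] already carries enough
    mass: as [l <= 0], the exponential is larger on the left of that point. *)
Lemma dual_rate_lower l e : l <= 0 -> 0 < e ->
  \forall n \near \oo, expR (N n * (dual_rate l - e)) <= mgf Q N Z n l.
Proof.
move=> l0 e0; have e3 : 0 < e / 3 by rewrite divr_gt0.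
have [z [a [Iz za]]] := dual_rate_adherent l0 e3.
have l1 : 0 < 1 - l by rewrite subr_gt0 (le_lt_trans l0).
pose del := e / 3 / (1 - l); have del0 : 0 < del by rewrite divr_gt0.
have zd : z < z + del by rewrite ltrDl.
have mG : measurable [set t : R | t < z + del].
  by apply: open_measurable; exact: open_lt.
have Iz' : (I z <= a%:E)%E by rewrite Iz.
apply: filterS2 Nev (ldp_lower mG (@open_lt _ (z + del)) zd Iz' e3) => n Nn h.
apply: le_trans (mgf_ge_half_line (z + del) Nn l0).
apply: le_trans (ler_wpM2l (expR_ge0 _) h).
rewrite -expRD ler_expR -mulrA -mulrDr ler_pM2l//.
by apply: tilt_loss => //; exact: half_line_loss.
Qed.

Lemma dual_rate_limit l : l <= 0 -> log_mgf_limit Q N Z l (dual_rate l).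
Proof.
move=> l0; apply/cvgrPdist_le => e e0.
apply: filterS3 Nev (dual_rate_upper l0 e0) (dual_rate_lower l0 e0) => n Nn up low.
have m0 : 0 < mgf Q N Z n l by apply: lt_le_trans low; exact: expR_gt0.
have : ln (mgf Q N Z n l) <= N n * (dual_rate l + e).
  by rewrite -[leRHS]expRK ler_ln ?posrE ?expR_gt0.
have : N n * (dual_rate l - e) <= ln (mgf Q N Z n l).
  by rewrite -[leLHS]expRK ler_ln ?posrE ?expR_gt0.
by move=> h1 h2; exact: scaled_dist_le.
Qed.

End exponents.

(** Support line at [D] of a convex function that is at least [b] at the left of
    [D]. Its slope is the supremum of the slopes of the chords to the left, all
    of which are nonpositive. *)
Lemma convex_support {R : realType} (I : R -> \bar R) (D b : R) :
  (forall z, 0 <= I z)%E -> convex_rate I ->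
  (exists2 z, z < D & (I z < +oo)%E) -> (forall z, z < D -> (b%:E <= I z)%E) -> 0 <= b ->
  exists2 l, l <= 0 & forall z, ((b + l * (z - D))%:E <= I z)%E.
Proof.
move=> I0 cI [z0 z0D Iz0] bI b0.
have fin z : (I z < +oo)%E -> exists a : R, I z = a%:E.
  by case: (I z) (I0 z) => // a _ _; exists a.
have [a0 Ia0] := fin _ Iz0.
(* Convexity propagates the lower bound to [D]: a smaller value there would pull
   points just at the left of [D] below [b]. *)
have ID : (b%:E <= I D)%E.
  rewrite leNgt; apply/negP => IDb; have [v Iv] := fin D (lt_trans IDb (ltry _)).
  rewrite Iv lte_fin in IDb.
  have va : v < a0 by rewrite (lt_le_trans IDb)// -lee_fin -Ia0 bI.
  pose t := (b - v) / (2 * (a0 - v)).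
  have t0 : 0 < t by rewrite divr_gt0 ?mulr_gt0// subr_gt0.
  have ba : b <= a0 by rewrite -lee_fin -Ia0 bI.
  have t1 : t <= 1.
    rewrite ler_pdivrMr ?mulr_gt0 ?subr_gt0//; by move: ba IDb; clear; lra.
  have := cI t z0 D; rewrite (ltW t0) t1 Ia0 Iv => /(_ isT).
  have zD : t * z0 + (1 - t) * D < D.
    have : t * z0 < t * D by rewrite ltr_pM2l.
    by clear; lra.
  move=> /(le_trans (bI _ zD)); rewrite -!EFinM -EFinD lee_fin.
  have -> : t * a0 + (1 - t) * v = v + (b - v) / 2.
    by rewrite /t; field; rewrite gt_eqF// subr_gt0.
  by move: IDb; clear; lra.
pose S := [set s : R | exists z a, [/\ z < D, I z = a%:E & s = - ((a - b) / (D - z))]].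
have S0 : S !=set0 by exists (- ((a0 - b) / (D - z0))), z0, a0.
have Sle0 : ubound S 0.
  move=> _ [z [a [zD Ia ->]]]; rewrite oppr_le0 divr_ge0// subr_ge0 ?(ltW zD)//.
  by rewrite -lee_fin -Ia bI.
have hS : has_sup S by split=> //; exists 0.
exists (sup S); first exact: ge_sup.
move=> z; have [zD|Dz|->] := ltgtP z D; last by rewrite subrr mulr0 addr0.
- have := I0 z; case Iz : (I z) => [a| |]// _; last by rewrite leey.
  rewrite lee_fin; have Dz : 0 < D - z by rewrite subr_gt0.
  have : - ((a - b) / (D - z)) <= sup S by apply: ub_le_sup; [by case: hS|exists z, a].
  rewrite lerNl ler_pdivlMr//; move: (sup S) => s; clear; lra.
- have := I0 z; case Iz : (I z) => [a| |]// _; last by rewrite leey.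
  rewrite lee_fin -lerBrDl -ler_pdivlMr ?subr_gt0//.
  (* Compare with the chord from a point [y] at the left to [z] at the right,
     which lies above [D]. *)
  apply: ge_sup => // _ [y [c [yD Ic ->]]].
  pose s := (z - D) / (z - y).
  have zy : 0 < z - y by rewrite subr_gt0 (lt_trans yD).
  have s01 : 0 <= s <= 1.
    rewrite divr_ge0 ?subr_ge0 ?(ltW Dz) ?(ltW (lt_trans yD Dz))//= ler_pdivrMr// mul1r.
    by rewrite lerD2l lerN2 ltW.
  have := cI s y z s01; rewrite Ic Iz.
  rewrite (_ : s * y + (1 - s) * z = D); last by rewrite /s; field; rewrite gt_eqF.
  move=> /(le_trans ID); rewrite -!EFinM -EFinD lee_fin => h.
  rewrite lerNl -mulNr ler_pdivrMr ?subr_gt0// mulrAC ler_pdivlMr ?subr_gt0//.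
  have : b * (z - y) <= (z - D) * c + (D - y) * a.
    rewrite -ler_pdivlMr//; apply: le_trans h _.
    by rewrite le_eqVlt; apply/orP; left; apply/eqP; rewrite /s; field; rewrite gt_eqF.
  by clear; lra.
Qed.

(** * Bounded costs *)

Lemma grid_cell (R : realFieldType) (l k i w : R) : l + k < (i + 1) * w ->
  l <= - k + i * w + w.
Proof. by lra. Qed.

Section dual_limit.
Context {R : realType}.
Variables (Ln : nat -> R -> R) (L : R -> R) (D D' C : R) (rt : nat -> R).
Hypothesis D'D : D' < D.
Hypothesis D0 : 0 <= D.
Hypothesis Ln_homo : forall n a b, (0 < n)%N -> a <= b -> b <= 0 -> Ln n a <= Ln n b.
Hypothesis Ln_cvg : forall l, l <= 0 -> Ln n l @[n --> \oo] --> L l.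
Hypothesis L0 : L 0 = 0.
Hypothesis Ln_bound : forall n l, (0 < n)%N -> l <= 0 -> l * D' - Ln n l <= C.

Local Notation K := ((C + 1) / (D - D')).

Hypothesis rt_ge : forall n l, (0 < n)%N -> l <= 0 -> l * D - Ln n l <= rt n.
Hypothesis rt_attained : forall n, (0 < n)%N ->
  exists l, [/\ - K <= l, l <= 0 & rt n = l * D - Ln n l].

Definition dual_exponent : R := sup [set s | exists2 l, l <= 0 & s = l * D - L l].

Lemma limit_bound l : l <= 0 -> l * D' - L l <= C.
Proof.
move=> l0; rewrite lerBlDr -lerBlDl; apply: (cvgr_to_ge (Ln_cvg l0)).
exists 1%N => // n /= n0; rewrite lerBlDl -lerBlDr; exact: Ln_bound.
Qed.

Let C0 : 0 <= C.
Proof. by have := limit_bound (lexx 0); rewrite L0 mul0r subr0. Qed.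

Let gap : 0 < D - D'. Proof. by rewrite subr_gt0. Qed.

Let K0 : 0 < K. Proof. by rewrite divr_gt0// ltr_wpDl. Qed.

Lemma dual_exponent_has_sup : has_sup [set s | exists2 l, l <= 0 & s = l * D - L l].
Proof.
split; first by exists (0 * D - L 0), 0.
exists C => _ [l l0 ->]; apply: le_trans (limit_bound l0).
by rewrite lerD2r ler_wnM2l// ltW.
Qed.

Lemma dual_exponent_ge l : l <= 0 -> l * D - L l <= dual_exponent.
Proof.
by move=> l0; apply: ub_le_sup; [have [] := dual_exponent_has_sup|exists l].
Qed.

Lemma dual_exponent_ge0 : 0 <= dual_exponent.
Proof. by have := dual_exponent_ge (lexx 0); rewrite L0 mul0r subr0. Qed.

Lemma dual_exponent_adherent e : 0 < e ->
  exists2 l, l <= 0 & dual_exponent - e < l * D - L l.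
Proof.
by move=> e0; have [_ [l l0 ->] h] := sup_adherent e0 dual_exponent_has_sup; exists l.
Qed.

(** Pointwise convergence suffices: the slopes stay in the interval from [- K]
    to [0], where the monotone functions [Ln n] are controlled by their values
    on a finite grid. *)
Lemma dual_exponent_cvg : rt n @[n --> \oo] --> dual_exponent.
Proof.
apply/cvgrPdist_le => e e0; have e2 : 0 < e / 2 by rewrite divr_gt0.
have low : \forall n \near \oo, dual_exponent - e <= rt n.
  have [l l0 hl] := dual_exponent_adherent e2.
  have : \forall n \near \oo, Ln n l <= L l + e / 2.
    by apply: cvgr_le; [exact: Ln_cvg|rewrite ltrDl].
  move=> h; near=> n; have n0 : (0 < n)%N by near: n; exists 1%N.
  apply: le_trans (rt_ge n0 l0).
  have : Ln n l <= L l + e / 2 by near: n.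
  by lra.
(* The mesh [w] is so small that moving [l] by one cell changes [l D] by at most
   [e / 2]. *)
pose k := (Num.truncn (K * D / (e / 2))).+1; pose w := K / k%:R.
have w0 : 0 < w by rewrite divr_gt0// ltr0n.
have wk : k%:R * w = K by rewrite /w mulrC divfK// pnatr_eq0.
have wD : w * D <= e / 2.
  rewrite mulrAC ler_pdivrMr ?ltr0n// -ler_pdivrMl// mulrC ltW//.
  exact: truncnS_gt.
pose g (i : 'I_k.+1) := - K + i%:R * w.
have g0 i : g i <= 0.
  by rewrite /g addrC subr_le0 -[leRHS]wk ler_wpM2r ?(ltW w0)// ler_nat -ltnS.
have grid : \forall n \near \oo, forall i, L (g i) - e / 2 <= Ln n (g i).
  apply: filter_forall => i; apply: cvgr_ge; first exact: Ln_cvg.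
  by rewrite gtrDl oppr_lt0.
have up : \forall n \near \oo, rt n <= dual_exponent + e.
  near=> n; have n0 : (0 < n)%N by near: n; exists 1%N.
  have gn : forall i, L (g i) - e / 2 <= Ln n (g i) by near: n.
  have [l [Kl l0 ->]] := rt_attained n0.
  pose i := Num.truncn ((l + K) / w).
  have lK : 0 <= (l + K) / w by rewrite divr_ge0 ?(ltW w0)// -lerBlDr sub0r.
  have ik : (i < k.+1)%N.
    rewrite ltnS -(ler_nat R) (@le_trans _ _ ((l + K) / w))//; first by rewrite /i truncn_le.
    by rewrite ler_pdivrMr// wk gerDr.
  have il : g (Ordinal ik) <= l.
    by rewrite /g/= addrC lerBlDr -ler_pdivlMr// truncn_le.
  have li : l <= g (Ordinal ik) + w.
    have := truncnS_gt ((l + K) / w); rewrite -/i ltr_pdivrMr// -natr1.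
    exact: grid_cell.
  have h1 := Ln_homo n0 il l0.
  have h2 := dual_exponent_ge (g0 (Ordinal ik)).
  have h3 := gn (Ordinal ik).
  have h4 : l * D <= (g (Ordinal ik) + w) * D by rewrite ler_wpM2r.
  by lra.
apply: filterS2 up low => n h1 h2; rewrite ler_norml.
by apply/andP; split; lra.
Unshelve. all: by end_near. Qed.

End dual_limit.

Lemma steep_value (R : realFieldType) (K D D' C a : R) :
  K * (D - D') = C + 1 -> - K * D' - a <= C -> - K * D - a < 0.
Proof. by lra. Qed.

Lemma exponent_slack (R : realFieldType) (r e a : R) : r - e / 2 < a -> r - e <= a - e / 2.
Proof. by lra. Qed.

(** The infimum of the rate function to the left of [D] does not exceed its
    Legendre dual there: otherwise a support line at [D] would contradict the
    bound by [r]. *)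
Lemma rate_below {R : realType} (I : R -> \bar R) (D D' C r b : R) :
  (forall z, 0 <= I z)%E -> convex_rate I -> (forall l, dual_values I l !=set0) ->
  D' < D -> (forall l, l <= 0 -> l * D' - dual_rate I l <= C) ->
  (forall l, l <= 0 -> l * D - dual_rate I l <= r) -> 0 <= C -> r < b -> 0 <= r ->
  exists2 z, z < D & (I z <= b%:E)%E.
Proof.
move=> I0 cI I1 D'D hC hr C0 rb r0; apply: contrapT => nz.
have bI z : z < D -> (b%:E <= I z)%E.
  by move=> zD; rewrite leNgt; apply/negP => Iz; apply: nz; exists z => //; exact: ltW.
have gap : 0 < D - D' by rewrite subr_gt0.
(* If [I] were infinite at the left of [D], its dual would be at most [l D], and
   the bound at [D'] would fail for steep [l]. *)
have [z0 z0D Iz0] : exists2 z, z < D & (I z < +oo)%E.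
  apply: contrapT => ninf; pose l := - ((C + 1) / (D - D')).
  have l0 : l <= 0 by rewrite oppr_le0 divr_ge0 ?(ltW gap)// addr_ge0.
  have Ll : dual_rate I l <= l * D.
    apply: ge_sup => // _ [z [a [Iz ->]]].
    have Dz : D <= z.
      by rewrite leNgt; apply/negP => zD; apply: ninf; exists z => //; rewrite Iz ltry.
    have a0 : 0 <= a by have := I0 z; rewrite Iz lee_fin.
    have := ler_wnM2l l0 Dz; move: a0; clear; lra.
  have lD : l * (D' - D) = C + 1 by rewrite /l -[D' - D]opprB mulrNN divfK// gt_eqF.
  by have := hC l l0; move: Ll lD; clear; lra.
have [l l0 Il] := convex_support I0 cI (ex_intro2 _ _ z0 z0D Iz0) bI (le_trans r0 (ltW rb)).
have Ll : dual_rate I l <= l * D - b.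
  apply: ge_sup => // _ [z [a [Iz ->]]].
  by have := Il z; rewrite Iz lee_fin; clear; lra.
by have := hr l l0; move: Ll rb; clear; lra.
Qed.

Section bounded_cost.
Context {R : realType} {d : nat} {dispA dispB : measure_display}.
Context {A : measurableType dispA} {B : measurableType dispB}.
Variable rho : A -> B -> R.
Hypothesis rho0 : forall a b, 0 <= rho a b.
Hypothesis mrho : measurable_fun setT (fun z : A * B => rho z.1 z.2).
Variable M : R.
Hypothesis M0 : 0 < M.
Hypothesis rhoM : forall a b, rho a b <= M.
Local Notation XA := (config (lattice d) A).
Local Notation XB := (config (lattice d) B).
Variables (P : probability XA R) (Q : probability XB R).
Hypothesis d_gt0 : (0 < d)%N.
Local Notation block_cost := (@block_cost R d dispA dispB A B rho).
Local Notation N := (fun n : nat => n%:R ^+ d : R).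

Lemma block_cost_le n x y : block_cost n x y <= M.
Proof.
have [->|n0] := posnP n.
  by rewrite block_costE expr0n gtn_eqF// invr0 mul0r ltW.
have N0 : 0 < n%:R ^+ d :> R by rewrite exprn_gt0// ltr0n.
rewrite block_costE ler_pdivrMl//.
apply: (@le_trans _ _ (\sum_(u <- box 0 n) M)); first exact: ler_sum.
by rewrite big_const_seq count_predT iter_addr_0 card_box -natrX -[leLHS]mulr_natl.
Qed.

Let mb n := measurable_block_cost mrho (d := d) n.
Let b0 n := @block_cost_ge0 R d _ _ A B rho rho0 n.

Lemma mean_block_cost_fin n : (mean_cost P Q (block_cost n) < +oo)%E.
Proof.
apply: (@le_lt_trans _ _ (\int[P]_x M%:E)%E); last by rewrite integral_prob_cst ltry.
apply: ge0_le_integral => //.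
- by move=> x _; apply: integral_ge0 => y _; rewrite lee_fin; exact: b0.
- exact: (measurable_mean_section Q (b0 n) (mb n)).
move=> x _; rewrite -(integral_prob_cst Q M); apply: ge0_le_integral => //.
- by move=> y _; rewrite lee_fin; exact: b0.
- by apply/measurable_EFinP; exact: (measurable_section (mb n)).
- by move=> y _; rewrite lee_fin; exact: block_cost_le.
Qed.

Definition mean_log_mgf (n : nat) (l : R) : R :=
  (N n)^-1 * log_mgf P Q (block_cost n) (N n * l).

Lemma scaled_le0 n l : l <= 0 -> N n * l <= 0.
Proof. by move=> l0; rewrite mulr_ge0_le0// exprn_ge0. Qed.

Lemma free_energy_block_ge n l x : l <= 0 ->
  N n * l * M <= free_energy Q (block_cost n) (N n * l) x.
Proof.
move=> l0; rewrite -ler_expR (expR_free_energy Q (b0 n) (mb n) x (scaled_le0 n l0)).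
rewrite -[leLHS](Rintegral_prob_cst Q); apply: le_Rintegral => //.
- exact: finite_measure_integrable_cst.
- exact: (integrable_expc Q (b0 n) (mb n) x (scaled_le0 n l0)).
- move=> y _; rewrite ler_expR ler_wnM2l ?scaled_le0//; exact: block_cost_le.
Qed.

(** Almost sure convergence passes to the mean, everything being bounded. *)
Lemma mean_log_mgf_cvg (l L : R) : l <= 0 ->
  {ae P, forall x, log_mgf_limit Q N (fun n => block_cost n x) l L} ->
  mean_log_mgf n l @[n --> \oo] --> L.
Proof.
move=> l0 hL; pose F n x := (N n)^-1 * free_energy Q (block_cost n) (N n * l) x.
have mF n : measurable_fun setT (fun x => (F n x)%:E).
  apply/measurable_EFinP; apply: measurable_funM => //.
  exact: (measurable_free_energy Q (mb n)).
have FL : {ae P, forall x, setT x -> (F n x)%:E @[n --> \oo] --> L%:E}.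
  by apply: filterS hL => x hx _; apply/fine_cvgP; split; [exact: nearW|].
have Fb : {ae P, forall x n, setT x -> (`|(F n x)%:E| <= (- l * M)%:E)%E}.
  apply: aeW => x n _; rewrite lee_fin /F.
  have [->|n0] := posnP n.
    by rewrite expr0n gtn_eqF// invr0 mul0r normr0 mulr_ge0 ?oppr_ge0// ltW.
  have N0 : 0 < N n by rewrite exprn_gt0// ltr0n.
  rewrite ler0_norm; last first.
    rewrite mulr_ge0_le0 ?invr_ge0 ?(ltW N0)//.
    exact: (free_energy_le0 Q (b0 n) (mb n) x (scaled_le0 n l0)).
  rewrite -mulrN ler_pdivrMl// mulNr mulrN lerN2 mulrA.
  exact: free_energy_block_ge.
have iM : P.-integrable setT (cst (- l * M)%:E) by exact: finite_measure_integrable_cst.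
have [_ _] := dominated_convergence measurableT mF (measurable_cst _) FL iM Fb.
rewrite integral_prob_cst => cv.
have mE n : (\int[P]_x (F n x)%:E = (mean_log_mgf n l)%:E)%E.
  have i1 := integrable_free_energy (b0 n) (mb n) (mean_block_cost_fin n) (scaled_le0 n l0).
  rewrite /mean_log_mgf -(RintegralZl _ measurableT i1) EFin_Rintegral//.
  exact: integrableZ_EFin.
have : (mean_log_mgf n l)%:E @[n --> \oo] --> L%:E.
  by apply: cvg_trans cv; apply: near_eq_cvg; apply: nearW => n; rewrite /= mE.
by move/fine_cvgP => [].
Qed.

Lemma mean_log_mgf_homo n a b : (0 < n)%N -> a <= b -> b <= 0 ->
  mean_log_mgf n a <= mean_log_mgf n b.
Proof.
move=> n0 ab bb; have N0 : 0 < N n by rewrite exprn_gt0// ltr0n.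
have a0 := le_trans ab bb.
rewrite /mean_log_mgf ler_pM2l; last by rewrite invr_gt0.
apply: le_Rintegral.
- exact: measurableT.
- exact: (integrable_free_energy (b0 n) (mb n) (mean_block_cost_fin n) (scaled_le0 n a0)).
- exact: (integrable_free_energy (b0 n) (mb n) (mean_block_cost_fin n) (scaled_le0 n bb)).
- move=> x _; apply: (free_energy_homo Q (b0 n) (mb n)); last exact: scaled_le0.
  by rewrite ler_pM2l.
Qed.

Local Notation Pn n := (law_on P (cube d n)).
Local Notation Qn n := (law_on Q (cube d n)).
Local Notation rhon n := (@rho_n R d _ _ A B rho n).

Let r0 n := @rho_n_ge0 R d _ _ A B rho rho0 n.
Let mr n := @measurable_rho_n R d _ _ A B rho mrho n.
Let rfin n : (mean_cost (Pn n) (Qn n) (rhon n) < +oo)%E.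
Proof. by rewrite mean_cost_restr//; exact: mean_block_cost_fin. Qed.

Lemma log_mgf_mean n l : (0 < n)%N -> l <= 0 ->
  log_mgf (Pn n) (Qn n) (rhon n) (N n * l) = N n * mean_log_mgf n l.
Proof.
move=> n0 l0; have N0 : 0 < N n by rewrite exprn_gt0// ltr0n.
rewrite /mean_log_mgf mulVKf ?gt_eqF//.
exact: (log_mgf_block rho0 mrho P Q n (scaled_le0 n l0)).
Qed.

Lemma rate_n_ge n l D : (0 < n)%N -> l <= 0 ->
  ((l * D - mean_log_mgf n l)%:E <= rate_n rho P Q n D)%E.
Proof.
move=> n0 l0; have N0 : 0 < N n by rewrite exprn_gt0// ltr0n.
rewrite rate_nE// lee_pdivlMl// -EFinM mulrBr mulrA.
rewrite -log_mgf_mean//; exact: (min_entropy_ge (@r0 n) (@mr n) (rfin n) D (scaled_le0 n l0)).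
Qed.

Hypotheses (P_stat : stationary P) (Q_stat : stationary Q).

Lemma rate_n_attained n l1 D : (0 < n)%N -> l1 < 0 -> l1 * D - mean_log_mgf n l1 < 0 ->
  (D%:E < site_cost rho P Q)%E ->
  exists l, [/\ l1 <= l, l <= 0 & rate_n rho P Q n D = (l * D - mean_log_mgf n l)%:E].
Proof.
move=> n0 l10 l1D Dav; have N0 : 0 < N n by rewrite exprn_gt0// ltr0n.
have Dn : (D%:E < mean_cost (Pn n) (Qn n) (rhon n))%E.
  by rewrite mean_cost_restr// mean_cost_block.
have Nl1 : N n * l1 < 0 by rewrite pmulr_rlt0.
have h1 : N n * l1 * D - log_mgf (Pn n) (Qn n) (rhon n) (N n * l1) < 0.
  by rewrite (log_mgf_mean n0 (ltW l10)) -mulrA -mulrBr pmulr_rlt0.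
have [l [l1l l0 _ minD]] := min_entropy_dual (@r0 n) (@mr n) (rfin n) Dn Nl1 h1.
have l0' : (N n)^-1 * l <= 0 by rewrite pmulr_rle0 ?invr_gt0// ltW.
exists ((N n)^-1 * l); split => //; first by rewrite ler_pdivlMl.
have lE : N n * ((N n)^-1 * l) = l by rewrite mulVKf// gt_eqF.
rewrite rate_nE// minD -{2}lE (log_mgf_mean n0 l0') -EFinM; congr EFin.
by rewrite mulrBr mulrA mulKf// gt_eqF.
Qed.

(** The conditional principle is stated for the restriction of [x] to the
    orthant, which contains all the blocks [C(n)]. *)
Lemma quenched_LDP (I : R -> \bar R) : conditional_LDP rho P Q I ->
  {ae P, forall x, LDP d Q (fun n y => block_cost n x y) I}.
Proof.
move=> [E [mE PE0 sE]]; exists (restr (orthant d) @^-1` E); split.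
- by rewrite -[X in measurable X]setTI; exact: measurable_reindex.
- exact: PE0.
move=> x /= nx; apply: sE => /= h; apply: nx; move: h; congr LDP.
by apply/funext => n; apply/funext => y; rewrite -rho_n_restr.
Qed.

Variable I : R -> \bar R.
Hypothesis I0 : forall z, (0 <= I z)%E.
Hypothesis I_convex : convex_rate I.
Hypothesis I_ldp : conditional_LDP rho P Q I.
Local Notation L := (dual_rate I).

Let mZ x n : measurable_fun setT (block_cost n x).
Proof. exact: (measurable_section (mb n)). Qed.

Let Z0 x n y : 0 <= block_cost n x y. Proof. exact: b0. Qed.

Lemma quenched_log_mgf l : l <= 0 ->
  {ae P, forall x, log_mgf_limit Q N (fun n => block_cost n x) l (L l)}.
Proof.
move=> l0; apply: filterS (quenched_LDP I_ldp) => x hx.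
exact: (dual_rate_limit d_gt0 (mZ x) (Z0 x) (fun n y => block_cost_le n x y) I0 hx M0 l0).
Qed.

Lemma exists_LDP_point : exists x, LDP d Q (fun n y => block_cost n x y) I.
Proof.
have [E [mE PE sE]] := quenched_LDP I_ldp.
apply: contrapT => nx; have : P setT = 0%E.
  by rewrite -PE; congr (P _); apply/seteqP; split=> // x _; apply: sE => hx; apply: nx; exists x.
rewrite probability_setT => /eqP; rewrite onee_eq0.
by [].
Qed.

(** The rate function takes values arbitrarily close to [0]. *)
Lemma dual_rate0 : L 0 = 0.
Proof.
have [x hx] := exists_LDP_point; apply/eqP; rewrite eq_le; apply/andP; split.
  exact: (dual_rate_le0 (mZ x) (Z0 x) I0 hx (lexx 0)).
rewrite leNgt; apply/negP => L0.
have e0 : 0 < - L 0 / 2 by rewrite divr_gt0// oppr_gt0.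
have [z] := exists_rate_le (mZ x) hx e0.
have := dual_rate_young (mZ x) (Z0 x) I0 hx z (lexx 0).
rewrite mul0r sub0r => h1 /(le_trans h1); rewrite lee_fin.
rewrite ler_pdivlMr// ger_pMr ?oppr_gt0//.
by rewrite leNgt ltr1n.
Qed.

(** Finite rates at some level [D'] below [D] bound the dual objectives at [D']
    uniformly in [n]. At [D] they are then negative for all slopes below [- K],
    with [K] independent of [n]. *)
Lemma D_min_oo_slack (D : R) : (D_min_oo rho P Q < D%:E)%E ->
  exists D' C, [/\ D' < D, 0 <= D' & forall n l, (0 < n)%N -> l <= 0 ->
    l * D' - mean_log_mgf n l <= C].
Proof.
move=> /ereal_inf_lt[_ [D' [D'0 supD'] <-]]; rewrite lte_fin => D'D.
pose s := ereal_sup [set rate_n rho P Q n D' | n in [set n | (0 < n)%N]].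
have sn n : (0 < n)%N -> (rate_n rho P Q n D' <= s)%E.
  by move=> n0; apply: ereal_sup_ubound; exists n.
have s0 : (0 <= s)%E.
  apply: le_trans (sn 1%N isT); have := rate_n_ge D' (ltn0Sn 0) (lexx 0).
  by rewrite mul0r sub0r /mean_log_mgf mulr0 log_mgf0 mulr0 oppr0.
have sfin : s \is a fin_num by rewrite ge0_fin_numE.
exists D', (fine s); split=> // n l n0 l0.
by rewrite -lee_fin fineK//; apply: le_trans (sn n n0); exact: rate_n_ge.
Qed.

(** The quenched decay rate of the matching probability is the limit of the
    annealed rates: both are the Legendre transform of [L] at [D]. *)
Lemma bounded_decay_rate (D : R) : (D_min_oo rho P Q < D%:E)%E ->
  (D%:E < site_cost rho P Q)%E ->
  exists r : R, [/\ 0 <= r, rate_n rho P Q n D @[n --> \oo] --> r%:E &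
    {ae P, forall x, decay_rate N (ball_prob Q (fun n => block_cost n x) D) r}].
Proof.
move=> Dmin Dav; have [D' [C [D'D D'0 bnd]]] := D_min_oo_slack Dmin.
have gap : 0 < D - D' by rewrite subr_gt0.
pose K := (C + 1) / (D - D').
have C0 : 0 <= C.
  have := bnd 1%N 0 isT (lexx 0).
  by rewrite mul0r sub0r /mean_log_mgf mulr0 log_mgf0 mulr0 oppr0.
have K0 : 0 < K by rewrite divr_gt0// ltr_wpDl.
have neg n : (0 < n)%N -> - K * D - mean_log_mgf n (- K) < 0.
  move=> n0; have nK : - K <= 0 by rewrite oppr_le0 ltW.
  have := bnd n (- K) n0 nK.
  have : K * (D - D') = C + 1 by rewrite /K divfK// gt_eqF.
  exact: steep_value.
pose rt n := fine (rate_n rho P Q n D).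
have nK : - K < 0 by rewrite oppr_lt0.
have att n : (0 < n)%N -> exists l, [/\ - K <= l, l <= 0 & rt n = l * D - mean_log_mgf n l].
  move=> n0; have [l [Kl l0 rl]] := rate_n_attained n0 nK (neg n n0) Dav.
  by exists l; rewrite /rt rl.
have fin n : (0 < n)%N -> (rt n)%:E = rate_n rho P Q n D.
  by move=> n0; have [l [_ _ rl]] := rate_n_attained n0 nK (neg n n0) Dav; rewrite /rt rl.
have ge n l : (0 < n)%N -> l <= 0 -> l * D - mean_log_mgf n l <= rt n.
  by move=> n0 l0; rewrite -lee_fin fin//; exact: rate_n_ge.
have cvL l : l <= 0 -> mean_log_mgf n l @[n --> \oo] --> L l.
  by move=> l0; apply: mean_log_mgf_cvg => //; exact: quenched_log_mgf.
have D0 : 0 <= D by rewrite (le_trans D'0)// ltW.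
have cvr := dual_exponent_cvg D'D D0 mean_log_mgf_homo cvL dual_rate0 bnd ge att.
pose r := dual_exponent L D; exists r.
have rge := dual_exponent_ge D'D cvL bnd.
have radh := dual_exponent_adherent D'D cvL bnd.
split.
- exact: (dual_exponent_ge0 D'D cvL dual_rate0 bnd).
- have : (rt n)%:E @[n --> \oo] --> r%:E by apply/fine_cvgP; split; [exact: nearW|].
  apply: cvg_trans; apply: near_eq_cvg; exists 1%N => // n /= n0; exact: fin.
apply: filterS (quenched_LDP I_ldp) => x hx e e0.
have e2 : 0 < e / 2 by rewrite divr_gt0.
have Nev : \forall n \near \oo, 0 < N n.
  by exists 1%N => // n /= n0; rewrite exprn_gt0// ltr0n.
have up : \forall n \near \oo,
    ball_prob Q (fun n => block_cost n x) D n <= expR (- (N n * (r - e))).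
  have [l l0 hl] := radh _ e2.
  have limx := dual_rate_limit d_gt0 (mZ x) (Z0 x) (fun n y => block_cost_le n x y) I0 hx M0 l0.
  have := decay_upper Nev (mZ x) (Z0 x) D l0 limx e2.
  apply: filterS2 Nev => n Nn /le_trans; apply; rewrite ler_expR lerN2 ler_pM2l//.
  exact: exponent_slack hl.
have low : \forall n \near \oo,
    expR (- (N n * (r + e))) <= ball_prob Q (fun n => block_cost n x) D n.
  (* The open half line below [D] has a point where the rate function is nearly
     [r]. *)
  have [z zD Iz] : exists2 z, z < D & (I z <= (r + e / 2)%:E)%E.
    apply: (rate_below I0 I_convex _ D'D (limit_bound cvL bnd) rge).
    - by exact: (dual_values_neq0 (mZ x) I0 hx).
    - exact: C0.
    - by rewrite ltrDl.
    - exact: (dual_exponent_ge0 D'D cvL dual_rate0 bnd).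
  have mG : measurable [set t : R | t < D] by apply: open_measurable; exact: open_lt.
  have := ldp_lower (mZ x) hx mG (@open_lt _ D) zD Iz e2.
  apply: filterS => n; rewrite -opprD -addrA -splitr mulrN => /le_trans; apply.
  rewrite -match_ball_prob//; have mE := measurable_match_at mrho D n x.
  have mF : measurable (block_cost n x @^-1` [set t | t < D]).
    by rewrite -[X in measurable X]setTI; exact: mZ.
  apply: fine_le; rewrite ?fin_num_measure//; apply: le_measure; rewrite ?inE//.
  by move=> y /= yD; exact: ltW.
by apply: filterS2 up low => n -> ->.
Qed.

End bounded_cost.

(** * Decoupling under phi-mixing *)

Section phi_mixing_decoupling.
Context {R : realType} {d : nat} {disp : measure_display} {T : measurableType disp}.
Local Notation Y := (config (lattice d) T).
Variable Q : probability Y R.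
Hypothesis d_gt0 : (0 < d)%N.

Lemma phi_mixing_ge0 l k : (0 <= phi_mixing Q l k)%E.
Proof.
apply: ereal_sup_ubound; exists fset0, fset0, setT, setT; split.
- by apply: events_on_depends => //; move=> y; split.
- by apply: events_on_depends => //; move=> y; split.
- by rewrite probability_setT.
- split; first by rewrite cardfs0.
  by apply: le_ereal_inf_tmp => r [v [w [v0 _ _]]]; move: v0; rewrite /= in_fset0.
- by rewrite setIT fine_probability_setT divr1 subrr normr0.
Qed.

(** When [F] has positive probability this is the definition of the coefficient,
    with [F] as the conditioning event; otherwise both sides vanish. *)
Lemma phi_mixing_pair (U V : {fset lattice d}) (k : nat) (G F : set Y) :
  measurable G -> measurable F -> depends_on [set` U] G -> depends_on [set` V] F ->
  (forall u v, u \in U -> v \in V -> (k <= ldist u v)%N) ->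
  phi_mixing Q #|` U| k \is a fin_num ->
  fine (Q (G `&` F)) <= fine (Q F) * (fine (Q G) + fine (phi_mixing Q #|` U| k)).
Proof.
move=> mG mF UG VF UV fin.
have mGF : measurable (G `&` F) by exact: measurableI.
have [F0|F0] := leP (fine (Q F)) 0.
  have F0' : fine (Q F) = 0 by apply/eqP; rewrite eq_le F0 fine_ge0.
  rewrite F0' mul0r -F0'; apply: fine_le; rewrite ?fin_num_measure//.
  by apply: le_measure; rewrite ?inE// => y [].
have QF : (0 < Q F)%E by rewrite -[Q F]fineK ?fin_num_measure.
have : (`|fine (Q (G `&` F)) / fine (Q F) - fine (Q G)|%:E <= phi_mixing Q #|` U| k)%E.
  apply: ereal_sup_ubound; exists U, V, G, F; split => //.
  - exact: events_on_depends.
  - exact: events_on_depends.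
  split => //; apply: le_ereal_inf_tmp => _ [u [v [uU vV ->]]].
  by rewrite lee_fin ler_nat; exact: UV.
rewrite -[X in (_ <= X)%E]fineK// lee_fin => /(le_trans (ler_norm _)).
by rewrite lerBlDl ler_pdivrMr// [X in _ <= X]mulrC.
Qed.

(** Of the distance [2 n^d j] between the corners at most [n <= n^d] is lost
    inside the blocks. *)
Lemma boxes_apart (u v u' v' : lattice d) n j : (0 < n)%N -> (0 < j)%N ->
  (2 * n ^ d * j <= ldist u v)%N -> u' \in box u n -> v' \in box v n ->
  (j * n ^ d <= ldist u' v')%N.
Proof.
move=> n0 j0 uv uu' vv'.
have nN : (n <= n ^ d)%N by rewrite -[leqLHS]expn1 leq_pexp2l.
suff : (ldist u v <= ldist u' v' + n)%N.
  move: uv nN j0; move: (n ^ d)%N (ldist u v) (ldist u' v') => a b c; clear; nia.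
rewrite ldist_leP; apply/forallP => i.
have : (ldist u' v' <= ldist u' v')%N by [].
rewrite {1}ldist_leP => /forallP/(_ i); move: uu' vv'; rewrite !in_box.
move=> /forallP/(_ i) h1 /forallP/(_ i) h2; move: h1 h2; move: (ldist u' v') => c.
by move: (u ord0 i) (v ord0 i) (u' ord0 i) (v' ord0 i); clear; lia.
Qed.

(** Blocks have [n^d] sites and are at distance at least [j n^d], so the
    hypothesis applies at the integer [n^d] in place of [n]. *)
Lemma phi_mixing_decoupled :
  (limn_esup (fun n => \sum_(1 <= j <oo)
     ((j.+1%:R ^+ d.-1)%:E * phi_mixing Q n (j * n))) < +oo)%E ->
  exists psi C, (forall n j, 0 <= psi n j :> R) /\
  \forall n \near \oo, (forall u v j (G F : set Y), (0 < j)%N ->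
      (2 * n ^ d * j <= ldist u v)%N -> measurable G -> measurable F ->
      depends_on [set` box u n] G -> depends_on [set` box v n] F ->
      fine (Q (G `&` F)) <= fine (Q F) * (fine (Q G) + psi n j)) /\
    (forall m, \sum_(1 <= j < m) j.+1%:R ^+ d.-1 * psi n j <= C).
Proof.
move=> phioo; pose psi n j := fine (phi_mixing Q (n ^ d) (j * n ^ d)).
have [C hC] : exists C : R, \forall n \near \oo, (\sum_(1 <= j <oo)
     ((j.+1%:R ^+ d.-1)%:E * phi_mixing Q n (j * n)) < C%:E)%E.
  have [C hC] : exists C : R, (limn_esup (fun n => \sum_(1 <= j <oo)
     ((j.+1%:R ^+ d.-1)%:E * phi_mixing Q n (j * n))) < C%:E)%E.
    case: (limn_esup _) phioo => // [r _|_]; last by exists 0; rewrite ltNye.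
    by exists (r + 1); rewrite lte_fin ltrDl.
  by exists C; exact: limn_esup_lt.
exists psi, C; split; first by move=> n j; apply: fine_ge0; exact: phi_mixing_ge0.
have hC' : \forall n \near \oo, (\sum_(1 <= j <oo)
     ((j.+1%:R ^+ d.-1)%:E * phi_mixing Q (n ^ d)%N (j * n ^ d)) < C%:E)%E.
  case: hC => n0 _ h; exists (maxn n0 1) => // n /=; rewrite geq_max => /andP[nn0 n1].
  apply: h => /=; apply: leq_trans nn0 _.
  by rewrite -[leqLHS]expn1 leq_pexp2l.
near=> n; have n0 : (0 < n)%N by near: n; exists 1%N.
have Cn : (\sum_(1 <= j <oo)
     ((j.+1%:R ^+ d.-1)%:E * phi_mixing Q (n ^ d)%N (j * n ^ d)) < C%:E)%E by near: n.
have t0 j : (0 <= (j.+1%:R ^+ d.-1)%:E * phi_mixing Q (n ^ d)%N (j * n ^ d))%E.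
  by rewrite mule_ge0 ?phi_mixing_ge0// lee_fin exprn_ge0.
have partial m : (\sum_(1 <= j < m)
     ((j.+1%:R ^+ d.-1)%:E * phi_mixing Q (n ^ d)%N (j * n ^ d)) <= C%:E)%E.
  apply: le_trans (ltW Cn); apply: nneseries_lim_ge => j _ _; exact: t0.
have fin j : (0 < j)%N -> phi_mixing Q (n ^ d)%N (j * n ^ d) \is a fin_num.
  move=> j0; rewrite ge0_fin_numE ?phi_mixing_ge0//.
  have : ((j.+1%:R ^+ d.-1)%:E * phi_mixing Q (n ^ d)%N (j * n ^ d) <= C%:E)%E.
    apply: le_trans (partial j.+1); rewrite big_nat_recr//= leeDr//.
    by apply: sume_ge0 => i _; exact: t0.
  apply: contraTT; rewrite -leNgt leye_eq => /eqP ->.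
  by rewrite gt0_muley ?lte_fin ?exprn_gt0// -ltNge ltry.
split=> [u v j G F j0 uv mG mF uG vF|m].
  have cb : #|` box u n| = (n ^ d)%N by rewrite card_box.
  rewrite /psi -cb; apply: phi_mixing_pair mG mF uG vF _ _; last by rewrite cb; exact: fin.
  by move=> u' v' uu' vv'; rewrite cb; exact: boxes_apart uv uu' vv'.
have := partial m; rewrite -lee_fin; apply: le_trans.
rewrite -sumEFin !big_nat; apply: lee_sum => j /andP[j1 _].
by rewrite EFinM /psi fineK// fin.
Unshelve. all: by end_near. Qed.

End phi_mixing_decoupling.

(** * Waiting times for matches between random fields *)

Theorem theorem29 (R : realType) (d : nat) (d_ge2 : (2 <= d)%N)
    (A B : completeMetricType R) (sepA : separable A) (sepB : separable B)
    (rho : borel A -> borel B -> R)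
    (rho_ge0 : forall a b, 0 <= rho a b)
    (rho_meas : measurable_fun [set: borel A * borel B]
                  (fun z => rho z.1 z.2))
    (disp : measure_display) (Omega : measurableType disp)
    (Pr : probability Omega R)
    (X : {RV Pr >-> config (lattice d) (borel A)})
    (Y : {RV Pr >-> config (lattice d) (borel B)})
    (P := distribution Pr X) (Q := distribution Pr Y)
    (X_stat : stationary P) (X_erg : ergodic P)
    (Y_stat : stationary Q) (Y_erg : ergodic Q)
    (XY_indep : independent_fields X Y) :
  (iid Q ->
   (D_av rho P Q < +oo)%E ->
   (D_min rho P Q 1 < D_av rho P Q)%E ->
   forall D : R, (D_min rho P Q 1 < D%:E < D_av rho P Q)%E ->
     {ae Pr, forall w,
       log_waiting rho D (X w) (Y w) n @[n --> \oo] --> rate_n rho P Q 1 D})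
  /\
  ((exists M : R, forall a b, rho a b <= M) ->
   (exists I : R -> \bar R,
      [/\ rate_function I, convex_rate I & conditional_LDP rho P Q I]) ->
   (limn_esup (fun n => \sum_(1 <= j <oo)
      ((j.+1%:R ^+ d.-1)%:E * phi_mixing Q n (j * n))) < +oo)%E ->
   (D_min_sup rho P Q < D_av rho P Q)%E ->
   forall D : R, (D_min_oo rho P Q < D%:E < D_av rho P Q)%E ->
     cvgn (fun n => rate_n rho P Q n D) /\
     {ae Pr, forall w,
       log_waiting rho D (X w) (Y w) n @[n --> \oo] -->
         limn (fun n => rate_n rho P Q n D)}).
Proof.
have d_gt0 : (0 < d)%N by exact: leq_trans d_ge2.
split=> [Q_iid Dav _ D|[M0 rhoM0] [I [[I0 _] I_convex I_ldp]] phi _ D] /andP[Dmin DavD].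
- rewrite (D_avE rho_ge0 rho_meas X_stat Y_stat) in Dav DavD.
  have [r [r0 rateE hrate]] := iid_decay_rate rho_ge0 rho_meas X_stat X_erg Y_stat
    d_gt0 Q_iid Dav Dmin DavD.
  rewrite rateE.
  exact: (log_waiting_cvg (psi := fun _ _ => 0) (C := 0)
    rho_meas XY_indep Y_stat d_gt0 r0 hrate
    (fun _ _ => lexx 0) (iid_decoupled d_gt0 Q_iid)).
- rewrite (D_avE rho_ge0 rho_meas X_stat Y_stat) in DavD.
  pose M := `|M0| + 1.
  have Mp : 0 < M by rewrite ltr_wpDl.
  have rhoM a b : rho a b <= M.
    by rewrite (le_trans (rhoM0 a b))// (le_trans (ler_norm _))// lerDl.
  have [r [r0 rateE hrate]] := bounded_decay_rate rho_ge0 rho_meas Mp rhoM d_gt0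
    X_stat Y_stat I0 I_convex I_ldp Dmin DavD.
  have [psi [C [psi0 hpair]]] := phi_mixing_decoupled d_gt0 phi.
  split; first by apply/cvg_ex; exists r%:E.
  rewrite (cvg_lim _ rateE)//.
  exact: (log_waiting_cvg rho_meas XY_indep Y_stat d_gt0 r0 hrate psi0 hpair).
Qed.
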